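(* Let $0<c_{\min}\le c_{\max}<\infty$. There exist constants $C>0$ and $\alpha>1$ depending only on $c_{\min},c_{\max}$ such that the following holds. Let $d=3$, let $\omega\ge\omega_0>0$, let $n\in\mathbb N$ and $0=x_0<x_1<\dots<x_{n+1}=1$ be arbitrary, let $c_1,c_2\in[c_{\min},c_{\max}]$, and let the wave speed on the unit ball $\Omega\subset\mathbb R^3$ be $c(\mathbf x)=c_j$ for $|\mathbf x|\in(x_{j-1},x_j)$, $1\le j\le n+1$, where $c_j=c_1$ if $j$ is odd and $c_j=c_2$ if $j$ is even. Let $\hat g_0\in\mathbb C$ and let $u$ be the solution of $$-\Delta u-\left(\frac{\omega}{c}\right)^2u=0\ \text{ in }\Omega,\qquad \frac{\partial u}{\partial n}-T_{\omega/c_{n+1}}u=g\ \text{ on }\Gamma=\partial\Omega,$$ with boundary data $g(\boldsymbol\xi)=\hat g_0\,Y_{0,\mathbf 0}(\boldsymbol\xi)$, $\boldsymbol\xi\in\Gamma$. Then $$\|u\|_{\mathcal H}\le C\,|\hat g_0|\,\alpha^{\omega},$$ and for all $r\in(0,1)$ and $\boldsymbol\xi\in\mathbb S_2$, $$|u(r\boldsymbol\xi)|\le C\,\alpha^\omega|\hat g_0|,\qquad |\nabla u(r\boldsymbol\xi)|\le C\,r\,\alpha^\omega|\hat g_0|.$$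
   Context: $\Omega=\{\mathbf x\in\mathbb R^3:|\mathbf x|<1\}$, $\Gamma=\partial\Omega=\mathbb S_2$, and $\partial/\partial n$ is the derivative in the direction of the outward normal of $\Omega$. The energy norm is $\|u\|_{\mathcal H}=\left(\|\nabla u\|_{L^2(\Omega)}^2+\|\tfrac{\omega}{c}u\|_{L^2(\Omega)}^2\right)^{1/2}$ on $H^1(\Omega)$. $Y_{0,\mathbf 0}=|\Gamma|^{-1/2}$ is the constant $L^2(\Gamma)$-normalized spherical harmonic. Dirichlet-to-Neumann operator: for $\kappa>0$ and $\tilde g\in H^{1/2}(\Gamma)$ let $w\in H^1_{\mathrm{loc}}(\mathbb R^3\setminus\overline\Omega)$ be the unique weak solution of $(-\Delta-\kappa^2)w=0$ in $\mathbb R^3\setminus\overline\Omega$, $w=\tilde g$ on $\Gamma$, with the Sommerfeld radiation condition $\left|\langle \mathbf x/|\mathbf x|,\nabla w(\mathbf x)\rangle-\mathrm i\kappa w(\mathbf x)\right|=o(|\mathbf x|^{-1})$ as $|\mathbf x|\to\infty$. Then $T_\kappa\tilde g:=\partial w/\partial n\in H^{-1/2}(\Gamma)$. The boundary value problem is well-posed (has a unique weak solution in $H^1(\Omega)$). *)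

(* Defs.v *)
From HB Require Import structures.
From mathcomp Require Export all_boot all_order all_algebra.
From mathcomp Require Export all_classical all_reals all_analysis.
From mathcomp Require Export measurable_realfun.
From mathcomp.real_closed Require Export complex.
Export numFieldNormedType.Exports.

Set Implicit Arguments.
Unset Strict Implicit.
Unset Printing Implicit Defensive.

Import Order.TTheory GRing.Theory Num.Theory.

Local Open Scope classical_set_scope.
Local Open Scope ring_scope.
Local Open Scope complex_scope.

Section Helmholtz.
Context {R : realType}.

Local Notation R3 := (R * R * R)%type.

(* [lebesgue_measure] with its domain retyped to [set R], so that products live
   on [R3] with the canonical product (Borel) sigma-algebra. *)
Definition leb1 : set R -> \bar R := @lebesgue_measure R.

HB.instance Definition _ := isMeasure.Build _ R R leb1
  (measure0 (@lebesgue_measure R)) (measure_ge0 (@lebesgue_measure R))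
  (@measure_semi_sigma_additive _ _ _ (@lebesgue_measure R)).

Lemma leb1_sigma_finite : sigma_finite setT leb1.
Proof. exact: (@sigma_finiteT _ _ _ (@lebesgue_measure R)). Qed.

HB.instance Definition _ :=
  @Measure_isSigmaFinite.Build _ _ _ leb1 leb1_sigma_finite.

Definition leb3 : set R3 -> \bar R := ((leb1 \x leb1) \x leb1)%E.

HB.instance Definition _ := Measure.on leb3.

(* The norm of the normed module [R * R * R] is the sup norm; [enorm] is the
   Euclidean one. *)
Definition enorm (x : R3) : R :=
  Num.sqrt (x.1.1 ^+ 2 + x.1.2 ^+ 2 + x.2 ^+ 2).

Definition coord (x : R3) (i : 'I_3) : R :=
  [:: x.1.1; x.1.2; x.2]`_i.

Definition basis (i : 'I_3) : R3 :=
  ((i == 0%N :> nat)%:R, (i == 1%N :> nat)%:R, (i == 2%N :> nat)%:R).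

Definition ball1 : set R3 := [set x | enorm x < 1].
Definition sphere : set R3 := [set x | enorm x = 1].
Definition exterior : set R3 := [set x | 1 < enorm x].
Definition shell (rho : R) : set R3 :=
  [set x | 1 < enorm x < rho].

Definition cfun := R3 -> R[i].
Definition cfield := 'I_3 -> cfun.

Definition cmeasurable (D : set R3) (f : cfun) : Prop :=
  measurable_fun D (fun x => complex.Re (f x)) /\
  measurable_fun D (fun x => complex.Im (f x)).

Definition cint (D : set R3) (f : cfun) : R[i] :=
  (\int[leb3]_(x in D) complex.Re (f x))%R +i*
  (\int[leb3]_(x in D) complex.Im (f x))%R.

Definition sqnorm2 (D : set R3) (f : cfun) : \bar R :=
  (\int[leb3]_(x in D) ((Normc.normc (f x)) ^+ 2)%:E)%E.

Definition L2 (D : set R3) (f : cfun) : Prop :=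
  cmeasurable D f /\ (sqnorm2 D f < +oo)%E.

Definition dotc (a b : 'I_3 -> R[i]) : R[i] := \sum_(i < 3) a i * b i.

Definition vnorm (a : 'I_3 -> R[i]) : R :=
  Num.sqrt (\sum_(i < 3) (Normc.normc (a i)) ^+ 2).

Definition cpartial (f : cfun) : cfield := fun i x =>
  ('D_(basis i) (fun y => complex.Re (f y)) x) +i*
  ('D_(basis i) (fun y => complex.Im (f y)) x).

(* The surface measure of the unit sphere is
   [sigma A = 3 * leb3 {x | 0 < |x| < 1 /\ x / |x| \in A}], so that
   [dx = r ^ 2 dr dsigma]. *)
Definition radial_proj (x : R3) : R3 := (enorm x)^-1 *: x.

Definition punctured_ball : set R3 := [set x | 0 < enorm x < 1].

Definition surf_cint (f : cfun) : R[i] :=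
  3%:R * cint punctured_ball (f \o radial_proj).

Definition surf_sqnorm2 (f : cfun) : \bar R :=
  (3%:R%:E * sqnorm2 punctured_ball (f \o radial_proj))%E.

Definition sphere_area : R :=
  3%:R * fine (leb3 punctured_ball).

Definition Y00 : cfun := fun _ => ((Num.sqrt sphere_area)^-1)%:C.

Fixpoint Ck (k : nat) (f : R3 -> R) : Prop :=
  continuous f /\
  if k is k'.+1 then
    forall i : 'I_3, (forall x, derivable f x (basis i)) /\
                     Ck k' (fun x => 'D_(basis i) f x)
  else True.

Definition smooth (f : R3 -> R) : Prop := forall k, Ck k f.

Definition csmooth (f : cfun) : Prop :=
  smooth (fun x => complex.Re (f x)) /\ smooth (fun x => complex.Im (f x)).

Definition test_function (D : set R3) (phi : cfun) : Prop :=
  csmooth phi /\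
  exists K : set R3,
    [/\ compact K, K `<=` D & forall x, ~ K x -> phi x = 0].

Definition weak_gradient (D : set R3) (u : cfun) (Du : cfield) :
    Prop :=
  forall phi, test_function D phi -> forall i : 'I_3,
    cint D (fun x => u x * cpartial phi i x) =
    - cint D (fun x => Du i x * phi x).

(* A Sobolev function is carried along with (a representative of) its weak
   gradient. *)
Definition H1 (D : set R3) (u : cfun) (Du : cfield) : Prop :=
  [/\ L2 D u, forall i, L2 D (Du i) & weak_gradient D u Du].

(* H^1_loc of the closure of the exterior domain: H^1 near the sphere. *)
Definition H1loc_ext (w : cfun) (Dw : cfield) : Prop :=
  forall rho : R, 1 < rho -> H1 (shell rho) w Dw.

(* [h] is the trace on the unit sphere of [u] in H^1(D), for [D] a bounded
   domain, lying locally on one side of its smooth boundary, whose boundary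
   contains the unit sphere: the trace operator is the continuous extension of
   the restriction of functions smooth up to the boundary. *)
Definition trace (D : set R3) (u : cfun) (Du : cfield) (h : cfun) :
    Prop :=
  cmeasurable sphere h /\
  exists phi : nat -> cfun,
    [/\ forall k, csmooth (phi k),
        sqnorm2 D (fun x => phi k x - u x) @[k --> \oo] --> 0%E,
        forall i : 'I_3,
          sqnorm2 D (fun x => cpartial (phi k) i x - Du i x) @[k --> \oo]
            --> 0%E &
        surf_sqnorm2 (fun x => phi k x - h x) @[k --> \oo] --> 0%E].

Definition trace_ext (w : cfun) (Dw : cfield) (h : cfun) : Prop :=
  forall rho : R, 1 < rho -> trace (shell rho) w Dw h.

Definition sommerfeld (kappa : R) (w : cfun) (Dw : cfield) : Prop :=
  forall eps : R, 0 < eps -> exists rho : R,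
    {ae leb3, forall x, 1 < enorm x -> rho < enorm x ->
       Normc.normc (\sum_(i < 3) (coord x i / enorm x)%:C * Dw i x
                    - (0 +i* kappa) * w x)
         <= eps / enorm x}.

Definition helmholtz_ext (kappa : R) (w : cfun) (Dw : cfield) : Prop :=
  forall phi, test_function exterior phi ->
    cint exterior (fun x => dotc (Dw ^~ x) (cpartial phi ^~ x)
                            - (kappa ^+ 2)%:C * w x * phi x) = 0.

Definition exterior_solution (kappa : R) (h w : cfun) (Dw : cfield) : Prop :=
  [/\ H1loc_ext w Dw, helmholtz_ext kappa w Dw, trace_ext w Dw h &
      sommerfeld kappa w Dw].

(* Elements of H^{-1/2} of the sphere are represented by the (bilinear)
   duality pairing with traces [eta].  The normal derivative of an exterior
   solution is defined by Green's formula; the sign is due to the normal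
   pointing out of the ball, hence into the exterior domain. *)
Definition normal_derivative (kappa : R) (w : cfun) (Dw : cfield)
    (F : cfun -> R[i]) : Prop :=
  forall (v : cfun) (Dv : cfield) (eta : cfun),
    H1loc_ext v Dv ->
    (exists rho : R, forall x, rho < enorm x ->
       v x = 0 /\ forall i, Dv i x = 0) ->
    trace_ext v Dv eta ->
    F eta = - cint exterior (fun x => dotc (Dw ^~ x) (Dv ^~ x)
                                      - (kappa ^+ 2)%:C * w x * v x).

(* [F] represents [T_kappa h]. *)
Definition is_DtN (kappa : R) (h : cfun) (F : cfun -> R[i]) : Prop :=
  exists (w : cfun) (Dw : cfield),
    exterior_solution kappa h w Dw /\ normal_derivative kappa w Dw F.

(* Weak form of [- Delta u - (omega / c)^2 u = 0] in the unit ball with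
   [du/dn - T_kappa u = g] on the unit sphere. *)
Definition weak_solution (omega kappa : R) (c : R3 -> R) (g : cfun)
    (u : cfun) (Du : cfield) : Prop :=
  H1 ball1 u Du /\
  exists (h : cfun) (F : cfun -> R[i]),
    [/\ trace ball1 u Du h, is_DtN kappa h F &
        forall (v : cfun) (Dv : cfield) (eta : cfun),
          H1 ball1 v Dv -> trace ball1 v Dv eta ->
          cint ball1 (fun x => dotc (Du ^~ x) (Dv ^~ x)
                               - ((omega / c x) ^+ 2)%:C * u x * v x)
            - F eta
          = surf_cint (fun x => g x * eta x)].

(* [u] is *the* solution: well-posedness of the boundary value problem is
   taken for granted, so uniqueness a.e. is part of the predicate. *)
Definition the_weak_solution (omega kappa : R) (c : R3 -> R) (g : cfun)
    (u : cfun) (Du : cfield) : Prop :=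
  weak_solution omega kappa c g u Du /\
  forall (v : cfun) (Dv : cfield), weak_solution omega kappa c g v Dv ->
    {ae leb3, forall x, ball1 x -> v x = u x}.

Definition energy_norm (omega : R) (c : R3 -> R) (u : cfun)
    (Du : cfield) : \bar R :=
  sqrte (\sum_(i < 3) sqnorm2 ball1 (Du i)
         + sqnorm2 ball1 (fun x => ((omega / c x)%:C * u x)%R))%E.

Definition C1_on (D : set R3) (f : R3 -> R) : Prop :=
  forall x, D x -> {for x, continuous f} /\
    forall i : 'I_3, derivable f x (basis i) /\
      {for x, continuous (fun y => 'D_(basis i) f y)}.

(* The representative of class C^1 in the open set [D] of an a.e.-class. *)
Definition C1_representative (D : set R3) (u ut : cfun) : Prop :=
  [/\ C1_on D (fun x => complex.Re (ut x)),
      C1_on D (fun x => complex.Im (ut x)) &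
      {ae leb3, forall x, D x -> ut x = u x}].

Definition layer_value (c1 c2 : R) (j : nat) : R := if odd j then c1 else c2.

(* The values of the wave speed on the interfaces (a null set) are
   irrelevant. *)
Definition layered (n : nat) (xs : nat -> R) (c1 c2 : R)
    (c : R3 -> R) : Prop :=
  measurable_fun setT c /\
  forall j : nat, (1 <= j <= n.+1)%N -> forall x : R3,
    xs j.-1 < enorm x < xs j -> c x = layer_value c1 c2 j.

End Helmholtz.

(* Main.v *)
(* A radial solution is u(x) = a v(|x|)/|x|, where v(0) = 0 and v'' = -(omega/c)^2 v
   on every layer.  The energy E = v'^2 + omega^2 v^2 is continuous across the
   interfaces and satisfies |E'| <= K omega E with K = 1 + cmin^-2, however many
   layers there are, so E on [0, 1] is at most exp(K omega) E(1).  The outgoing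
   wave exp(i kappa (|x| - 1))/|x| gives the Dirichlet-to-Neumann map on constants,
   and the boundary condition becomes a (v'(1) - i kappa v(1)) = g, whose left-hand
   side controls |a| E(1)^(1/2).  Bounds for u, its gradient and its energy norm
   follow from |v(r)| <= M r and |r v'(r) - v(r)| <= (omega/cmin)^2 M r^3, where M
   bounds |v'|.
   This u is a weak solution: integrate by parts along rays against smooth functions
   and pass to H^1 by density, which is how traces are defined.  Uniqueness
   identifies it with the given solution almost everywhere; weak gradients then agree
   because their difference is an L^2 limit of smooth functions and is orthogonal to
   all test functions. *)

From HB Require Import structures.
From mathcomp Require Import ring lra.
Require Import Defs.

Set Implicit Arguments.
Unset Strict Implicit.
Unset Printing Implicit Defensive.

Import Order.TTheory GRing.Theory Num.Theory.

Local Open Scope classical_set_scope.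
Local Open Scope ring_scope.

(** * Polar coordinates *)

(** The definitions decide the route. The surface integral is 3 times an integral over the punctured
    ball of the radial extension, so polar coordinates follow from Tonelli's theorem and dilations
    alone, with no parametrization of the sphere. A trace comes with smooth functions that converge
    in L^2 to the function, to its gradient and to the trace; as the coefficients of every identity
    are bounded on a domain of finite volume, each identity has to be checked for smooth functions
    only. Radial functions are handled as V(|x|^2) with V of class C^1: polynomials close to V and
    V' on an interval give smooth approximations at once, and no singularity is left at the origin.
    In the exterior a cutoff kills the outer boundary term; it equals 1 wherever the test function
    is nonzero, hence does not change the integral.

    The base is alpha = exp(2 + cmin^-2): the energy contributes exp((1 + cmin^-2) omega), and one
    further exp(omega) absorbs the factor 1 + (omega/cmin)^2 left by the gradient bound. *)

Lemma sigma_finite_prod d1 d2 (T1 : measurableType d1) (T2 : measurableType d2)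
    (R : realType) (m1 : {sigma_finite_measure set T1 -> \bar R})
    (m2 : {sigma_finite_measure set T2 -> \bar R}) :
  sigma_finite setT (m1 \x m2)%E.
Proof.
have /sigma_finiteP[F [TF ndF Foo]] := sigma_finiteT m1.
have /sigma_finiteP[G [TG ndG Goo]] := sigma_finiteT m2.
exists (fun n => F n `*` G n).
  rewrite -setXTT TF TG predeqE => -[x y]; split.
    move=> [/= [n _ Fnx] [k _ Gky]]; exists (maxn n k) => //; split.
      by move: x Fnx; exact/subsetPset/ndF/leq_maxl.
    by move: y Gky; exact/subsetPset/ndG/leq_maxr.
  by move=> [n _ []/= ? ?]; split; exists n.
move=> k; have [? ?] := Foo k; have [? ?] := Goo k.
split; first exact: measurableX.
by rewrite product_measure1E// lte_mul_pinfty// ge0_fin_numE.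
Qed.

Lemma is_derive_ext (R : realType) (V : normedModType R) (f g : V -> R)
    (x v : V) (d d' : R) :
  is_derive x v f d -> f =1 g -> d = d' -> is_derive x v g d'.
Proof. by move=> h /funext <- <-. Qed.

Section MeasureR3.
Context {R : realType}.
Local Notation R3 := (R * R * R)%type.
Local Notation leb1 := (@leb1 R).
Local Notation leb3 := (@leb3 R).

Lemma leb1_itv (a b : R) : a <= b -> leb1 `]a, b]%classic = (b - a)%:E.
Proof.
move=> ab; rewrite /leb1 lebesgue_measure_itv/= lte_fin.
by case: ltgtP ab => //= -> _; rewrite subrr.
Qed.

(** [leb1] is Lebesgue measure on another presentation of the Borel sets; pushing forward along the
    identity, read as a map between the two presentations, moves integrals across. *)
Lemma integral_leb1E (D : set R) (f : R -> \bar R) :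
  measurable D -> measurable_fun D f ->
  (\int[leb1]_(x in D) f x = \int[lebesgue_measure]_(x in D) f x)%E.
Proof.
move=> mD.
have ge0 (g : R -> \bar R) : measurable_fun D g -> (forall x, 0 <= g x)%E ->
    (\int[leb1]_(x in D) g x = \int[lebesgue_measure]_(x in D) g x)%E.
  move=> mg g0.
  have := @ge0_integral_pushforward _ _ (measurableTypeR R) R R (fun x => x)
    (@measurable_id _ _ setT) lebesgue_measure D g mD mg (fun x _ => g0 x).
  by move=> <-.
move=> mf; rewrite integralE [in RHS]integralE !ge0//.
  exact: measurable_funeneg.
exact: measurable_funepos.
Qed.

(** By uniqueness of Lebesgue measure: s times its image under the dilation takes the right values
    on half-open intervals. *)
Lemma leb1_scale (s : R) (A : set R) : 0 < s -> measurable A ->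
  leb1 ((fun x => s * x) @^-1` A) = ((s^-1)%:E * leb1 A)%E.
Proof.
move=> s0 mA.
have sn0 : s != 0 by rewrite gt_eqF.
have mf : measurable_fun setT (fun x : measurableTypeR R => (s * x : measurableTypeR R)).
  exact: measurable_funM.
pose si := NngNum (ltW s0).
pose mu : {measure set (measurableTypeR R) -> \bar R} :=
  mscale si (pushforward (@lebesgue_measure R)
    (fun x : measurableTypeR R => (s * x : measurableTypeR R))).
have H : forall B : set R, measurable B -> lebesgue_measure B = mu mf B.
  apply: lebesgue_measure_unique => //= _ [[a b]] _ <-.
  rewrite /mscale/= /pushforward.
  have -> : (fun x : R => s * x) @^-1` `]a, b]%classic = `]s^-1 * a, s^-1 * b]%classic.
    apply/seteqP; split => x /=; rewrite !in_itv/=;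
     rewrite ltr_pdivrMl// ler_pdivlMl//.
  rewrite !lebesgue_measure_itv/= !lte_fin ltr_pM2l ?invr_gt0//.
  case: ifP => _; rewrite ?mule0//.
  by rewrite -!EFinB -EFinM mulrBr !mulVKf.
rewrite /leb1 [in RHS]H// /mu /mscale/= muleA -EFinM mulVf// mul1e //.
Qed.

Lemma integral_leb1_scale (s : R) (f : R -> \bar R) : 0 < s ->
  measurable_fun setT f -> (forall x, 0 <= f x)%E ->
  (\int[leb1]_x f (s * x)%R = (s^-1)%:E * \int[leb1]_x f x)%E.
Proof.
move=> s0 mf f0.
have ms : measurable_fun setT (fun x : R => s * x) by exact: measurable_funM.
have V0 : 0 <= s^-1 by rewrite invr_ge0 ltW.
rewrite (_ : (\int[leb1]_x f (s * x)%R)%E =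
    (\int[pushforward leb1 (fun x : R => (s * x)%R)]_x f x)%E); last first.
  by rewrite ge0_integral_pushforward.
rewrite (@eq_measure_integral _ _ _ _ (mscale (NngNum V0) leb1)).
  by rewrite ge0_integral_mscale.
by move=> A mA _; rewrite -[RHS]/((s^-1)%:E * leb1 A)%E -leb1_scale.
Qed.

Definition leb2 : set (R * R) -> \bar R := (leb1 \x leb1)%E.
HB.instance Definition _ := Measure.on leb2.
HB.instance Definition _ :=
  @Measure_isSigmaFinite.Build _ _ _ leb2 (sigma_finite_prod leb1 leb1).
HB.instance Definition _ :=
  @Measure_isSigmaFinite.Build _ _ _ leb3 (sigma_finite_prod leb2 leb1).

Lemma integral_leb3_leb2 (f : R3 -> \bar R) :
  measurable_fun setT f -> (forall x, 0 <= f x)%E ->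
  (\int[leb3]_x f x =
   \int[leb2]_ab \int[leb1]_c f (ab, c))%E.
Proof.
move=> mf f0.
exact: (@fubini_tonelli1 _ _ _ _ R leb2 leb1 f mf f0).
Qed.
Lemma integral_leb3E (f : R3 -> \bar R) :
  measurable_fun setT f -> (forall x, 0 <= f x)%E ->
  (\int[leb3]_x f x =
   \int[leb1]_a \int[leb1]_b \int[leb1]_c f (a, b, c))%E.
Proof.
move=> mf f0; rewrite integral_leb3_leb2//.
apply: (@fubini_tonelli1 _ _ _ _ R leb1 leb1 (fun ab => \int[leb1]_c f (ab, c))%E).
  exact: (@measurable_fun_fubini_tonelli_F _ _ _ _ R leb1 f).
by move=> x; exact: integral_ge0.
Qed.

Lemma measurable_fun_R3 d (T : measurableType d) (f g h : T -> R) :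
  measurable_fun setT f -> measurable_fun setT g -> measurable_fun setT h ->
  measurable_fun setT (fun x => (f x, g x, h x) : R3).
Proof.
by move=> mf mg mh; apply: measurable_fun_pair => //; exact: measurable_fun_pair.
Qed.

Lemma measurable_x1 : measurable_fun setT (fun x : R3 => x.1.1).
Proof. exact: (measurableT_comp measurable_fst measurable_fst). Qed.

Lemma measurable_x2 : measurable_fun setT (fun x : R3 => x.1.2).
Proof. exact: (measurableT_comp measurable_snd measurable_fst). Qed.

Lemma measurable_x3 : measurable_fun setT (fun x : R3 => x.2).
Proof. exact: measurable_snd. Qed.

(** The inverse is discontinuous at 0, where its value is 0. The continuous functions x / (x^2 +
    1/(n+1)) converge to it at every point, 0 included. *)
Lemma measurable_invr : measurable_fun setT (fun x : R => x^-1).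
Proof.
apply: (@measurable_fun_cvg _ R R setT (fun n (x : R) => x / (x ^+ 2 + n.+1%:R^-1)) (fun x => x^-1)).
  move=> n; apply: continuous_measurable_fun => x.
  apply: cvgM; first exact: cvg_id.
  apply: cvgV.
    by rewrite gt_eqF// ltr_wpDl ?sqr_ge0// invr_gt0.
  apply: cvgD; last exact: cvg_cst.
  exact: exprn_continuous.
move=> x _; have [->|x0] := eqVneq x 0.
  rewrite invr0; under eq_fun do rewrite mul0r; exact: cvg_cst.
rewrite (_ : x^-1 = x / (x ^+ 2 + 0)); last first.
  by rewrite addr0 expr2 invfM mulrA mulfV// mul1r.
apply: cvgM; first exact: cvg_cst.
apply: cvgV; first by rewrite addr0 expf_neq0.
apply: cvgD; first exact: cvg_cst.
exact: cvg_harmonic.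
Qed.

Lemma measurable_sqrtr : measurable_fun setT (@Num.sqrt R).
Proof. by apply: continuous_measurable_fun; exact: sqrt_continuous. Qed.

Lemma measurable_enorm : measurable_fun setT (@enorm R).
Proof.
apply: measurableT_comp; first exact: measurable_sqrtr.
apply: measurable_funD; last by apply: measurable_funX; exact: measurable_x3.
apply: measurable_funD; first by apply: measurable_funX; exact: measurable_x1.
by apply: measurable_funX; exact: measurable_x2.
Qed.

Lemma measurable_scale d (T : measurableType d) (f : T -> R) (g : T -> R3) :
  measurable_fun setT f -> measurable_fun setT g ->
  measurable_fun setT (fun x => f x *: g x).
Proof.
move=> mf mg; apply: (@measurable_fun_R3 _ _ (fun x => f x * (g x).1.1)
   (fun x => f x * (g x).1.2) (fun x => f x * (g x).2)).
- by apply: measurable_funM => //; exact: (measurableT_comp measurable_x1 mg).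
- by apply: measurable_funM => //; exact: (measurableT_comp measurable_x2 mg).
- by apply: measurable_funM => //; exact: (measurableT_comp measurable_x3 mg).
Qed.

Lemma measurable_radial_proj : measurable_fun setT (@radial_proj R).
Proof.
apply: measurable_scale => //.
by apply: measurableT_comp; [exact: measurable_invr|exact: measurable_enorm].
Qed.

Lemma measurable_comp_countable d (T : measurableType d) d' (U : measurableType d')
    (I : countType) (h : T -> I) (psi : I -> U) :
  (forall i, measurable (h @^-1` [set i])) -> measurable_fun setT (psi \o h).
Proof.
move=> mh _ A mA; rewrite setTI.
have -> : (psi \o h) @^-1` A = \bigcup_i (if psi i \in A then h @^-1` [set i] else set0).
  apply/seteqP; split => x /=.
    by move=> Ax; exists (h x) => //; rewrite mem_set.
  by move=> [i _]; case: ifPn => // /set_mem Ai /= ->.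
apply: countable_bigcupT_measurable; first exact: countableP.
by move=> i; case: ifP.
Qed.

Lemma measurable_floor_fiber (m : R) (i : int) d (T : measurableType d) (f : T -> R) :
  measurable_fun setT f -> measurable [set x | Num.floor (m * f x) = i].
Proof.
move=> mf.
rewrite (_ : [set x | _] = (fun x => m * f x) @^-1` `[i%:~R, (i + 1)%:~R[%classic).
  rewrite -[X in measurable X]setTI.
  exact: (measurable_funM (measurable_cst _) mf).
apply/seteqP; split => x /=; rewrite in_itv/=.
  by move=> <-; rewrite floor_le floorD1_gt.
exact: floor_def.
Qed.

Let grid (n : nat) (x : R) : R := (Num.floor (n.+1%:R * x))%:~R / n.+1%:R.

Lemma grid_cvg (x : R) : grid ^~ x @ \oo --> x.
Proof.
apply/cvgrPdist_le => /= e e0.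
have H := @cvg_harmonic R; move/cvgrPdist_le : H => /(_ e e0).
apply: filterS => n /=; rewrite sub0r normrN /harmonic => He.
apply: le_trans He; rewrite [leRHS]ger0_norm ?invr_ge0// /grid.
have n0 : 0 < n.+1%:R :> R by [].
have -> : x = (n.+1%:R * x) / n.+1%:R by rewrite mulrC mulKf// gt_eqF.
rewrite -mulrBl normrM [X in _ * X]ger0_norm ?invr_ge0// ler_piMl ?invr_ge0//.
rewrite [n.+1%:R * (_ / _)]mulrCA divff ?gt_eqF// mulr1.
rewrite ger0_norm ?subr_ge0 ?floor_le// lerBlDl.
by apply/ltW; have := floorD1_gt (n.+1%:R * x); rewrite intrD.
Qed.

(** The sigma-algebra on [R3] is a product one, not one generated by open sets. So [f] is written as
    the limit of its values at the points of ever finer grids; each such function is constant on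
    countably many measurable cells. *)
Lemma continuous_measurable_R3 (f : R3 -> R) : continuous f -> measurable_fun setT f.
Proof.
move=> cf; apply: (@measurable_fun_cvg _ _ _ _
  (fun n x => f (grid n x.1.1, grid n x.1.2, grid n x.2))).
  move=> n.
  pose h (x : R3) : int * int * int := (Num.floor (n.+1%:R * x.1.1),
    Num.floor (n.+1%:R * x.1.2), Num.floor (n.+1%:R * x.2)).
  pose g (i : int * int * int) : R3 := (i.1.1%:~R / n.+1%:R, i.1.2%:~R / n.+1%:R, i.2%:~R / n.+1%:R).
  apply: (@measurable_comp_countable _ _ _ _ _ h (f \o g)) => -[[i j] k].
  rewrite (_ : h @^-1` _ = [set x | Num.floor (n.+1%:R * x.1.1) = i] `&`
     [set x | Num.floor (n.+1%:R * x.1.2) = j] `&` [set x | Num.floor (n.+1%:R * x.2) = k]).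
    apply: measurableI; last by apply: measurable_floor_fiber; exact: measurable_x3.
    apply: measurableI; first by apply: measurable_floor_fiber; exact: measurable_x1.
    by apply: measurable_floor_fiber; exact: measurable_x2.
  apply/seteqP; split => x /=; rewrite /h; first by move=> [-> -> ->].
  by move=> [[-> ->] ->].
move=> [[x y] z] _ /=.
apply: (continuous_cvg _ (cf _)).
apply: (@cvg_pair _ _ _ _ (nbhs (x,y)) (nbhs z)); last exact: grid_cvg.
apply: (@cvg_pair _ _ _ _ (nbhs x) (nbhs y)); exact: grid_cvg.
Qed.

Lemma integral_leb3_scale (s : R) (f : R3 -> \bar R) : 0 < s ->
  measurable_fun setT f -> (forall x, 0 <= f x)%E ->
  (\int[leb3]_x f (s *: x)%R = (s^-1 ^+ 3)%:E * \int[leb3]_x f x)%E.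
Proof.
move=> s0 mf f0.
have sV : 0 <= s^-1 by rewrite invr_ge0 ltW.
have mfs : measurable_fun setT (fun x : R3 => f (s *: x)).
  by apply: measurableT_comp => //; exact: measurable_scale.
rewrite !integral_leb3E//.
pose F2 (ab : R * R) := (\int[leb1]_c f (ab, c))%E.
pose F1 a := (\int[leb1]_b F2 (a, b))%E.
have F20 ab : (0 <= F2 ab)%E by exact: integral_ge0.
have F10 ab : (0 <= F1 ab)%E by exact: integral_ge0.
have mF2 : measurable_fun setT F2.
  exact: (@measurable_fun_fubini_tonelli_F _ _ _ _ R leb1 f).
have mF1 : measurable_fun setT F1.
  exact: (@measurable_fun_fubini_tonelli_F _ _ _ _ R leb1 F2).
have mF2a a : measurable_fun setT (fun b => F2 (a, b)).
  exact: measurable_fun_pair2.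
have ms : measurable_fun setT (fun b : R => s * b) by exact: measurable_funM.
have E2 a b : (\int[leb1]_c f (s *: (a, b, c))%R = (s^-1)%:E * F2 (s * a, s * b)%R)%E.
  have := @integral_leb1_scale s (fun c => f (s * a, s * b, c)) s0.
  by apply => //; exact: measurable_fun_pair2.
have E1 a : (\int[leb1]_b \int[leb1]_c f (s *: (a, b, c))%R = (s^-1)%:E * ((s^-1)%:E * F1 (s * a)%R))%E.
  under eq_integral do rewrite E2.
  rewrite ge0_integralZl_EFin//; last exact: (measurableT_comp (mF2a (s * a)) ms).
  by rewrite (@integral_leb1_scale s (fun b => F2 (s * a, b))).
under eq_integral do rewrite E1.
have mF1s : measurable_fun setT (fun a => F1 (s * a)).
  exact: (measurableT_comp mF1 ms).
rewrite ge0_integralZl_EFin//; last 2 first.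
  - by move=> x _; rewrite mule_ge0.
  - exact: measurable_funeM.
rewrite ge0_integralZl_EFin//.
by rewrite integral_leb1_scale// !muleA -!EFinM !exprS expr0 mulr1 mulrA.
Qed.

(** The origin lies in a coordinate plane, which is null as a product with a point. *)
Lemma leb3_null_origin : leb3 [set x | enorm x = 0] = 0%E.
Proof.
apply/eqP; rewrite eq_le measure_ge0 andbT.
have <- : leb3 (setT `*` [set 0]) = 0%E.
  rewrite /leb3 product_measure1E//.
  rewrite [X in (_ * X)%E](_ : _ = 0%E) ?mule0//.
  exact: lebesgue_measure_set1.
apply: le_measure; rewrite ?inE//.
- rewrite -[X in measurable X]setTI.
  exact: (measurable_enorm measurableT (measurable_set1 0)).
- exact: measurableX.
move=> [[x y] z] /= /eqP; rewrite /enorm/= sqrtr_eq0 => H; split => //.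
apply/eqP; rewrite -sqrf_eq0 eq_le sqr_ge0 andbT.
by apply: le_trans H; rewrite lerDr addr_ge0// sqr_ge0.
Qed.

Lemma enorm_ge0 (x : R3) : 0 <= enorm x.
Proof. exact: sqrtr_ge0. Qed.

Lemma enormZ (s : R) (x : R3) : enorm (s *: x) = `|s| * enorm x.
Proof.
rewrite /enorm -sqrtr_sqr -sqrtrM ?sqr_ge0//; congr Num.sqrt.
rewrite /= !/(_ *: _)/=; ring.
Qed.

Lemma enormZ_ge0 (s : R) (x : R3) : 0 <= s -> enorm (s *: x) = s * enorm x.
Proof. by move=> s0; rewrite enormZ ger0_norm. Qed.

Lemma measurable_punctured_ball : measurable (@punctured_ball R).
Proof.
rewrite (_ : punctured_ball = (@enorm R) @^-1` `]0, 1[%classic).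
  by rewrite -[X in measurable X]setTI; exact: measurable_enorm.
by apply/seteqP; split => x /=; rewrite in_itv/=.
Qed.

Lemma in_ray (m r : R) : (r \in `]m, +oo[%classic) = (m < r).
Proof.
by apply/idP/idP => [/set_mem|h]; [|apply/mem_set]; rewrite /= in_itv/= andbT.
Qed.

(** This is the integral over s that is left in [integral_polar]; its value cancels the factor |z|^3
    there. *)
Lemma integral_inv4 (m : R) : 0 < m ->
  (\int[leb1]_(s in `]m, +oo[) (3 * s^-1 ^+ 4)%:E = (m^-1 ^+ 3)%:E)%E.
Proof.
move=> m0.
have dF (x : R) : 0 < x -> is_derive x 1 (fun s : R => - (s^-1 ^+ 3)) (3 * x^-1 ^+ 4).
  move=> x0; have xn0 : x != 0 by rewrite gt_eqF.
  apply: (is_derive_ext (is_deriveN (is_deriveX 3 (is_deriveV xn0 (is_derive_id x 1))))).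
    by [].
  rewrite /= /(_ *: _)/= -exprVn; ring.
have cV (x : R) : x != 0 -> {for x, continuous (fun s : R => s^-1)}.
  by move=> x0; apply: cvgV => //; exact: cvg_id.
have cf : {within `[m, +oo[, continuous (fun s : R => 3 * s^-1 ^+ 4)}.
  apply: continuous_in_subspaceT => x; rewrite inE/= in_itv/= andbT => mx.
  have x0 : x != 0 by rewrite gt_eqF// (lt_le_trans m0).
  apply: cvgM; first exact: cvg_cst.
  exact: (continuous_cvg _ (@exprn_continuous _ 4 x^-1) (cV _ x0)).
have mf : measurable_fun `]m, +oo[%classic (fun s : R => (3 * s^-1 ^+ 4)%:E).
  apply/measurable_EFinP; apply: measurable_funM => //.
  apply: measurable_funX; exact: (measurable_funS measurableT _ measurable_invr).
rewrite integral_leb1E// integral_itv_obnd_cbnd//.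
rewrite (ge0_continuous_FTC2y (F := fun s => - (s^-1 ^+ 3)) (l := 0))//.
- by rewrite -EFinB sub0r opprK.
- move=> x mx; rewrite mulr_ge0// exprn_ge0// invr_ge0.
  by rewrite ltW// (lt_le_trans m0).
- rewrite -oppr0; apply: cvgN.
  rewrite (_ : (0 : R) = 0 ^+ 3); last by rewrite expr0n.
  apply: (continuous_cvg _ (@exprn_continuous _ 3 0)).
  apply/cvgr0Pnorm_le => e e0; exists e^-1; split; first by rewrite num_real.
  move=> x xe; have x0 : 0 < x by apply: lt_trans xe; rewrite invr_gt0.
  rewrite gtr0_norm ?invr_gt0// -[leRHS]invrK lef_pV2 ?posrE ?invr_gt0//.
  exact: ltW.
- by move=> x mx; have [] := dF x (lt_trans m0 mx).
- apply: cvg_at_right_filter; apply: cvgN.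
  have mn0 : m != 0 by rewrite gt_eqF.
  by apply: (continuous_cvg _ (@exprn_continuous _ 3 m^-1)); exact: cV.
move=> x; rewrite in_itv/= andbT => mx.
by rewrite derive1E; have := dF x (lt_trans m0 mx) => h; rewrite derive_val.
Qed.

(* Tonelli in y, r after the substitutions r = s |y| and z = s y, which turn the
   right-hand side into |z|^3 f(z) times the integral of 3 s^-4 over s > |z|. *)
Lemma integral_polar (f : R3 -> \bar R) :
  measurable_fun setT f -> (forall x, 0 <= f x)%E ->
  (\int[leb3]_x f x =
   \int[leb3]_(y in @punctured_ball R) \int[leb1]_(r in `]0%R, +oo[)
     ((3 * r ^+ 2)%:E * f (r *: radial_proj y)%R))%E.
Proof.
move=> mf f0.
pose I : R -> R := \1_(`]0, +oo[%classic).
have I0 (r : R) : r <= 0 -> I r = 0.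
  by move=> r0; rewrite /I indicE memNset//= in_itv/= andbT; apply/negP; rewrite -leNgt.
have I1 (r : R) : 0 < r -> I r = 1.
  by move=> r0; rewrite /I indicE mem_set//= in_itv/= andbT.
have Ige r : 0 <= I r by rewrite /I indicE.
have mI : measurable_fun setT I by exact: measurable_indic.
(* The values of [I] encode 0 < |y| < 1 and s > 0. The rest is 3 r^2 dr after r = s |y|, which is 3
   s^2 |y|^3 ds. *)
pose w (p : R3 * R) := I (enorm p.1) * I (1 - enorm p.1) * I p.2 *
   (3 * p.2 ^+ 2 * enorm p.1 ^+ 3).
have w0 p : 0 <= w p.
  have q0 : 0 <= 3 * p.2 ^+ 2 * enorm p.1 ^+ 3.
    by apply: mulr_ge0; [apply: mulr_ge0 => //; exact: sqr_ge0|exact/exprn_ge0/enorm_ge0].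
  by rewrite /w; apply: mulr_ge0 => //; rewrite !mulr_ge0.
have men1 : measurable_fun setT (fun p : R3 * R => enorm p.1).
  exact: (measurableT_comp measurable_enorm measurable_fst).
have mIs : measurable_fun setT (fun p : R3 * R => I p.2).
  exact: (measurableT_comp mI measurable_snd).
have mw : measurable_fun setT w.
  apply: measurable_funM; last first.
    apply: measurable_funM; last exact: measurable_funX.
    by apply: measurable_funM => //; apply: measurable_funX; exact: measurable_snd.
  apply: measurable_funM => //; apply: measurable_funM.
    exact: (measurableT_comp mI men1).
  apply: (measurableT_comp mI); exact: measurable_funB.
have msc : measurable_fun setT (fun p : R3 * R => p.2 *: p.1).
  exact: measurable_scale measurable_snd measurable_fst.
pose H (p : R3 * R) : \bar R := ((w p)%:E * f (p.2 *: p.1)%R)%E.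
have H0 p : (0 <= H p)%E by rewrite mule_ge0// lee_fin.
have mH : measurable_fun setT H.
  apply: emeasurable_funM; first exact/measurable_EFinP.
  exact: (measurableT_comp mf msc).
have step1 y : punctured_ball y ->
  (\int[leb1]_(r in `]0%R, +oo[) ((3 * r ^+ 2)%:E * f (r *: radial_proj y)%R) =
   \int[leb1]_s H (y, s))%E.
  move=> /andP[y0 y1].
  pose g (r : R) := ((I r * (3 * r ^+ 2))%:E * f (r *: radial_proj y)%R)%E.
  have mg : measurable_fun setT g.
    apply: emeasurable_funM.
      apply/measurable_EFinP; apply: measurable_funM => //.
      by apply: measurable_funM => //; exact: measurable_funX.
    by apply: (measurableT_comp mf); exact: measurable_scale.
  have g0 r : (0 <= g r)%E by rewrite mule_ge0// lee_fin; apply: mulr_ge0 => //; apply: mulr_ge0 => //; exact: sqr_ge0.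
  transitivity (\int[leb1]_r g r)%E.
    rewrite integral_mkcond; apply: eq_integral => r _; rewrite patchE /g.
    rewrite in_ray; case: ltP => r0; first by rewrite I1// mul1r.
    by rewrite I0// mul0r mul0e.
  have := integral_leb1_scale y0 mg g0 => /(congr1 (fun z => (enorm y)%:E * z)%E).
  have mgs : measurable_fun setT (fun s => g (enorm y * s)).
    by apply: (measurableT_comp mg); exact: measurable_funM.
  rewrite muleA -EFinM mulfV ?gt_eqF// mul1e => <-.
  rewrite -ge0_integralZl_EFin//; last exact/ltW.
  apply: eq_integral => s _; rewrite /g /H /w /= (I1 _ y0) (I1 (1 - enorm y)) ?subr_gt0// !mul1r.
  rewrite /radial_proj scalerA mulrAC mulfV ?gt_eqF// mul1r muleA -EFinM.
  congr (_%:E * _)%E.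
  have [s0|s0] := ltP 0 s.
    by rewrite !I1//; [ring|rewrite mulr_gt0].
  by rewrite !I0//; [ring|rewrite pmulr_rle0].
have step2 : (\int[leb3]_x f x = \int[leb3]_z ((I (enorm z))%:E * f z))%E.
  rewrite (ge0_negligible_integral _ (N := [set x | enorm x = 0]))//; last first.
    exact: leb3_null_origin.
    rewrite -[X in measurable X]setTI.
    exact: (measurable_enorm measurableT (measurable_set1 0)).
  rewrite integral_mkcond; apply: eq_integral => z _; rewrite patchE.
  have := enorm_ge0 z; rewrite le_eqVlt => /orP[/eqP z0|z0].
    by rewrite memNset//=; [rewrite -z0 I0// mul0e|case=> _; apply].
  by rewrite mem_set//=; [rewrite I1// mul1e|split=> // /eqP; rewrite gt_eqF].
pose w' (p : R3 * R) := I (enorm p.1) * I (p.2 - enorm p.1) *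
   (3 * p.2^-1 ^+ 4 * enorm p.1 ^+ 3).
pose H' (p : R3 * R) : \bar R := ((w' p)%:E * f p.1)%E.
have mw' : measurable_fun setT w'.
  apply: measurable_funM; last first.
    apply: measurable_funM; last exact: measurable_funX.
    apply: measurable_funM => //; apply: measurable_funX.
    exact: (measurableT_comp measurable_invr measurable_snd).
  apply: measurable_funM; first exact: (measurableT_comp mI men1).
  apply: (measurableT_comp mI); apply: measurable_funB => //; exact: measurable_snd.
have mH' : measurable_fun setT H'.
  apply: emeasurable_funM; first exact/measurable_EFinP.
  exact: (measurableT_comp mf measurable_fst).
have w'0 p : 0 <= w' p.
  rewrite /w'; have [h|h] := leP p.2 (enorm p.1).
    by rewrite (I0 (_ - _)) ?subr_le0// mulr0 mul0r.
  have p0 : 0 <= p.2 by rewrite ltW// (le_lt_trans _ h)// enorm_ge0.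
  apply: mulr_ge0; first exact: mulr_ge0.
  by apply: mulr_ge0; [apply: mulr_ge0 => //; rewrite exprn_ge0 ?invr_ge0|exact/exprn_ge0/enorm_ge0].
have H'0 p : (0 <= H' p)%E by rewrite mule_ge0// lee_fin.
(* With z = s y, the Jacobian and the factor |y|^3 give s^-3 each, so that 3 s^2 becomes 3 s^-4, and
   |y| < 1 becomes |z| < s. *)
have step3 s : (\int[leb3]_y H (y, s) = \int[leb3]_z H' (z, s))%E.
  have [s0|s0] := ltP 0 s; last first.
    rewrite !integral0_eq// => z _; rewrite /H /H' /w /w'/=.
      rewrite (I0 (s - _)) ?mulr0 ?mul0r ?mul0e//.
      by rewrite subr_le0 (le_trans s0)// enorm_ge0.
    by rewrite (I0 s)// mulr0 mul0r mul0e.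
  pose G z := ((I (enorm z) * I (s - enorm z) * (3 * s^-1 * enorm z ^+ 3))%:E * f z)%E.
  have G0 z : (0 <= G z)%E.
    rewrite mule_ge0// lee_fin; apply: mulr_ge0; first exact: mulr_ge0.
    by apply: mulr_ge0; [apply: mulr_ge0 => //; rewrite invr_ge0 ltW|exact/exprn_ge0/enorm_ge0].
  have mG : measurable_fun setT G.
    apply: emeasurable_funM => //; apply/measurable_EFinP.
    have me := @measurable_enorm.
    apply: measurable_funM.
      apply: measurable_funM; first exact: (measurableT_comp mI me).
      by apply: (measurableT_comp mI); exact: measurable_funB.
    by apply: measurable_funM => //; exact: measurable_funX.
  transitivity (\int[leb3]_y G (s *: y))%E.
    apply: eq_integral => y _; rewrite /G /H /w/=; congr (_%:E * _)%E.
    rewrite enormZ_ge0 ?ltW// (I1 s)//.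
    have -> : I (s * enorm y) = I (enorm y).
      have := enorm_ge0 y; rewrite le_eqVlt => /orP[/eqP <-|y0].
        by rewrite mulr0.
      by rewrite !I1// mulr_gt0.
    have -> : I (s - s * enorm y) = I (1 - enorm y).
      rewrite -{1}[s]mulr1 -mulrBr; have [h|h] := leP (1 - enorm y) 0.
        by rewrite !I0// pmulr_rle0.
      by rewrite !I1// mulr_gt0.
    by field; rewrite gt_eqF.
  rewrite integral_leb3_scale// -ge0_integralZl_EFin//; last first.
    by rewrite exprn_ge0// invr_ge0 ltW.
  apply: eq_integral => z _; rewrite /G /H' /w' muleA -EFinM/=.
  by congr (_%:E * _)%E; field; rewrite gt_eqF.
have step4 z : (\int[leb1]_s H' (z, s) = (I (enorm z))%:E * f z)%E.
  have := enorm_ge0 z; rewrite le_eqVlt => /orP[/eqP z0|z0].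
    rewrite -z0 I0// mul0e integral0_eq// => s _.
    by rewrite /H' /w'/= -z0 (I0 0)// !mul0r mul0e.
  have E (s : R) : H' (z, s) = ((((fun s => 3 * s^-1 ^+ 4) \_ `]enorm z, +oo[) s)%:E * ((enorm z ^+ 3)%:E * f z))%E.
    rewrite /H' /w'/= I1// mul1r muleA -EFinM patchE; congr (_%:E * _)%E.
    rewrite in_ray; case: ltP => h; first by rewrite I1 ?subr_gt0// mul1r.
    by rewrite I0 ?mul0r// subr_le0.
  under eq_integral do rewrite E.
  rewrite ge0_integralZr//; last 3 first.
  - apply/measurable_EFinP; apply/(measurable_restrictT _ _).1 => //.
    apply: measurable_funM => //; apply: measurable_funX.
    exact: (measurable_funS measurableT _ measurable_invr).
  - move=> s _; rewrite lee_fin patchE in_ray; case: ltP => // h.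
    by rewrite mulr_ge0// exprn_ge0// invr_ge0 ltW// (lt_trans z0).
  - by rewrite mule_ge0// lee_fin exprn_ge0// ltW.
  rewrite (_ : (\int[_]_x _)%E =
      (\int[leb1]_(s in `]enorm z, +oo[) (3 * s^-1 ^+ 4)%:E)%E); last first.
    rewrite [RHS]integral_mkcond; apply: eq_integral => s _.
    by rewrite !patchE; case: ifP.
  rewrite integral_inv4// muleA -EFinM -exprMn mulVf ?gt_eqF// expr1n.
  by rewrite I1.
rewrite step2; under eq_integral do rewrite -step4.
transitivity (\int[leb3]_y \int[leb1]_s H (y, s))%E; last first.
  rewrite [RHS]integral_mkcond; apply: eq_integral => y _; rewrite patchE.
  case: ifPn => [/set_mem yb|/negP/negP yb]; first by rewrite step1.
  rewrite integral0_eq// => s _; rewrite /H /w/=.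
  have [h|h] := leP (enorm y) 0; first by rewrite I0// !mul0r mul0e.
  rewrite (I0 (1 - _)) ?mulr0 ?mul0r ?mul0e// subr_le0 leNgt; apply/negP => y1.
  by move: yb; rewrite notin_setE; apply; rewrite /punctured_ball/= h.
rewrite -(@fubini_tonelli1 _ _ _ _ R leb3 leb1 H)// (@fubini_tonelli2 _ _ _ _ R leb3 leb1 H)//.
under [in RHS]eq_integral do rewrite /fubini_G step3.
by rewrite -(@fubini_tonelli1 _ _ _ _ R leb3 leb1 H')// (@fubini_tonelli2 _ _ _ _ R leb3 leb1 H').
Qed.

End MeasureR3.

(** * Null spheres and polar integration over annuli *)

Section Annuli.
Context {R : realType}.
Local Notation R3 := (R * R * R)%type.
Local Notation leb1 := (@leb1 R).
Local Notation leb3 := (@leb3 R).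

Definition annulus (a b : R) : set R3 := [set x | a < enorm x < b].

Lemma measurable_annulus a b : measurable (annulus a b).
Proof.
rewrite (_ : annulus a b = (@enorm R) @^-1` `]a, b[%classic).
  by rewrite -[X in measurable X]setTI; exact: measurable_enorm.
by apply/seteqP; split => x /=; rewrite in_itv/=.
Qed.

Definition eball (rho : R) : set R3 := [set x | enorm x < rho].

Lemma measurable_eball rho : measurable (eball rho).
Proof.
rewrite (_ : eball rho = (@enorm R) @^-1` `]-oo, rho[%classic).
  by rewrite -[X in measurable X]setTI; exact: measurable_enorm.
by apply/seteqP; split => x /=; rewrite in_itv/=.
Qed.

Lemma le_coord_enorm (x : R3) :
  [/\ `|x.1.1| <= enorm x, `|x.1.2| <= enorm x & `|x.2| <= enorm x].
Proof.
have H (u v : R) : u ^+ 2 <= v -> `|u| <= Num.sqrt v.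
  by move=> uv; rewrite -sqrtr_sqr ler_sqrt ?(le_trans (sqr_ge0 u) uv).
have := sqr_ge0 x.1.1; have := sqr_ge0 x.1.2; have := sqr_ge0 x.2.
by move=> h1 h2 h3; split; apply: H; lra.
Qed.

Lemma leb3_ball_lty (rho : R) : (leb3 (eball rho) < +oo)%E.
Proof.
have [r0|r0] := leP rho 0.
  rewrite (_ : eball rho = set0) ?measure0//.
  apply/seteqP; split => x //= h.
  by have := lt_le_trans h r0; rewrite ltNge enorm_ge0.
pose J : set R := `]-rho, rho]%classic.
have mJ : measurable J by exact: measurable_itv.
apply: (@le_lt_trans _ _ (leb3 ((J `*` J) `*` J))).
  apply: le_measure; rewrite ?inE//.
  - exact: measurable_eball.
  - by apply: measurableX => //; exact: measurableX.
  move=> x /= xr; have [h1 h2 h3] := le_coord_enorm x.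
  have H (u : R) : `|u| <= enorm x -> J u.
    move=> ux; rewrite /J/= in_itv/=.
    by have := le_lt_trans ux xr; rewrite ltr_norml => /andP[-> /ltW].
  by split; [split|]; exact: H.
rewrite /leb3 product_measure1E//; last exact: measurableX.
have fJ : (leb1 J < +oo)%E by rewrite /J leb1_itv ?ltry//; lra.
apply: lte_mul_pinfty => //.
  rewrite ge0_fin_numE// [X in (X < _)%E](_ : _ = leb1 J * leb1 J)%E; last first.
    exact: product_measure1E.
  by apply: lte_mul_pinfty => //; rewrite ge0_fin_numE.
Qed.

Lemma leb3_annulus_lty a b : (leb3 (annulus a b) < +oo)%E.
Proof.
apply: le_lt_trans (leb3_ball_lty b); apply: le_measure; rewrite ?inE//.
- exact: measurable_annulus.
- exact: measurable_eball.
by move=> x /= /andP[].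
Qed.

Lemma enorm_radial (r : R) (y : R3) : 0 <= r -> 0 < enorm y ->
  enorm (r *: radial_proj y) = r.
Proof.
move=> r0 y0; rewrite /radial_proj scalerA enormZ_ge0; last by rewrite mulr_ge0// invr_ge0 ltW.
by rewrite -mulrA mulVf ?mulr1// gt_eqF.
Qed.

(** In polar coordinates every ray meets the sphere in at most one radius. *)
Lemma leb3_sphere (s : R) : leb3 [set x | enorm x = s] = 0%E.
Proof.
have mS : measurable [set x : R3 | enorm x = s].
  rewrite -[X in measurable X]setTI.
  exact: (measurable_enorm measurableT (measurable_set1 s)).
rewrite -(setIT [set x | _]) -integral_indic//.
rewrite integral_polar//; last exact/measurable_EFinP/measurable_indic.
rewrite integral0_eq// => y /andP[y0 _].
rewrite (ge0_negligible_integral _ (N := [set s]))//=; last 3 first.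
- apply: emeasurable_funM; apply/measurable_EFinP.
    by apply: measurable_funM => //; exact: measurable_funX.
  apply: (measurable_funS measurableT) => //; apply: measurableT_comp => //.
  exact: measurable_scale.
- by move=> r _; rewrite -EFinM lee_fin mulr_ge0// mulr_ge0// sqr_ge0.
- exact: lebesgue_measure_set1.
rewrite integral0_eq// => r [/= r0 rs].
rewrite in_itv/= andbT in r0.
rewrite indicE memNset ?mule0//= enorm_radial ?ltW//.
Qed.

Lemma integral_sqr (a b : R) : 0 <= a -> a < b ->
  (\int[leb1]_(r in `]a, b[) (3 * r ^+ 2)%:E = (b ^+ 3 - a ^+ 3)%:E)%E.
Proof.
move=> a0 ab.
have dF (x : R) : is_derive x 1 (fun s : R => s ^+ 3) (3 * x ^+ 2).
  apply: (is_derive_ext (is_deriveX 3 (is_derive_id x 1))) => //.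
  by rewrite /= /(_ *: _)/= mulr1.
have mf : measurable_fun setT (fun r : R => (3 * r ^+ 2)%:E).
  by apply/measurable_EFinP; apply: measurable_funM => //; exact: measurable_funX.
rewrite integral_leb1E//; last exact: (measurable_funS measurableT _ mf).
rewrite -(@integral_itv_bndoo _ a b _ true false)//; last first.
  exact: (measurable_funS measurableT _ mf).
rewrite (continuous_FTC2 (F := fun s : R => s ^+ 3))//.
- apply: continuous_subspaceT => x; apply: cvgM; first exact: cvg_cst.
  exact: exprn_continuous.
- split => [x _||].
  + by have [] := dF x.
  + by apply: cvg_at_right_filter; exact: exprn_continuous.
  + by apply: cvg_at_left_filter; exact: exprn_continuous.
by move=> x _; rewrite derive1E; have := dF x => h; rewrite derive_val.
Qed.

Lemma in_oo_set (a b r : R) : (r \in `]a, b[%classic) = (a < r < b).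
Proof. by apply/idP/idP => [/set_mem|H]; [|apply/mem_set]; rewrite /= in_itv/=. Qed.

(* Constants are added to make the integrand nonnegative. *)
Lemma Rintegral_polar (a b M : R) (g Phi : R3 -> R) : 0 <= M -> 0 <= a -> a < b ->
  measurable_fun setT g -> (forall x, annulus a b x -> `|g x| <= M) ->
  measurable_fun (@punctured_ball R) Phi ->
  (forall y, punctured_ball y -> `|Phi y| <= M * (b ^+ 3 - a ^+ 3)) ->
  (forall y, punctured_ball y ->
     (\int[leb1]_(r in `]a, b[) (3 * r ^+ 2 * g (r *: radial_proj y))%:E =
      (Phi y)%:E)%E) ->
  \int[leb3]_(x in annulus a b) g x = \int[leb3]_(y in @punctured_ball R) Phi y.
Proof.
move=> M0 a0 ab mg gM mP PM gP.
have mA := measurable_annulus a b; have mB := @measurable_punctured_ball R.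
have fB : (leb3 (@punctured_ball R) < +oo)%E by exact: (leb3_annulus_lty 0 1).
have fA := leb3_annulus_lty a b.
have iB : leb3.-integrable (@punctured_ball R) (EFin \o Phi).
  apply: measurable_bounded_integrable => //.
  exists (M * (b ^+ 3 - a ^+ 3)); split; first by rewrite num_real.
  by move=> z Mz y /PM h; exact: le_trans (ltW Mz).
have iA : leb3.-integrable (annulus a b) (EFin \o g).
  apply: measurable_bounded_integrable => //; first exact: (measurable_funS measurableT).
  exists M; split; first by rewrite num_real.
  by move=> z Mz y /gM h; exact: le_trans (ltW Mz).
(* The nonnegative case, where [integral_polar] applies to the restriction of [h] to the annulus. *)
have key (k : R) (h Psi : R3 -> R) : measurable_fun setT h ->
    (forall x, annulus a b x -> 0 <= h x) ->
    (forall y, punctured_ball y ->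
     (\int[leb1]_(r in `]a, b[) (3 * r ^+ 2 * h (r *: radial_proj y))%:E =
      (Psi y)%:E)%E) ->
    (\int[leb3]_(x in annulus a b) (h x)%:E =
     \int[leb3]_(y in @punctured_ball R) (Psi y)%:E)%E.
  move=> mh h0 hP.
  rewrite integral_mkcond integral_polar; last 2 first.
  - apply/(measurable_restrictT _ _).1 => //; apply/measurable_EFinP.
    exact: (measurable_funS measurableT).
  - by move=> x; rewrite patchE; case: ifPn => // /set_mem /h0; rewrite lee_fin.
  apply: eq_integral => y /set_mem yB; rewrite -hP//.
  rewrite integral_mkcond [in RHS]integral_mkcond.
  apply: eq_integral => r _; rewrite !patchE in_ray.
  have y0 : 0 < enorm y by case/andP: yB.
  rewrite in_oo_set; case: ltP => r0; last first.
    by rewrite (le_gtF (le_trans r0 a0)).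
  case: ifPn => [/set_mem|/negP]; rewrite /annulus/= ?enorm_radial ?ltW//.
    by move=> ->; rewrite EFinM.
  move=> H; case: ifPn => arb; last by rewrite mule0.
  by exfalso; apply: H; apply/mem_set => /=; rewrite enorm_radial ?ltW.
(* The integral of the constant [M] along a ray: adding [M] to [g] adds [K] to [Phi]. *)
set K := M * (b ^+ 3 - a ^+ 3).
have cst_int (D : set R3) (k : R) : measurable D -> (leb3 D < +oo)%E ->
    leb3.-integrable D (EFin \o cst k).
  move=> mD fD; apply: measurable_bounded_integrable => //.
  by exists `|k|; split; [rewrite num_real|move=> z kz x _; exact: ltW].
have KE : (\int[leb1]_(r in `]a, b[) (3 * r ^+ 2 * M)%:E = K%:E)%E.
  under eq_integral do rewrite mulrC EFinM.
  rewrite ge0_integralZl_EFin//; first by rewrite integral_sqr// -EFinM.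
  - by move=> r _; rewrite lee_fin mulr_ge0// sqr_ge0.
  - apply/measurable_EFinP; apply: measurable_funM => //; exact: measurable_funX.
have H2 : \int[leb3]_(x in annulus a b) (cst M x) = \int[leb3]_(y in @punctured_ball R) (cst K y).
  by rewrite /Rintegral (key 0 (cst M) (cst K))// => y _.
have H1 : \int[leb3]_(x in annulus a b) (g x + cst M x) =
    \int[leb3]_(y in @punctured_ball R) (Phi y + cst K y).
  rewrite /Rintegral (key 0 (fun x => g x + cst M x) (fun y => Phi y + cst K y))//.
  - exact: measurable_funD.
  - by move=> x /gM; rewrite ler_norml => /andP[h _]; rewrite -lerBlDr sub0r.
  move=> y yB; rewrite EFinD -gP// -KE.
  under eq_integral do rewrite mulrDr EFinD.
  have y0 : 0 < enorm y by case/andP: yB.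
  have bd_int (k : R3 -> R) : measurable_fun setT k ->
     (forall x, annulus a b x -> `|k x| <= M) ->
     leb1.-integrable `]a, b[ (fun r => (3 * r ^+ 2 * k (r *: radial_proj y))%:E).
    move=> mk kM.
    apply: (@measurable_bounded_integrable _ _ _ leb1 (fun r => 3 * r ^+ 2 * k (r *: radial_proj y)) `]a, b[) => //.
    - apply: (@le_lt_trans _ _ (leb1 `]a, b])); last by rewrite leb1_itv ?ltry// ltW.
      apply: le_measure; rewrite ?inE//.
      by apply: subset_itvl; rewrite bnd_simp.
    - apply: (measurable_funS measurableT) => //; apply: measurable_funM.
        by apply: measurable_funM => //; exact: measurable_funX.
      by apply: (measurableT_comp mk); exact: measurable_scale.
    exists (3 * b ^+ 2 * M); split; first by rewrite num_real.
    move=> z Mz r; rewrite /= in_itv/= => /andP[ar rb]; apply: le_trans (ltW Mz).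
    have r0 : 0 <= r by rewrite (le_trans a0)// ltW.
    rewrite normrM ler_pM//.
      rewrite ger0_norm; last by rewrite mulr_ge0// sqr_ge0.
      by rewrite ler_pM2l// lerXn2r ?nnegrE// ?ltW// (le_lt_trans r0).
    by apply: kM; rewrite /annulus/= enorm_radial// ar.
  rewrite integralD//; first exact: bd_int.
  by apply: (bd_int (cst M)) => // x _; rewrite /= ger0_norm.
have := H1; rewrite RintegralD//; last exact: cst_int.
by rewrite [in RHS]RintegralD ?H2//; [exact: addIr|exact: cst_int].
Qed.

End Annuli.

(** * Integration by parts on layered annuli *)

Lemma layer_bounds (R : realType) (n : nat) (xs : nat -> R) :
  (forall i, (i <= n)%N -> xs i < xs i.+1) ->
  forall i, (i <= n)%N -> xs 0%N <= xs i /\ xs i.+1 <= xs n.+1.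
Proof.
move=> xlt i ni; have H1 : (i <= n)%N -> xs 0%N <= xs i.
  elim: i {ni} => [|i IHi] ij; first exact: lexx.
  by apply: le_trans (IHi (ltnW ij)) _; exact/ltW/xlt/ltnW.
have H2 j : (j <= n)%N -> xs (n - j).+1 <= xs n.+1.
  elim: j => [|j IHj] jn; first by rewrite subn0.
  have := IHj (ltnW jn); apply: le_trans; rewrite -subSn// subSS.
  by apply/ltW/xlt; rewrite leq_subr.
by split; [exact: H1|have := H2 (n - i)%N (leq_subr _ _); rewrite subKn].
Qed.

Section LayeredFTC.
Context {R : realType}.
Local Notation leb1 := (@leb1 R).

(** [f] is controlled in the open interval only, since it may jump at the end points; the
    fundamental theorem of calculus is applied to [h], which is continuous up to them. *)
Lemma integral_derivative (F f h : R -> R) (a b : R) : a < b ->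
  measurable_fun setT f ->
  (forall r, a <= r <= b -> {for r, continuous F}) ->
  (forall r, a < r < b -> is_derive r 1 F (h r)) ->
  (forall r, a <= r <= b -> {for r, continuous h}) ->
  (forall r, a < r < b -> f r = h r) ->
  (\int[leb1]_(r in `]a, b[) (f r)%:E = (F b - F a)%:E)%E.
Proof.
move=> ab mf cF dF ch fh.
have cFw r : a <= r <= b -> F x @[x --> r] --> F r by move=> /cF.
have mfD (D : set R) : measurable D -> measurable_fun D (EFin \o f).
  by move=> mD; apply/measurable_EFinP; exact: (measurable_funS measurableT).
rewrite integral_leb1E; [|exact: measurable_itv|exact: mfD].
rewrite -(@integral_itv_bndoo _ a b _ true false); last exact: mfD.
have ch' : {within `[a, b], continuous h}.
  by apply: continuous_in_subspaceT => x /set_mem; rewrite /= in_itv/= => /ch.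
rewrite (eq_integral_itv_bounded (g := h)).
- rewrite (continuous_FTC2 (F := F))//; first split.
  + by move=> x; rewrite in_itv/= => /dF[].
  + by apply: cvg_at_right_filter; apply: cFw; rewrite lexx ltW.
  + by apply: cvg_at_left_filter; apply: cFw; rewrite lexx ltW.
  by move=> x; rewrite in_itv/= => /dF H; rewrite derive1E derive_val.
- exact: (measurable_funS measurableT).
- apply: (measurable_funS _ (_ : `]a, b[ `<=` `[a, b]%classic)).
  + exact: measurable_itv.
  + by apply: subset_itvW; rewrite lexx.
  exact: subspace_continuous_measurable_fun.
- by move=> x; rewrite in_itv/= => /fh.
Qed.

(** The boundary terms at the interfaces telescope because [F] is continuous there; only its
    derivative jumps. *)
Lemma integral_layered_derivative (n : nat) (xs : nat -> R) (F f : R -> R)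
    (h : nat -> R -> R) :
  (forall i, (i <= n)%N -> xs i < xs i.+1) ->
  measurable_fun setT f ->
  (forall r, xs 0%N <= r <= xs n.+1 -> {for r, continuous F}) ->
  (forall i r, (i <= n)%N -> xs i < r < xs i.+1 -> is_derive r 1 F (h i r)) ->
  (forall i r, (i <= n)%N -> xs i <= r <= xs i.+1 -> {for r, continuous (h i)}) ->
  (forall i r, (i <= n)%N -> xs i < r < xs i.+1 -> f r = h i r) ->
  (\int[leb1]_(r in `]xs 0%N, xs n.+1[) (f r)%:E = (F (xs n.+1) - F (xs 0%N))%:E)%E.
Proof.
elim: n => [|n IH] xlt mf cF dF ch fh.
  apply: (@integral_derivative _ _ (h 0%N)) => //.
  - exact: xlt.
  - by move=> r rx; exact: dF.
  - by move=> r rx; exact: ch.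
  - by move=> r rx; exact: fh.
have x0n m : (m <= n.+1)%N -> xs 0%N < xs m.+1.
  by move=> mn; apply: le_lt_trans (layer_bounds xlt mn).1 (xlt _ mn).
have xn := xlt n.+1 (leqnn _).
have mfD (D : set R) : measurable D -> measurable_fun D (EFin \o f).
  by move=> mD; apply/measurable_EFinP; exact: (measurable_funS measurableT).
rewrite (@itv_bndbnd_setU _ _ (BRight (xs 0%N)) (BLeft (xs n.+1))); last 2 first.
- by rewrite bnd_simp; exact: x0n.
- by rewrite bnd_simp ltW.
rewrite integral_setU; [|exact: measurable_itv|exact: measurable_itv| |]; last 2 first.
- by apply: mfD; apply: measurableU; exact: measurable_itv.
- apply/disj_setPS => y [/=]; rewrite !in_itv/= => /andP[_ yx] /andP[].
  by rewrite leNgt yx.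
have -> : (\int[leb1]_(x in `]xs 0%N, xs n.+1[) (f x)%:E = (F (xs n.+1) - F (xs 0%N))%:E)%E.
  apply: IH => //.
  - by move=> i /leqW; exact: xlt.
  - by move=> r /andP[r0 rn]; apply: cF; rewrite r0 (le_trans rn)// ltW.
  - by move=> i r /leqW; exact: dF.
  - by move=> i r /leqW; exact: ch.
  - by move=> i r /leqW; exact: fh.
rewrite integral_leb1E; [|exact: measurable_itv|exact: mfD].
rewrite -integral_itv_obnd_cbnd; last exact: mfD.
rewrite -integral_leb1E; [|exact: measurable_itv|exact: mfD].
have -> : (\int[leb1]_(x in `]xs n.+1, xs n.+2[) (f x)%:E = (F (xs n.+2) - F (xs n.+1))%:E)%E.
  apply: (@integral_derivative F f (h n.+1)) => //.
  - move=> r /andP[r0 rn]; apply: cF; rewrite rn andbT (le_trans _ r0)// ltW//.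
    exact: x0n.
  - by move=> r; exact: dF.
  - by move=> r; exact: ch.
  - by move=> r; exact: fh.
by rewrite -EFinD; congr _%:E; ring.
Qed.

End LayeredFTC.

(** * Chain rule along rays and integration by parts for radial fields *)

Section ChainRule.
Context {R : realType}.
Local Notation leb3 := (@leb3 R).
Local Notation R3 := (R * R * R)%type.

(** Besides smooth functions this class has to contain the radial solutions, whose second
    derivatives jump at the interfaces. *)
Definition C1 (phi : R3 -> R) : Prop := continuous phi /\
  forall i : 'I_3, (forall x, derivable phi x (basis i)) /\
    continuous (fun x => 'D_(basis i) phi x).

Definition i0 : 'I_3 := inord 0.
Definition i1 : 'I_3 := inord 1.
Definition i2 : 'I_3 := inord 2.

Lemma big_I3 (V : nmodType) (F : 'I_3 -> V) : \sum_(i < 3) F i = F i0 + F i1 + F i2.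
Proof.
rewrite !big_ord_recr big_ord0/= add0r.
by congr (F _ + F _ + F _); apply/val_inj; rewrite /= inordK.
Qed.

Lemma coord_i0 (x : R3) : coord x i0 = x.1.1.
Proof. by rewrite /coord inordK. Qed.
Lemma coord_i1 (x : R3) : coord x i1 = x.1.2.
Proof. by rewrite /coord inordK. Qed.
Lemma coord_i2 (x : R3) : coord x i2 = x.2.
Proof. by rewrite /coord inordK. Qed.

Lemma basis_i0 : basis i0 = (1, 0, 0) :> R3.
Proof. by rewrite /basis !inordK. Qed.
Lemma basis_i1 : basis i1 = (0, 1, 0) :> R3.
Proof. by rewrite /basis !inordK. Qed.
Lemma basis_i2 : basis i2 = (0, 0, 1) :> R3.
Proof. by rewrite /basis !inordK. Qed.

(** This lemma and its two analogues turn a partial derivative in space into the derivative of a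
    function of one real variable, to which the mean value theorem and the fundamental theorem of
    calculus apply. *)
Lemma is_derive_slice1 (phi : R3 -> R) (a b c : R) : derivable phi (a, b, c) (basis i0) ->
  is_derive a 1 (fun t => phi (t, b, c)) ('D_(basis i0) phi (a, b, c)).
Proof.
move=> d; have E : (fun h : R => h^-1 *: (phi (h *: (1:R) + a, b, c) - phi (a, b, c))) =
   (fun h => h^-1 *: (phi (h *: basis i0 + (a, b, c)) - phi (a, b, c))).
  apply/funext => h; congr (_ *: (phi _ - _)).
  rewrite basis_i0 -[RHS]/(h *: (1:R) + a, h * 0 + b, h * 0 + c).
  by rewrite !mulr0 !add0r.
by split; rewrite /derivable /derive; rewrite [X in X @ _]E.
Qed.

Lemma is_derive_slice2 (phi : R3 -> R) (a b c : R) : derivable phi (a, b, c) (basis i1) ->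
  is_derive b 1 (fun t => phi (a, t, c)) ('D_(basis i1) phi (a, b, c)).
Proof.
move=> d; have E : (fun h : R => h^-1 *: (phi (a, h *: (1:R) + b, c) - phi (a, b, c))) =
   (fun h => h^-1 *: (phi (h *: basis i1 + (a, b, c)) - phi (a, b, c))).
  apply/funext => h; congr (_ *: (phi _ - _)).
  rewrite basis_i1 -[RHS]/(h * 0 + a, h *: (1:R) + b, h * 0 + c).
  by rewrite !mulr0 !add0r.
by split; rewrite /derivable /derive; rewrite [X in X @ _]E.
Qed.

Lemma is_derive_slice3 (phi : R3 -> R) (a b c : R) : derivable phi (a, b, c) (basis i2) ->
  is_derive c 1 (fun t => phi (a, b, t)) ('D_(basis i2) phi (a, b, c)).
Proof.
move=> d; have E : (fun h : R => h^-1 *: (phi (a, b, h *: (1:R) + c) - phi (a, b, c))) =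
   (fun h => h^-1 *: (phi (h *: basis i2 + (a, b, c)) - phi (a, b, c))).
  apply/funext => h; congr (_ *: (phi _ - _)).
  rewrite basis_i2 -[RHS]/(h * 0 + a, h * 0 + b, h *: (1:R) + c).
  by rewrite !mulr0 !add0r.
by split; rewrite /derivable /derive; rewrite [X in X @ _]E.
Qed.

(** The end points come in either order because coordinate increments have unknown signs; the bound
    on c keeps the intermediate point near [a]. *)
Lemma MVT_between (f df : R -> R) (a b : R) : (forall x : R, is_derive x 1 f (df x)) ->
  exists2 c, `|c - a| <= `|b - a| & f b - f a = df c * (b - a).
Proof.
move=> d; have cf : continuous f.
  by move=> x; apply/differentiable_continuous/derivable1_diffP; have [] := d x.
have [ab|ba|<-] := ltgtP a b.
- have [c cab E] := MVT ab (fun x _ => d x) (continuous_subspaceT cf).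
  exists c => //; move: cab; rewrite in_itv/= => /andP[ac cb].
  by rewrite !gtr0_norm ?subr_gt0// lerB// ltW.
- have [c cab E] := MVT ba (fun x _ => d x) (continuous_subspaceT cf).
  exists c; last by rewrite -opprB E -mulrN opprB.
  move: cab; rewrite in_itv/= => /andP[bc ca].
  by rewrite !ltr0_norm ?subr_lt0// !opprB lerB// ltW.
- by exists a; rewrite !subrr ?mulr0.
Qed.

Lemma continuous_R3_eps (g : R3 -> R) (p : R3) (e : R) : {for p, continuous g} -> 0 < e ->
  exists2 d, 0 < d & forall q : R3, `|q.1.1 - p.1.1| < d -> `|q.1.2 - p.1.2| < d ->
    `|q.2 - p.2| < d -> `|g q - g p| <= e.
Proof.
move=> cg e0; have := cg; rewrite /prop_for /continuous_at.
move/cvgrPdist_le => /(_ e e0)/nbhs_ballP[d /= d0 H].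
exists d => // q h1 h2 h3; rewrite distrC; apply: H.
by split; [split|]; rewrite /ball/= distrC.
Qed.

Lemma weighted_sum_close (v1 v2 v3 x1 x2 x3 y1 y2 y3 e : R) : 0 < e ->
  let S := `|v1| + `|v2| + `|v3| + 1 in
  `|y1 - x1| <= e / S -> `|y2 - x2| <= e / S -> `|y3 - x3| <= e / S ->
  `|v1 * x1 + v2 * x2 + v3 * x3 - (v1 * y1 + v2 * y2 + v3 * y3)| <= e.
Proof.
move=> e0 S h1 h2 h3.
have S0 : 0 < S by rewrite ltr_wpDl// !addr_ge0.
have -> : v1 * x1 + v2 * x2 + v3 * x3 - (v1 * y1 + v2 * y2 + v3 * y3) =
   v1 * (x1 - y1) + v2 * (x2 - y2) + v3 * (x3 - y3) by ring.
apply: le_trans (ler_normD _ _) _; apply: le_trans (lerD (ler_normD _ _) (lexx _)) _.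
rewrite !normrM.
apply: (@le_trans _ _ ((`|v1| + `|v2| + `|v3|) * (e / S))).
  rewrite !mulrDl; apply: lerD; [apply: lerD|].
  - by apply: ler_wpM2l => //; rewrite distrC.
  - by apply: ler_wpM2l => //; rewrite distrC.
  - by apply: ler_wpM2l => //; rewrite distrC.
rewrite mulrA ler_pdivrMr// mulrC ler_wpM2l ?ltW// /S; lra.
Qed.

(** From one point of the ray to the next, the coordinates are changed one at a time. The mean value
    theorem turns each change into a partial derivative at a nearby point, and the continuity of the
    partial derivatives lets these points be replaced by [r *: v]. *)
Lemma is_derive_ray (phi : R3 -> R) (v : R3) (r : R) : C1 phi ->
  is_derive r 1 (fun s => phi (s *: v)) (\sum_(i < 3) coord v i * 'D_(basis i) phi (r *: v)).
Proof.
move=> [_ C]; set d := \sum_(i < 3) _.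
suff H : h^-1 *: (phi ((h *: (1 : R) + r) *: v) - phi (r *: v)) @[h --> 0^'] --> d.
  by split; [apply/cvg_ex; exists d|apply/cvg_lim].
apply/cvgrPdist_le => e e0.
pose S := `|v.1.1| + `|v.1.2| + `|v.2| + 1.
have S0 : 0 < S by rewrite ltr_wpDl// !addr_ge0.
have eS : 0 < e / S by rewrite divr_gt0.
have cD i : {for r *: v, continuous (fun x => 'D_(basis i) phi x)} by have [_] := C i; apply.
have [d0 d00 H0] := continuous_R3_eps (cD i0) eS.
have [d1 d10 H1] := continuous_R3_eps (cD i1) eS.
have [d2 d20 H2] := continuous_R3_eps (cD i2) eS.
pose dm := Num.min d0 (Num.min d1 d2).
have dm0 : 0 < dm by rewrite !lt_min d00 d10 d20.
have near0 : \forall h \near (0 : R)^', h != 0 /\ `|h| * S < dm.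
  near=> h; split; first by near: h; exact: nbhs_dnbhs_neq.
  rewrite -ltr_pdivlMr//; near: h; apply: dnbhs0_lt; exact: divr_gt0.
apply: filterS near0 => h [h0 hS].
have D1 b c t := is_derive_slice1 ((C i0).1 (t, b, c)).
have D2 a c t := is_derive_slice2 ((C i1).1 (a, t, c)).
have D3 a b t := is_derive_slice3 ((C i2).1 (a, b, t)).
have s1 : h *: (1 : R) = h by rewrite /(_ *: _)/= mulr1.
rewrite s1; set q := (h + r) *: v; set p := r *: v.
have [x xb Ex] := MVT_between p.1.1 q.1.1 (D1 q.1.2 q.2).
have [y yb Ey] := MVT_between p.1.2 q.1.2 (D2 p.1.1 q.2).
have [z zb Ez] := MVT_between p.2 q.2 (D3 p.1.1 p.1.2).
have qp1 : q.1.1 - p.1.1 = h * v.1.1 by rewrite -[LHS]/((h + r) * v.1.1 - r * v.1.1); ring.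
have qp2 : q.1.2 - p.1.2 = h * v.1.2 by rewrite -[LHS]/((h + r) * v.1.2 - r * v.1.2); ring.
have qp3 : q.2 - p.2 = h * v.2 by rewrite -[LHS]/((h + r) * v.2 - r * v.2); ring.
have small (u w : R) : `|u| <= `|h * w| -> `|w| <= S -> `|u| < dm.
  move=> uw wS; apply: le_lt_trans uw _; rewrite normrM.
  by apply: le_lt_trans hS; rewrite ler_wpM2l.
have vS1 : `|v.1.1| <= S by rewrite /S -!addrA lerDl !addr_ge0.
have vS2 : `|v.1.2| <= S.
  by rewrite /S -!addrA addrCA lerDl !addr_ge0.
have vS3 : `|v.2| <= S.
  by rewrite /S addrAC lerDr !addr_ge0.
have dm_le w : w < dm -> [/\ w < d0, w < d1 & w < d2] by rewrite !lt_min => /and3P[].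
have [x0 x1 x2] := dm_le _ (small _ _ (eq_ind _ (fun w => `|x - p.1.1| <= `|w|) xb _ qp1) vS1).
have [y0 y1 y2] := dm_le _ (small _ _ (eq_ind _ (fun w => `|y - p.1.2| <= `|w|) yb _ qp2) vS2).
have [z0 z1 z2] := dm_le _ (small _ _ (eq_ind _ (fun w => `|z - p.2| <= `|w|) zb _ qp3) vS3).
have qq1 : `|q.1.1 - p.1.1| < dm by rewrite qp1; apply: (small _ _ (lexx _)).
have qq2 : `|q.1.2 - p.1.2| < dm by rewrite qp2; apply: (small _ _ (lexx _)).
have qq3 : `|q.2 - p.2| < dm by rewrite qp3; apply: (small _ _ (lexx _)).
have [q20 q21 q22] := dm_le _ qq2.
have [q30 q31 q32] := dm_le _ qq3.
have B0 := H0 (x, q.1.2, q.2) x0 q20 q30.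
have B1 := H1 (p.1.1, y, q.2) _ y1 q31.
have B2 := H2 (p.1.1, p.1.2, z) _ _ z2.
rewrite /= subrr normr0 in B1 B2.
have {}B1 := B1 d10.
rewrite subrr normr0 in B2; have {}B2 := B2 d20 d20.
have E : phi q - phi p = h * (v.1.1 * 'D_(basis i0) phi (x, q.1.2, q.2) +
   v.1.2 * 'D_(basis i1) phi (p.1.1, y, q.2) + v.2 * 'D_(basis i2) phi (p.1.1, p.1.2, z)).
  have -> : phi q - phi p = (phi (q.1.1, q.1.2, q.2) - phi (p.1.1, q.1.2, q.2)) +
     (phi (p.1.1, q.1.2, q.2) - phi (p.1.1, p.1.2, q.2)) +
     (phi (p.1.1, p.1.2, q.2) - phi (p.1.1, p.1.2, p.2)).
    have -> : phi q = phi (q.1.1, q.1.2, q.2) by case: (q) => -[].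
    have -> : phi p = phi (p.1.1, p.1.2, p.2) by case: (p) => -[].
    ring.
  rewrite Ex Ey Ez qp1 qp2 qp3; ring.
rewrite E /(_ *: _)/= mulKf// /d big_I3 coord_i0 coord_i1 coord_i2 -/p.
exact: (weighted_sum_close e0 B0 B1 B2).
Unshelve. all: by end_near. Qed.

Lemma continuous_bounded_ball (phi : R3 -> R) (b : R) : continuous phi ->
  exists2 M, 0 <= M & forall x, enorm x <= b -> `|phi x| <= M.
Proof.
move=> cphi.
pose K : set R3 := (`[-b, b] `*` `[-b, b]) `*` `[-b, b].
have cK : compact K.
  by apply: compact_setX; [apply: compact_setX|]; exact: segment_compact.
have /compact_bounded[M [_ HM]] : compact (phi @` K).
  by apply: continuous_compact => //; exact: continuous_subspaceT.
exists (`|M| + 1); first by rewrite addr_ge0.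
move=> x xb; apply: HM; first by rewrite ltr_pwDr// ler_norm.
exists x => //; have [h1 h2 h3] := le_coord_enorm x.
have H (u : R) : `|u| <= enorm x -> `[-b, b]%classic u.
  by move=> ux; rewrite /= in_itv/= -ler_norml (le_trans ux).
by split; [split|]; exact: H.
Qed.

Lemma coordE (x : R3) (i : 'I_3) : coord x i =
  (i == i0)%:R * x.1.1 + (i == i1)%:R * x.1.2 + (i == i2)%:R * x.2.
Proof.
have E0 : (i == i0) = (i == 0 :> nat)%N by rewrite -val_eqE/= inordK.
have E1 : (i == i1) = (i == 1 :> nat)%N by rewrite -val_eqE/= inordK.
have E2 : (i == i2) = (i == 2 :> nat)%N by rewrite -val_eqE/= inordK.
rewrite E0 E1 E2 /coord.
by case: i {E0 E1 E2} => -[|[|[|//]]] //= _; rewrite ?mul1r ?mul0r ?addr0 ?add0r.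
Qed.

Lemma measurable_coord (i : 'I_3) : measurable_fun setT (fun x : R3 => coord x i).
Proof.
rewrite (_ : (fun x : R3 => coord x i) = (fun x : R3 => (i == i0)%:R * x.1.1 +
   (i == i1)%:R * x.1.2 + (i == i2)%:R * x.2)); last first.
  by apply/funext => x; rewrite coordE.
apply: measurable_funD; first apply: measurable_funD.
- by apply: measurable_funM => //; exact: measurable_x1.
- by apply: measurable_funM => //; exact: measurable_x2.
- by apply: measurable_funM => //; exact: measurable_x3.
Qed.

Lemma coordZ (s : R) (x : R3) i : coord (s *: x) i = s * coord x i.
Proof.
rewrite !coordE -[(s *: x).1.1]/(s * x.1.1) -[(s *: x).1.2]/(s * x.1.2).
rewrite -[(s *: x).2]/(s * x.2); ring.
Qed.

Lemma le_coord (x : R3) i : `|coord x i| <= enorm x.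
Proof.
have [h0 h1 h2] := le_coord_enorm x.
rewrite /coord; case: i => -[|[|[|//]]] //=.
Qed.

Lemma C1_bounded (phi : R3 -> R) (rho : R) : C1 phi ->
  exists2 M, 0 <= M & forall x, enorm x <= rho ->
    `|phi x| <= M /\ forall i, `|'D_(basis i) phi x| <= M.
Proof.
move=> [cp Cp].
have [M M0 HM] := continuous_bounded_ball rho cp.
have [N0 N00 HN0] := continuous_bounded_ball rho (Cp i0).2.
have [N1 N10 HN1] := continuous_bounded_ball rho (Cp i1).2.
have [N2 N20 HN2] := continuous_bounded_ball rho (Cp i2).2.
exists (M + \sum_(i < 3) tnth [tuple N0; N1; N2] i).
  by rewrite addr_ge0// big_ord_recl/= big_ord_recl/= big_ord_recl/= big_ord0 !addr_ge0.
move=> x xr; rewrite big_ord_recl/= big_ord_recl/= big_ord_recl/= big_ord0 !(tnth_nth 0)/= addr0.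
split; first by have := HM x xr; lra.
have E (i : 'I_3) : [|| i == i0, i == i1 | i == i2].
  by case: i => -[|[|[|//]]] p; rewrite -!val_eqE/= !inordK.
move=> i; case/or3P: (E i) => /eqP ->.
- by have := HN0 x xr; lra.
- by have := HN1 x xr; lra.
by have := HN2 x xr; lra.
Qed.

(** The divergence theorem for the radial field with component A(r) / r^2, whose divergence is A'(r)
    / r^2. Multiplied by the weight 3 r^2, the integrand on the ray of direction v is the derivative
    of 3 A(r) phi(r v). The bounds by [K * r ^+ 2] keep the integrand bounded when the inner radius
    is 0. *)
Lemma polar_integration_by_parts (n : nat) (xs : nat -> R) (A A1 : R -> R)
    (h : nat -> R -> R) (K : R) (phi : R3 -> R) :
  C1 phi -> 0 <= xs 0%N -> 0 <= K ->
  (forall i, (i <= n)%N -> xs i < xs i.+1) ->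
  measurable_fun setT A -> measurable_fun setT A1 ->
  (forall r, xs 0%N <= r <= xs n.+1 -> {for r, continuous A}) ->
  (forall i r, (i <= n)%N -> xs i < r < xs i.+1 -> is_derive r 1 A (h i r)) ->
  (forall i r, (i <= n)%N -> xs i <= r <= xs i.+1 -> {for r, continuous (h i)}) ->
  (forall i r, (i <= n)%N -> xs i < r < xs i.+1 -> A1 r = h i r) ->
  (forall r, xs 0%N <= r <= xs n.+1 -> `|A r| <= K * r ^+ 2) ->
  (forall r, xs 0%N < r < xs n.+1 -> `|A1 r| <= K * r ^+ 2) ->
  \int[leb3]_(x in annulus (xs 0%N) (xs n.+1))
    (A (enorm x) / enorm x ^+ 2 *
       (\sum_(i < 3) coord x i / enorm x * 'D_(basis i) phi x) +
     A1 (enorm x) / enorm x ^+ 2 * phi x) =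
  \int[leb3]_(y in @punctured_ball R)
    (3 * (A (xs n.+1) * phi (xs n.+1 *: radial_proj y) -
          A (xs 0%N) * phi (xs 0%N *: radial_proj y))).
Proof.
move=> C a0 K0 xlt mA mA1 cA dA ch A1h AK A1K.
set a := xs 0%N; set b := xs n.+1.
have xs_mono := layer_bounds xlt.
have ab : a < b by exact: le_lt_trans (xs_mono _ (leqnn n)).1 (xlt _ (leqnn n)).
have b0 : 0 < b by exact: le_lt_trans ab.
have [cphi CD] := C.
have [M M0 HM] := C1_bounded b C.
have phiM x : enorm x <= b -> `|phi x| <= M by move=> /HM[].
have DM x i : enorm x <= b -> `|'D_(basis i) phi x| <= M by move=> /HM[].
have mphi := continuous_measurable_R3 cphi.
have mD i := continuous_measurable_R3 (CD i).2.
have me := @measurable_enorm R.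
have minv := @measurable_invr R.
have mA' : measurable_fun setT (fun x : R3 => A (enorm x)) by exact: measurableT_comp.
have mA1' : measurable_fun setT (fun x : R3 => A1 (enorm x)) by exact: measurableT_comp.
have mie : measurable_fun setT (fun x : R3 => (enorm x)^-1) by exact: measurableT_comp.
have mie2 : measurable_fun setT (fun x : R3 => (enorm x ^+ 2)^-1).
  by apply: (measurableT_comp minv); exact: measurable_funX.
set g := (fun x : R3 => A (enorm x) / enorm x ^+ 2 *
       (\sum_(i < 3) coord x i / enorm x * 'D_(basis i) phi x) +
     A1 (enorm x) / enorm x ^+ 2 * phi x).
have mg : measurable_fun setT g.
  apply: measurable_funD; last by apply: measurable_funM => //; exact: measurable_funM.
  apply: measurable_funM; first exact: measurable_funM.
  apply: measurable_sum => i; apply: measurable_funM => //.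
  by apply: measurable_funM => //; exact: measurable_coord.
have sc_le (y : R3) (r : R) : 0 <= r -> punctured_ball y -> enorm (r *: radial_proj y) = r.
  by move=> r0 /andP[y0 _]; exact: enorm_radial.
have a3b3 : 0 < b ^+ 3 - a ^+ 3 by rewrite subr_gt0 ltrXn2r.
have Kb (r : R) : a <= r <= b -> `|A r| <= K * b ^+ 2.
  move=> rab; have /andP[ar rb] := rab; apply: le_trans (AK _ rab) _.
  by rewrite ler_wpM2l// lerXn2r// nnegrE ?(le_trans a0)// ltW.
(* [Rintegral_polar] wants one constant for two bounds: the first summand bounds the integrand, the
   second, times b^3 - a^3, bounds the integral along a ray. *)
pose Q := K * (3 * M + M) + 6 * K * b ^+ 2 * M / (b ^+ 3 - a ^+ 3).
have Q20 : 0 <= 6 * K * b ^+ 2 * M / (b ^+ 3 - a ^+ 3).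
  by rewrite divr_ge0 ?(ltW a3b3)//; apply: mulr_ge0 => //; apply: mulr_ge0; [apply: mulr_ge0|exact: sqr_ge0].
have Q10 : 0 <= K * (3 * M + M) by rewrite mulr_ge0// addr_ge0// mulr_ge0.
apply: (@Rintegral_polar R a b Q g) => //.
- exact: addr_ge0.
- move=> x xab; have /andP[ax xb] := xab.
  have e0 : 0 < enorm x by exact: le_lt_trans ax.
  have e2 : 0 < enorm x ^+ 2 by rewrite exprn_gt0.
  apply: (@le_trans _ _ (K * (3 * M + M))); last by rewrite lerDl.
  rewrite /g mulrDr; apply: le_trans (ler_normD _ _) _; apply: lerD.
    rewrite normrM; apply: ler_pM => //.
      rewrite normrM normfV (gtr0_norm e2) ler_pdivrMr//; apply: AK.
      by rewrite !ltW.
    apply: le_trans (ler_norm_sum _ _ _) _.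
    rewrite big_I3; have -> : 3 * M = M + M + M by ring.
    have H i : `|coord x i / enorm x * 'D_(basis i) phi x| <= M.
      rewrite normrM -[leRHS]mul1r; apply: ler_pM => //; last exact/DM/ltW.
      by rewrite normrM normfV (gtr0_norm e0) ler_pdivrMr// mul1r le_coord.
    by apply: lerD; [apply: lerD|].
  rewrite normrM; apply: ler_pM => //; last exact/phiM/ltW.
  by rewrite normrM normfV (gtr0_norm e2) ler_pdivrMr//; apply: A1K.
- apply: measurable_funTS; apply: measurable_funM => //.
  have mr (s : R) : measurable_fun setT (fun y : R3 => phi (s *: radial_proj y)).
    apply: (measurableT_comp mphi); apply: measurable_scale => //.
    exact: measurable_radial_proj.
  by apply: measurable_funB; apply: measurable_funM.
- move=> y yB; apply: (@le_trans _ _ (6 * K * b ^+ 2 * M)); last first.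
    by rewrite /Q [leRHS]mulrDl divfK ?gt_eqF// lerDr mulr_ge0// ltW.
  have H (s : R) : a <= s <= b -> `|A s * phi (s *: radial_proj y)| <= K * b ^+ 2 * M.
    move=> sab; have /andP[sa sb] := sab; rewrite normrM; apply: ler_pM => //; first exact: Kb.
    by apply: phiM; rewrite sc_le// (le_trans a0).
  have Ha := H a (introT andP (conj (lexx a) (ltW ab))).
  have Hb := H b (introT andP (conj (ltW ab) (lexx b))).
  rewrite normrM ger0_norm//.
  have -> : 6 * K * b ^+ 2 * M = 3 * (K * b ^+ 2 * M + K * b ^+ 2 * M) by ring.
  rewrite ler_pM2l//; apply: le_trans (ler_normB _ _) _.
  exact: (lerD Hb Ha).
move=> y yB; set v := radial_proj y.
have cv : continuous (fun r : R => r *: v) by move=> r; exact: scalel_continuous.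
have cpv (r : R) : {for r, continuous (fun r : R => phi (r *: v))}.
  exact: (continuous_cvg _ (cphi (r *: v)) (cv r)).
have cDv (r : R) i : {for r, continuous (fun r : R => 'D_(basis i) phi (r *: v))}.
  exact: (continuous_cvg _ ((CD i).2 (r *: v)) (cv r)).
pose S r := \sum_(i < 3) coord v i * 'D_(basis i) phi (r *: v).
have cS (r : R) : {for r, continuous S}.
  have -> : S = (fun r => coord v i0 * 'D_(basis i0) phi (r *: v) +
     coord v i1 * 'D_(basis i1) phi (r *: v) + coord v i2 * 'D_(basis i2) phi (r *: v)).
    by apply/funext => s; rewrite /S big_I3.
  apply: cvgD; [apply: cvgD|]; apply: cvgM; first [exact: cvg_cst|exact: cDv].
rewrite mulrBr.
apply: (@integral_layered_derivative R n xs (fun r => 3 * (A r * phi (r *: v)))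
   (fun r => 3 * r ^+ 2 * g (r *: v)) (fun i r => 3 * (A r * S r + phi (r *: v) * h i r))) => //.
- apply: measurable_funM; first by apply: measurable_funM => //; exact: measurable_funX.
  by apply: (measurableT_comp mg); exact: measurable_scale.
- by move=> r rab; apply: cvgM; [exact: cvg_cst|apply: cvgM; [exact: cA|exact: cpv]].
- move=> i r ni rx; have dphi := is_derive_ray v r C.
  have dAr := dA _ _ ni rx.
  apply: (is_derive_ext (is_deriveZ 3 (is_deriveM dAr dphi))) => //.
- move=> i r ni rx; have [ai bi] := xs_mono _ ni.
  have rab : a <= r <= b.
    by case/andP: rx => r1 r2; rewrite (le_trans ai)//= (le_trans r2).
  apply: cvgM; first exact: cvg_cst.
  apply: cvgD; apply: cvgM.
  + exact: cA.
  + exact: cS.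
  + exact: cpv.
  + exact: ch.
move=> i r ni rx; have [ai bi] := xs_mono _ ni.
have r0 : 0 < r by case/andP: rx => r1 r2; rewrite (le_lt_trans a0)// (le_lt_trans ai).
rewrite /g sc_le ?ltW// -(A1h _ _ ni rx).
have -> : \sum_(i < 3) coord (r *: v) i / r * 'D_(basis i) phi (r *: v) = S r.
  by apply: eq_bigr => k _; rewrite coordZ [r * _]mulrC mulfK ?gt_eqF.
by field; rewrite gt_eqF.
Qed.

End ChainRule.

(** * The layered ordinary differential equation *)

Lemma scaleRE (R : realType) (a b : R) : a *: (b : R^o) = a * b.
Proof. by []. Qed.

Section Sinc.
Context {R : realType}.

Lemma is_cvg_pseries_le_invfact (c : nat -> R) (x : R) :
  (forall n, `|c n| <= n`!%:R^-1) -> cvgn (pseries c x).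
Proof.
move=> cn; apply: normed_cvg.
apply: (@series_le_cvg _ _ (exp_coeff `|x|)).
- by move=> n; exact: normr_ge0.
- by move=> n; rewrite /exp_coeff /= divr_ge0// exprn_ge0.
- move=> n /=; rewrite /exp_coeff/= normrM normrX mulrC.
  by apply: ler_wpM2l => //; exact: exprn_ge0.
- exact: is_cvg_series_exp_coeff.
Qed.

(** The bound 1/n! survives termwise differentiation, so a single comparison with the exponential
    series yields the convergence of the series and of its first two derived series. *)
Lemma pseries_diffs_le_invfact (c : nat -> R) :
  (forall n, `|c n| <= n`!%:R^-1) -> forall n, `|pseries_diffs c n| <= n`!%:R^-1.
Proof.
move=> cn n; rewrite /pseries_diffs normrM normr_nat.
apply: le_trans (ler_wpM2l _ (cn n.+1)) _ => //.
by rewrite factS natrM invfM mulrA mulfV ?mul1r// pnatr_eq0.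
Qed.

Lemma is_derive_pseries (c : nat -> R) (x : R) : (forall n, `|c n| <= n`!%:R^-1) ->
  is_derive x 1 (fun x => limn (pseries c x)) (limn (pseries (pseries_diffs c) x)).
Proof.
move=> cn; apply: (@pseries_snd_diffs _ _ (`|x| + 1)).
- exact: is_cvg_pseries_le_invfact.
- by apply: is_cvg_pseries_le_invfact; exact: pseries_diffs_le_invfact.
- by apply: is_cvg_pseries_le_invfact; exact/pseries_diffs_le_invfact/pseries_diffs_le_invfact.
- by rewrite [ltRHS]ger0_norm ?addr_ge0// ltrDl.
Qed.

Let sc (n : nat) : R := (-1) ^ n / (n.*2.+1)`!%:R.

(* sinc x = sum of (-1)^n x^n / (2n+1)!, the entire function with
   t sinc(t^2) = sin t. *)
Definition sinc (x : R) : R := limn (pseries sc x).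
Definition sinc' (x : R) : R := limn (pseries (pseries_diffs sc) x).

Lemma sc_le n : `|sc n| <= n`!%:R^-1.
Proof.
rewrite /sc normrM normfV normr_nat normrX normrN1 expr1n mul1r.
rewrite lef_pV2 ?posrE ?ltr0n ?fact_gt0// ler_nat.
by apply: leq_fact; rewrite -addnn -addnS leq_addr.
Qed.

Lemma is_derive_sinc (x : R) : is_derive x 1 sinc (sinc' x).
Proof. exact/is_derive_pseries/sc_le. Qed.

Lemma continuous_sinc' : continuous sinc'.
Proof.
move=> x; apply/differentiable_continuous/derivable1_diffP.
by have [] := is_derive_pseries x (pseries_diffs_le_invfact sc_le).
Qed.

Lemma sincE (t : R) : t * sinc (t ^+ 2) = sin t.
Proof.
have H := @cvg_sin_coeff' R t.
have C : pseries sc (t ^+ 2) @ \oo --> sinc (t ^+ 2).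
  exact/is_cvg_pseries_le_invfact/sc_le.
apply: cvg_unique H => //.
rewrite (_ : series _ = (fun n => t * pseries sc (t ^+ 2) n)).
  by apply: cvgM => //; exact: cvg_cst.
apply/funext => n; rewrite /pseries /series/= big_distrr/=.
apply: eq_bigr => i _; rewrite /sin_coeff' /sc exprS -muln2 mulnC exprM; ring.
Qed.

End Sinc.

(** * Gluing functions of one variable at a point *)

Section Glue.
Context {R : realType}.

Definition glue (X : R) (f g : R -> R) (r : R) : R := if r < X then f r else g r.

(** At [X] the difference quotient is, for every increment, the quotient of one of the two branches,
    and both tend to [g1 X]. *)
Lemma is_derive_glue (X : R) (f g f1 g1 : R -> R) :
  (forall r : R, r <= X -> is_derive r 1 f (f1 r)) ->
  (forall r : R, X <= r -> is_derive r 1 g (g1 r)) ->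
  f X = g X -> f1 X = g1 X -> forall r : R, is_derive r 1 (glue X f g) (glue X f1 g1 r).
Proof.
move=> df dg fg fg1 r; rewrite {2}/glue.
have [rX|Xr|rX] := ltgtP r X.
- apply: near_eq_is_derive (df r (ltW rX)); near=> s; rewrite /glue ifT//.
  by near: s; exact: lt_nbhsl.
- apply: near_eq_is_derive (dg r (ltW Xr)); near=> s; rewrite /glue ifF//.
  by apply/negbTE; rewrite -leNgt ltW//; near: s; exact: lt_nbhsr.
rewrite rX.
suff H : h^-1 *: (glue X f g (h *: (1 : R) + X) - glue X f g X) @[h --> 0^'] --> g1 X.
  by split; [apply/cvg_ex; exists (g1 X)|apply/cvg_lim].
have [df1 Ef] := df X (lexx X); have [dg1 Eg] := dg X (lexx X).
have cf : h^-1 *: (f (h *: (1 : R) + X) - f X) @[h --> 0^'] --> g1 X.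
  by rewrite -fg1 -Ef; exact: df1.
have cg : h^-1 *: (g (h *: (1 : R) + X) - g X) @[h --> 0^'] --> g1 X.
  by rewrite -Eg; exact: dg1.
apply/cvgrPdist_le => e e0.
move/cvgrPdist_le : cf => /(_ e e0) cf.
move/cvgrPdist_le : cg => /(_ e e0) cg.
near=> h; rewrite {2}/glue ltxx /glue; case: ifPn => _.
  by rewrite -fg; near: h.
by near: h.
Unshelve. all: by end_near. Qed.

Lemma continuous_glue (X : R) (f g : R -> R) :
  (forall r : R, r <= X -> {for r, continuous f}) ->
  (forall r : R, X <= r -> {for r, continuous g}) ->
  f X = g X -> continuous (glue X f g).
Proof.
move=> cf cg fg r.
have [rX|Xr|rX] := ltgtP r X.
- have E : {near r, f =1 glue X f g}.
    by near=> s; rewrite /glue ifT//; near: s; exact: lt_nbhsl.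
  rewrite /continuous_at {2}/glue rX; exact: cvg_trans (near_eq_cvg E) (cf r (ltW rX)).
- have E : {near r, g =1 glue X f g}.
    near=> s; rewrite /glue ifF//.
    by apply/negbTE; rewrite -leNgt ltW//; near: s; exact: lt_nbhsr.
  rewrite /continuous_at {2}/glue (lt_gtF Xr); exact: cvg_trans (near_eq_cvg E) (cg r (ltW Xr)).
rewrite rX /continuous_at {2}/glue ltxx.
apply/cvgrPdist_le => e e0.
have := cf X (lexx X); rewrite /prop_for /continuous_at fg => /cvgrPdist_le/(_ e e0) cf'.
have := cg X (lexx X) => /cvgrPdist_le/(_ e e0) cg'.
near=> s; rewrite /glue; case: ifPn => _; by near: s.
Unshelve. all: by end_near. Qed.

End Glue.

(** * Waves across layers: existence, energy, flux and profiles *)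

Section ODE.
Context {R : realType}.

(** [al] and [be] are the value and the slope at [X]. Differentiation stays in this family and sends
    the pair (al, be) to (be, - al k^2), so the same lemma also gives second derivatives. *)
Lemma is_derive_wave (k al be X : R) : k != 0 -> forall r : R,
  is_derive r 1 (fun r => al * cos (k * (r - X)) + be / k * sin (k * (r - X)))
    (be * cos (k * (r - X)) - al * k * sin (k * (r - X))).
Proof.
move=> k0 r.
have dl : is_derive r 1 (fun r : R => k * (r - X)) k.
  have h := is_deriveZ k (is_deriveB (is_derive_id r (1 : R)) (is_derive_cst X r 1)).
  by apply: (is_derive_ext h) => //; rewrite subr0 /(_ *: _)/= mulr1.
have dc := @is_derive1_comp R cos (fun r : R => k * (r - X)) r _ _ (is_derive_cos _) dl.
have ds := @is_derive1_comp R sin (fun r : R => k * (r - X)) r _ _ (is_derive_sin _) dl.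
apply: (is_derive_ext (is_deriveD (is_deriveZ al dc) (is_deriveZ (be / k) ds))) => //.
by rewrite !scaleRE; field.
Qed.

(** The solution is continued one layer at a time: beyond each interface it is replaced by the wave
    of the next layer with the same value and slope. The innermost piece is kept in closed form
    because it decides the regularity at the origin. *)
Lemma layered_ode (n : nat) (xs k : nat -> R) :
  (forall i, (i <= n)%N -> xs i < xs i.+1) ->
  (forall i, (i <= n)%N -> k i != 0) ->
  exists v v1 : R -> R,
  [/\ forall r : R, is_derive r 1 v (v1 r), continuous v1,
      forall i (r : R), (i <= n)%N -> xs i < r < xs i.+1 -> is_derive r 1 v1 (- (k i ^+ 2 * v r)) &
      forall r : R, r < xs 1%N -> v r = sin (k 0%N * r) / k 0%N].
Proof.
move=> xlt k0.
(* At every stage the equation of the last layer holds on the whole half-line beyond [xs m], ready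
   to be cut at the next interface. *)
suff : forall m, (m <= n)%N -> exists v v1 : R -> R,
  [/\ forall r : R, is_derive r 1 v (v1 r), continuous v1,
      forall i (r : R), (i < m)%N -> xs i < r < xs i.+1 -> is_derive r 1 v1 (- (k i ^+ 2 * v r)),
      forall r : R, xs m < r -> is_derive r 1 v1 (- (k m ^+ 2 * v r)) &
      forall r : R, r < xs 1%N -> v r = sin (k 0%N * r) / k 0%N].
  move=> /(_ n (leqnn n))[v [v1 [H1 H2 H3 H4 H5]]].
  exists v, v1; split => // i r; rewrite leq_eqVlt => /predU1P[->|ni].
    by move=> /andP[xr _]; exact: H4.
  exact: H3.
elim=> [|m IH] mn.
  have kn := k0 _ (leq0n n).
  have H := is_derive_wave 0 1 0 kn.
  exists (fun r => sin (k 0%N * r) / k 0%N), (fun r => cos (k 0%N * r)); split => //.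
  - move=> r; apply: (is_derive_ext (H r)).
      by move=> s; rewrite mul0r add0r subr0 div1r mulrC.
    by rewrite subr0 mul1r !mul0r subr0.
  - move=> r; apply: (continuous_cvg _ (@continuous_cos R (k 0%N * r))).
    by apply: cvgM; [exact: cvg_cst|exact: cvg_id].
  - move=> r _; apply: (is_derive_ext (is_derive_wave 1 0 0 kn r)).
      by move=> s; rewrite !mul0r addr0 mul1r subr0.
    by rewrite subr0; field.
have [v [v1 [H1 H2 H3 H4 H5]]] := IH (ltnW mn).
have kn := k0 _ mn; set X := xs m.+1; set K := k m.+1.
pose al := v X; pose be := v1 X.
pose w r := al * cos (K * (r - X)) + be / K * sin (K * (r - X)).
pose w1 r := be * cos (K * (r - X)) - al * K * sin (K * (r - X)).
have dw : forall r : R, is_derive r 1 w (w1 r) by exact: is_derive_wave.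
have dw1 (r : R) : is_derive r 1 w1 (- (K ^+ 2 * w r)).
  apply: (is_derive_ext (is_derive_wave be (- al * K ^+ 2) X kn r)).
    by move=> s; rewrite /w1 -/K; field.
  by rewrite /w -/K; field.
have wX : v X = w X by rewrite /w subrr mulr0 cos0 sin0 mulr1 mulr0 addr0.
have w1X : v1 X = w1 X by rewrite /w1 subrr mulr0 cos0 sin0 mulr1 mulr0 subr0.
have cw1 : continuous w1.
  by move=> r; apply/differentiable_continuous/derivable1_diffP; have [] := dw1 r.
exists (glue X v w), (glue X v1 w1); split.
- by apply: is_derive_glue.
- by apply: continuous_glue => // r _; [exact: H2|exact: cw1].
- move=> i r im ri.
  have rX : r < X.
    case/andP: ri => _ /lt_le_trans; apply.
    suff : (i <= m)%N -> xs i.+1 <= xs m.+1 by apply.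
    move=> {}im; have : forall j, (j <= m - i)%N -> xs (m - j).+1 <= xs m.+1.
      elim=> [|j IHj] jm; first by rewrite subn0.
      apply: le_trans (IHj (ltnW jm)).
      have jm' : (j < m)%N by apply: leq_trans jm _; exact: leq_subr.
      rewrite -subSn// subSS; apply/ltW/xlt.
      by apply: leq_trans (ltnW mn); rewrite leq_subr.
    by move=> /(_ (m - i)%N (leqnn _)); rewrite subKn.
  have E : \near r, v1 r = glue X v1 w1 r.
    by near=> s; rewrite /glue ifT//; near: s; exact: lt_nbhsl.
  rewrite {2}/glue rX; apply: near_eq_is_derive E _.
  move: im; rewrite ltnS leq_eqVlt => /predU1P[im|im]; last exact: H3.
  by rewrite im in ri *; apply: H4; case/andP: ri.
- move=> r Xr; rewrite {2}/glue (lt_gtF Xr).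
  have E : \near r, w1 r = glue X v1 w1 r.
    near=> s; rewrite /glue ifF//.
    by apply/negbTE; rewrite -leNgt ltW//; near: s; exact: lt_nbhsr.
  exact: near_eq_is_derive E _.
- move=> r rx; rewrite /glue ifT; first exact: H5.
  apply: lt_le_trans rx _.
  have : forall j, (j <= m)%N -> xs 1%N <= xs j.+1.
    elim=> [|j IHj] jm; first exact: lexx.
    apply: le_trans (IHj (ltnW jm)) _; apply/ltW/xlt.
    by apply: leq_trans jm _; exact: ltnW.
  exact.
Unshelve. all: by end_near. Qed.

(** Monotonicity needs the sign of the derivative off the interfaces only: continuity of [F] joins
    the layers. *)
Lemma layered_nondecreasing (n : nat) (xs : nat -> R) (F : R -> R) (h : nat -> R -> R) :
  (forall i, (i <= n)%N -> xs i < xs i.+1) -> continuous F ->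
  (forall i (r : R), (i <= n)%N -> xs i < r < xs i.+1 -> is_derive r 1 F (h i r)) ->
  (forall i (r : R), (i <= n)%N -> xs i < r < xs i.+1 -> 0 <= h i r) ->
  forall x y : R, xs 0%N <= x -> x <= y -> y <= xs n.+1 -> F x <= F y.
Proof.
move=> xlt cF dF h0.
have step i x y : (i <= n)%N -> xs i <= x -> x <= y -> y <= xs i.+1 -> F x <= F y.
  move=> ni xi xy yi.
  apply: (@ger0_derive1_le_cc _ F (xs i) (xs i.+1)) => //.
  - by move=> r; rewrite in_itv/= => ri; have [] := dF _ _ ni ri.
  - move=> r; rewrite in_itv/= => ri; have H := dF _ _ ni ri.
    by rewrite derive1E derive_val; exact: h0.
  - exact: continuous_subspaceT.
  - by rewrite in_itv/= xi (le_trans xy).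
  - by rewrite in_itv/= yi (le_trans xi).
suff H m : (m <= n)%N -> forall x y : R, xs 0%N <= x -> x <= y -> y <= xs m.+1 -> F x <= F y.
  exact: (H n (leqnn _)).
elim: m => [|m IH] mn x y x0 xy ym; first exact: (step 0%N).
have [yx|xy'] := leP y (xs m.+1); first by apply: IH => //; exact: ltnW.
have [mx|mx] := leP (xs m.+1) x; first exact: (step m.+1).
apply: (@le_trans _ _ (F (xs m.+1))).
  by apply: IH => //; [exact: ltnW|exact: ltW].
by apply: (step m.+1) => //; exact: ltW.
Qed.

Lemma is_derive_continuous (f f1 : R -> R) : (forall r : R, is_derive r 1 f (f1 r)) -> continuous f.
Proof.
by move=> d x; apply/differentiable_continuous/derivable1_diffP; have [] := d x.
Qed.

(* The derivative of the energy v'^2 + w^2 v^2 is 2 (w^2 - k^2) v v', which the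
   energy itself bounds up to the factor K w: the bound ignores the number of
   layers. *)
Lemma energy_estimate (n : nat) (xs k : nat -> R) (om K : R) (v v1 : R -> R) :
  0 < om -> 0 <= K ->
  (forall i, (i <= n)%N -> xs i < xs i.+1) ->
  (forall i, (i <= n)%N -> `|om ^+ 2 - k i ^+ 2| <= K * om ^+ 2) ->
  (forall r : R, is_derive r 1 v (v1 r)) -> continuous v1 ->
  (forall i (r : R), (i <= n)%N -> xs i < r < xs i.+1 -> is_derive r 1 v1 (- (k i ^+ 2 * v r))) ->
  forall x y : R, xs 0%N <= x -> x <= y -> y <= xs n.+1 ->
  (v1 x ^+ 2 + om ^+ 2 * v x ^+ 2) * expR (K * om * x) <=
  (v1 y ^+ 2 + om ^+ 2 * v y ^+ 2) * expR (K * om * y).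
Proof.
move=> om0 K0 xlt kK dv cv1 dv1.
have cv := is_derive_continuous dv.
have de (r : R) : is_derive r 1 (fun r => expR (K * om * r)) (K * om * expR (K * om * r)).
  have dl : is_derive r 1 (fun r : R => K * om * r) (K * om).
    apply: (is_derive_ext (is_deriveZ (K * om) (is_derive_id r (1:R)))) => //.
    by rewrite /= /(_ *: _)/= mulr1.
  apply: (is_derive_ext (@is_derive1_comp R expR (fun r => K * om * r) r _ _ (is_derive_expR _) dl)) => //.
  exact: mulrC.
(* With the weight exp(K om r) the energy is nondecreasing, which bounds it inside by its value at
   the outer radius, the direction used later. *)
pose E r := v1 r ^+ 2 + om ^+ 2 * v r ^+ 2.
pose h i r := E r * (K * om * expR (K * om * r)) + expR (K * om * r) *
   (2 * v1 r * (- (k i ^+ 2 * v r)) + om ^+ 2 * (2 * v r * v1 r)).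
apply: (@layered_nondecreasing _ _ _ h) => //.
- move=> r; apply: cvgM; last exact: (is_derive_continuous de).
  apply: cvgD; first exact: (continuous_cvg _ (@exprn_continuous _ 2 (v1 r)) (cv1 r)).
  apply: cvgM; first exact: cvg_cst.
  exact: (continuous_cvg _ (@exprn_continuous _ 2 (v r)) (cv r)).
- move=> i r ni ri.
  have H1 := is_deriveX 2 (dv1 _ _ ni ri).
  have H2 := is_deriveZ (om ^+ 2) (is_deriveX 2 (dv r)).
  apply: (is_derive_ext (is_deriveM (is_deriveD H1 H2) (de r))); first by [].
  rewrite -[_ r]/(v1 r ^+ 2 + om ^+ 2 * v r ^+ 2) /h /E !scaleRE /=; ring.
move=> i r ni ri; rewrite /h.
have -> : E r * (K * om * expR (K * om * r)) + expR (K * om * r) *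
   (2 * v1 r * (- (k i ^+ 2 * v r)) + om ^+ 2 * (2 * v r * v1 r)) =
   expR (K * om * r) * (K * om * E r + 2 * ((om ^+ 2 - k i ^+ 2) * (v r * v1 r))) by ring.
rewrite mulr_ge0 ?expR_ge0//.
have H : `|2 * ((om ^+ 2 - k i ^+ 2) * (v r * v1 r))| <= K * om * E r.
  rewrite !normrM (ger0_norm (ler0n _ _)).
  apply: (@le_trans _ _ (2 * (K * om ^+ 2 * (`|v r| * `|v1 r|)))).
    rewrite ler_pM2l//; apply: ler_wpM2r; [exact: mulr_ge0|exact: kK].
  rewrite /E -(real_normK (num_real (v1 r))) -(real_normK (num_real (v r))).
  (* Expanding this square gives 2 om |v| |v1| <= E. *)
  have := sqr_ge0 (`|v1 r| - om * `|v r|) => S.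
  have -> : 2 * (K * om ^+ 2 * (`|v r| * `|v1 r|)) = K * om * (2 * om * `|v r| * `|v1 r|) by ring.
  apply: ler_wpM2l; first by rewrite mulr_ge0// ltW.
  by rewrite -subr_ge0; apply: le_trans S _; rewrite le_eqVlt; apply/orP; left; apply/eqP; ring.
by move: H; rewrite ler_norml => /andP[+ _]; rewrite -subr_ge0 opprK addrC.
Qed.

(** r v' - v is r^2 times the slope of v / r. Its derivative r v'' = - k_i^2 r v is at most Q M r^2
    in size, because the mean value theorem gives |v| <= M r. The resulting cubic rate is the source
    of the factor r in the gradient bound. *)
Lemma radial_flux_estimate (n : nat) (xs k : nat -> R) (Q M : R) (v v1 : R -> R) :
  xs 0%N = 0 -> 0 <= M ->
  (forall i, (i <= n)%N -> xs i < xs i.+1) ->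
  (forall i, (i <= n)%N -> k i ^+ 2 <= Q) ->
  (forall r : R, is_derive r 1 v (v1 r)) -> continuous v1 ->
  (forall i (r : R), (i <= n)%N -> xs i < r < xs i.+1 -> is_derive r 1 v1 (- (k i ^+ 2 * v r))) ->
  v 0 = 0 -> (forall r : R, 0 <= r <= xs n.+1 -> `|v1 r| <= M) ->
  forall r : R, 0 <= r <= xs n.+1 -> `|v r| <= M * r /\ `|r * v1 r - v r| <= Q * M * r ^+ 3.
Proof.
move=> x0 M0 xlt kQ dv cv1 dv1 v0 v1M.
have cv := is_derive_continuous dv.
have vM r : 0 <= r <= xs n.+1 -> `|v r| <= M * r.
  move=> /andP[]; rewrite le_eqVlt => /predU1P[<- _|r0 r1].
    by rewrite v0 normr0 mulr0.
  have [c] := MVT r0 (fun x _ => dv x) (continuous_subspaceT cv).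
  rewrite in_itv/= => /andP[c0 cr]; rewrite v0 !subr0 => ->.
  rewrite normrM (gtr0_norm r0) ler_pM2r//; apply: v1M.
  by rewrite (ltW c0) ltW// (lt_le_trans cr).
have Q0 : 0 <= Q by apply: le_trans (kQ 0%N (leq0n _)); exact: sqr_ge0.
move=> r r01; split; first exact: vM.
(* The values 1 and -1 of [s] give the upper and the lower bound. *)
have sgn (s : R) : `|s| = 1 -> s * (r * v1 r - v r) <= Q * M * r ^+ 3.
  move=> s1.
  pose F r := Q * M * r ^+ 3 - s * (r * v1 r - v r).
  have F0 : F 0 = 0 by rewrite /F v0 expr0n/= !mulr0 mul0r subrr mulr0 subrr.
  rewrite -subr_ge0 -/(F r) -F0.
  pose h i (r : R) := Q * M * (3 * r ^+ 2) - s * (v1 r + r * (- (k i ^+ 2 * v r)) - v1 r).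
  case/andP: r01 => r0 r1.
  apply: (@layered_nondecreasing n xs F h xlt); [| | |by rewrite x0|exact: r0|exact: r1].
  - move=> x; apply: cvgB; first by apply: cvgM; [exact: cvg_cst|exact: exprn_continuous].
    apply: cvgM; first exact: cvg_cst.
    by apply: cvgB; [apply: cvgM; [exact: cvg_id|exact: cv1]|exact: cv].
  - move=> i x ni xi.
    have H1 := is_deriveZ (Q * M) (is_deriveX 3 (is_derive_id x (1:R))).
    have H2 := is_deriveB (is_deriveM (is_derive_id x (1:R)) (dv1 _ _ ni xi)) (dv x).
    apply: (is_derive_ext (is_deriveB H1 (is_deriveZ s H2))); first by [].
    by rewrite /h /= !scaleRE; ring.
  move=> i x ni xi; rewrite /h.
  have -> : Q * M * (3 * x ^+ 2) - s * (v1 x + x * - (k i ^+ 2 * v x) - v1 x) =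
     3 * (Q * M * x ^+ 2) + s * (x * (k i ^+ 2 * v x)) by ring.
  have [xi0 xin] : 0 <= xs i /\ xs i.+1 <= xs n.+1.
    by have := layer_bounds xlt ni; rewrite x0.
  have /andP[ix xi1] := xi.
  have xx : 0 <= x <= xs n.+1 by rewrite (le_trans xi0 (ltW ix)) (le_trans (ltW xi1)).
  have x0' : 0 <= x by case/andP: xx.
  have H : `|s * (x * (k i ^+ 2 * v x))| <= Q * M * x ^+ 2.
    rewrite normrM s1 mul1r normrM (ger0_norm x0') normrM (ger0_norm (sqr_ge0 (k i))).
    apply: (@le_trans _ _ (x * (Q * (M * x)))); last by rewrite le_eqVlt; apply/orP; left; apply/eqP; ring.
    apply: ler_wpM2l => //; apply: ler_pM => //; [exact: sqr_ge0|exact: kQ|exact: vM].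
  have P : 0 <= Q * M * x ^+ 2 by rewrite mulr_ge0 ?sqr_ge0// mulr_ge0.
  move: H; rewrite ler_norml => /andP[H _]; lra.
rewrite ler_norml; apply/andP; split.
  by rewrite lerNl -mulN1r; apply: sgn; rewrite normrN1.
by rewrite -[leLHS]mul1r; apply: sgn; rewrite normr1.
Qed.

(** The variable is t = |x|^2 because |x|^2, unlike |x|, is a polynomial in the coordinates. *)
Definition profile (v : R -> R) (t : R) : R := v (Num.sqrt t) / Num.sqrt t.

Definition profile1 (v v1 : R -> R) (t : R) : R :=
  (Num.sqrt t * v1 (Num.sqrt t) - v (Num.sqrt t)) / (2 * Num.sqrt t ^+ 3).

Lemma profileE (v : R -> R) (r : R) : 0 < r -> profile v (r ^+ 2) = v r / r.
Proof. by move=> r0; rewrite /profile sqrtr_sqr gtr0_norm. Qed.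

Lemma profile1E (v v1 : R -> R) (r : R) : 0 < r ->
  profile1 v v1 (r ^+ 2) = (r * v1 r - v r) / (2 * r ^+ 3).
Proof. by move=> r0; rewrite /profile1 sqrtr_sqr gtr0_norm. Qed.

Lemma is_derive_profile (v v1 : R -> R) :
  (forall r : R, is_derive r 1 v (v1 r)) -> continuous v1 -> forall t : R,
  (0 < t -> is_derive t 1 (profile v) (profile1 v v1 t)) /\
  (0 < t -> {for t, continuous (profile1 v v1)}).
Proof.
move=> dv cv1 t; have cv := is_derive_continuous dv; split=> t0.
  have s0 : 0 < Num.sqrt t by rewrite sqrtr_gt0.
  have sn0 : Num.sqrt t != 0 by rewrite gt_eqF.
  have ds := is_derive1_sqrt t0.
  have dvs := @is_derive1_comp R v (@Num.sqrt R) t _ _ (dv _) ds.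
  apply: (is_derive_ext (is_deriveM dvs (is_deriveV sn0 ds))); first by [].
  rewrite !scaleRE /profile1 /=; field; exact: sn0.
have s0 : 0 < Num.sqrt t by rewrite sqrtr_gt0.
have cs := @sqrt_continuous R t.
apply: cvgM; last first.
  apply: cvgV; first by rewrite mulf_neq0// expf_neq0// gt_eqF.
  apply: cvgM; first exact: cvg_cst.
  exact: (continuous_cvg _ (@exprn_continuous _ 3 _) cs).
apply: cvgB; last exact: (continuous_cvg _ (cv _) cs).
by apply: cvgM; [exact: cs|exact: (continuous_cvg _ (cv1 _) cs)].
Qed.

(* A radial function v(|x|)/|x| with v as in [layered_ode] is V(|x|^2) with V of
   class C^1 on the whole line. *)
Lemma radial_profile (X k : R) (v v1 : R -> R) : 0 < X -> k != 0 ->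
  (forall r : R, is_derive r 1 v (v1 r)) -> continuous v1 ->
  (forall r : R, r < X -> v r = sin (k * r) / k) ->
  exists V V1 : R -> R, [/\ forall t : R, is_derive t 1 V (V1 t), continuous V1,
    forall r : R, 0 < r -> V (r ^+ 2) = v r / r &
    forall r : R, 0 < r -> V1 (r ^+ 2) = (r * v1 r - v r) / (2 * r ^+ 3)].
Proof.
move=> X0 k0 dv cv1 vX.
have cv := is_derive_continuous dv.
have v1X r : r < X -> v1 r = cos (k * r).
  move=> rX.
  have H : is_derive r 1 v (cos (k * r)).
    have E : \near r, sin (k * r) / k = v r.
      by near=> s; rewrite vX//; near: s; exact: lt_nbhsl.
    apply: (near_eq_is_derive E).
    apply: (is_derive_ext (is_derive_wave 0 1 0 k0 r)).
      by move=> s; rewrite mul0r add0r subr0 div1r mulrC.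
    by rewrite subr0 mul1r !mul0r subr0.
  by have [_ <-] := H; have [_ <-] := dv r.
pose X2 := X ^+ 2.
have X20 : 0 < X2 by rewrite exprn_gt0.
(* The profile of sin(k r) / k in closed form, regular at 0 and for negative t. *)
pose f t := sinc (k ^+ 2 * t).
pose f1 t := k ^+ 2 * sinc' (k ^+ 2 * t).
have /all_and2[dg cg1] := is_derive_profile dv cv1.
set g := profile v in dg; set g1 := profile1 v v1 in dg cg1.
have df (t : R) : is_derive t 1 f (f1 t).
  have dl : is_derive t 1 (fun t : R => k ^+ 2 * t) (k ^+ 2).
    apply: (is_derive_ext (is_deriveZ (k ^+ 2) (is_derive_id t (1:R)))) => //.
    by rewrite /= /(_ *: _)/= mulr1.
  apply: (is_derive_ext (@is_derive1_comp R sinc (fun t => k ^+ 2 * t) t _ _ (is_derive_sinc _) dl)) => //.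
  exact: mulrC.
have cf1 : continuous f1.
  move=> t.
  have cl : k ^+ 2 * s @[s --> t] --> k ^+ 2 * t.
    by apply: cvgM; [exact: cvg_cst|exact: cvg_id].
  have cs := continuous_cvg _ (@continuous_sinc' R (k ^+ 2 * t)) cl.
  by apply: cvgM; [exact: cvg_cst|exact: cs].
have fg t : 0 < t -> t < X2 -> f t = g t.
  move=> t0 tX; have s0 : 0 < Num.sqrt t by rewrite sqrtr_gt0.
  have sX : Num.sqrt t < X by rewrite -(gtr0_norm X0) -sqrtr_sqr ltr_sqrt.
  rewrite /f /g /profile vX//.
  have {1}-> : t = Num.sqrt t ^+ 2 by rewrite sqr_sqrtr// ltW.
  rewrite -exprMn; have /(canRL (mulKf _)) -> := sincE (k * Num.sqrt t).
    by rewrite mulrC invfM mulrA.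
  by rewrite mulf_neq0// gt_eqF.
have fg1 t : 0 < t -> t < X2 -> f1 t = g1 t.
  move=> t0 tX.
  have E : \near t, f t = g t.
    by near=> s; apply: fg; near: s; [exact: lt_nbhsr|exact: lt_nbhsl].
  have := near_eq_is_derive E (df t) => -[_ <-].
  by have [_ ->] := dg t t0.
(* Any point strictly between 0 and [X2] would do: the two branches agree around it, so values and
   derivatives match. *)
pose Y := X2 / 2.
have Y0 : 0 < Y by rewrite divr_gt0.
have YX : Y < X2 by rewrite /Y; lra.
have YY : g Y = f Y /\ g1 Y = f1 Y by rewrite fg// fg1.
exists (glue Y f g), (glue Y f1 g1); split.
- apply: (is_derive_glue (fun t _ => df t) _ (esym YY.1) (esym YY.2)) => t Yt.
  by apply: dg; exact: lt_le_trans Yt.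
- apply: (continuous_glue (fun t _ => cf1 t) _ (esym YY.2)) => t Yt.
  by apply: cg1; exact: lt_le_trans Yt.
- move=> r r0; have r20 : 0 < r ^+ 2 by rewrite exprn_gt0.
  rewrite -[RHS](profileE v r0) /glue; case: ltP => // rY.
  by rewrite fg// (lt_trans rY).
move=> r r0; have r20 : 0 < r ^+ 2 by rewrite exprn_gt0.
rewrite -[RHS](profile1E v v1 r0) /glue; case: ltP => // rY.
by rewrite fg1// (lt_trans rY).
Unshelve. all: by end_near. Qed.

(** Below X^2 the profile is continued by its tangent line, which makes it C^1 on the whole line
    without changing it for r >= X. *)
Lemma exterior_profile (X : R) (v v1 : R -> R) : 0 < X ->
  (forall r : R, is_derive r 1 v (v1 r)) -> continuous v1 ->
  exists V V1 : R -> R, [/\ forall t : R, is_derive t 1 V (V1 t), continuous V1,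
    forall r : R, X <= r -> V (r ^+ 2) = v r / r &
    forall r : R, X <= r -> V1 (r ^+ 2) = (r * v1 r - v r) / (2 * r ^+ 3)].
Proof.
move=> X0 dv cv1; have /all_and2[dg cg1] := is_derive_profile dv cv1.
set g := profile v in dg; set g1 := profile1 v v1 in dg cg1.
pose Y := X ^+ 2; have Y0 : 0 < Y by rewrite exprn_gt0.
pose f t := g Y + g1 Y * (t - Y).
have df (t : R) : is_derive t 1 f (g1 Y).
  have h := is_deriveD (is_derive_cst (g Y) t (1 : R))
    (is_deriveZ (g1 Y) (is_deriveB (is_derive_id t (1 : R)) (is_derive_cst Y t 1))).
  by apply: (is_derive_ext h) => //; rewrite subr0 add0r scaleRE mulr1.
have leY r : X <= r -> 0 < r /\ (r ^+ 2 < Y) = false.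
  move=> Xr; have r0 := lt_le_trans X0 Xr; split => //.
  by apply/negbTE; rewrite -leNgt /Y ler_pXn2r ?nnegrE// ltW.
exists (glue Y f g), (glue Y (fun=> g1 Y) g1); split.
- have fY : f Y = g Y by rewrite /f subrr mulr0 addr0.
  apply: (is_derive_glue (fun t _ => df t) _ fY) => // t Yt.
  by apply: dg; exact: lt_le_trans Yt.
- apply: continuous_glue => [t _|t Yt|] //; first exact: cvg_cst.
  by apply: cg1; exact: lt_le_trans Yt.
- by move=> r /leY[r0 rY]; rewrite /glue rY -(profileE v r0).
by move=> r /leY[r0 rY]; rewrite /glue rY -(profile1E v v1 r0).
Qed.

End ODE.

(** * Weierstrass approximation and smooth functions *)

Section Weierstrass.
Context {R : realType}.

Lemma uniformly_continuous_itv (f : R -> R) (a b e : R) : continuous f -> 0 < e ->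
  exists2 d, 0 < d & forall x y : R, a <= x <= b -> `|y - x| < d -> `|f y - f x| <= e.
Proof.
move=> cf e0.
have /compact_near_coveringP cov := @segment_compact R a b.
have H := cov R (0 : R)^'+ (fun d x => forall y, `|y - x| < d -> `|f y - f x| <= e)
  (at_right_proper_filter 0).
have {H} : \forall d \near (0 : R)^'+, `[a, b]%classic `<=` (fun x => forall y, `|y - x| < d -> `|f y - f x| <= e).
  apply: H => x _.
  have e20 : 0 < e / 2 by rewrite divr_gt0.
  have := cf x => /cvgrPdist_le/(_ _ e20)/nbhs_ballP[d /= d0 Hd].
  have d20 : 0 < d / 2 by rewrite divr_gt0.
  exists (ball x (d / 2), [set d' | 0 < d' < d / 2]) => /=.
    split; first exact: nbhsx_ballx.
    near=> d'; rewrite /=; apply/andP; split; near: d'.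
      exact: nbhs_right_gt.
    exact: nbhs_right_lt.
  move=> [z d'] /= [xz /andP[d'0 d'd]] y yz.
  have xy : `|x - y| < d.
    have -> : x - y = (x - z) - (y - z) by ring.
    apply: le_lt_trans (ler_normB _ _) _.
    by rewrite [ltRHS](splitr d) ltrD// (lt_trans yz).
  have xz' : `|x - z| < d by apply: lt_trans xz _; rewrite ltr_pdivrMr// ltr_pMr// ltr1n.
  have -> : f y - f z = (f x - f z) - (f x - f y) by ring.
  apply: le_trans (ler_normB _ _) _; rewrite (splitr e).
  by apply: lerD; apply: Hd.
move=> H.
have : \forall d \near (0 : R)^'+, 0 < d /\ `[a, b]%classic `<=` (fun x => forall y, `|y - x| < d -> `|f y - f x| <= e).
  by near=> d; split; near: d => //; exact: nbhs_right_gt.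
move=> /filter_ex[d [d0 Hd]]; exists d => // x y xab; apply: Hd.
by rewrite /= in_itv/=.
Unshelve. all: by end_near. Qed.

(** The Bernstein basis: the probability of k successes in n trials of success probability x. Its
    total mass, mean and variance drive the approximation. *)
Let bern (n k : nat) (x : R) : R := x ^+ k * (1 - x) ^+ (n - k) *+ 'C(n, k).

Lemma bern_sum n x : \sum_(k < n.+1) bern n k x = 1.
Proof.
have := exprDn (1 - x) x n; rewrite subrK expr1n => E.
by rewrite [RHS]E; apply: eq_bigr => k _; rewrite /bern mulrC.
Qed.

(** The absorption identity for binomial coefficients; summed over k, it reduces each moment to a
    lower one. *)
Lemma bern_shift n k x : k.+1%:R * bern n.+1 k.+1 x = n.+1%:R * x * bern n k x.
Proof.
rewrite /bern subSS exprS -[_ *+ 'C(n.+1, _)]mulr_natr -[_ *+ 'C(n, _)]mulr_natr.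
have : (n.+1%:R * 'C(n, k)%:R = k.+1%:R * 'C(n.+1, k.+1)%:R :> R).
  by rewrite -!natrM mul_bin_diag.
move=> H; transitivity (x * x ^+ k * (1 - x) ^+ (n - k) * (k.+1%:R * 'C(n.+1, k.+1)%:R)).
  by ring.
by rewrite -H; ring.
Qed.

Lemma bern_mean n x : \sum_(k < n.+2) k%:R * bern n.+1 k x = n.+1%:R * x.
Proof.
rewrite big_ord_recl mul0r add0r /=.
under eq_bigr do rewrite /bump/= add1n bern_shift.
by rewrite -big_distrr/= bern_sum mulr1.
Qed.

Lemma bern_var n x : \sum_(k < n.+3) (k%:R - n.+2%:R * x) ^+ 2 * bern n.+2 k x =
  n.+2%:R * x * (1 - x).
Proof.
have S2 : \sum_(k < n.+3) k%:R ^+ 2 * bern n.+2 k x = n.+2%:R * x * (n.+1%:R * x + 1).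
  rewrite big_ord_recl expr0n/= mul0r add0r.
  have E (i : 'I_n.+2) : (bump 0 i)%:R ^+ 2 * bern n.+2 (bump 0 i) x =
      n.+2%:R * x * (i%:R * bern n.+1 i x + bern n.+1 i x).
    by rewrite /bump/= add1n expr2 -mulrA bern_shift -(natr1 i); ring.
  under eq_bigr do rewrite E.
  by rewrite -big_distrr/= big_split/= bern_mean bern_sum.
transitivity (\sum_(k < n.+3) (k%:R ^+ 2 * bern n.+2 k x - 2 * n.+2%:R * x * (k%:R * bern n.+2 k x)
   + (n.+2%:R * x) ^+ 2 * bern n.+2 k x)).
  by apply: eq_bigr => k _; ring.
rewrite big_split/= sumrB S2 -!big_distrr/= bern_mean bern_sum -(natr1 n.+1); ring.
Qed.

Lemma bern_ge0 n k x : 0 <= x <= 1 -> 0 <= bern n k x.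
Proof.
move=> /andP[x0 x1]; rewrite /bern mulrn_wge0// mulr_ge0// exprn_ge0//.
by rewrite subr_ge0.
Qed.

(** Bernstein's proof. If k/N is within [d] of x, uniform continuity bounds the deviation of f;
    otherwise 2 M times (k/N - x)^2 / d^2 does, as in Chebyshev's inequality, and the variance makes
    the sum of these terms small. *)
Lemma weierstrass01 (f : R -> R) (e : R) : continuous f -> 0 < e ->
  exists p : {poly R}, forall x, 0 <= x <= 1 -> `|p.[x] - f x| <= e.
Proof.
move=> cf e0; have e20 : 0 < e / 2 by rewrite divr_gt0.
have [d d0 Hd] := uniformly_continuous_itv 0 1 cf e20.
have [M M0 fM] : exists2 M, 0 <= M & forall x, 0 <= x <= 1 -> `|f x| <= M.
  have /compact_bounded[M [_ HM]] : compact (f @` `[0, 1]).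
    by apply: continuous_compact; [exact: continuous_subspaceT|exact: segment_compact].
  exists (`|M| + 1); first by rewrite addr_ge0.
  move=> x x01; apply: HM; first by rewrite ltr_pwDr// ler_norm.
  by exists x => //; rewrite /= in_itv.
(* Chosen so that 2 M / (d^2 N) <= e / 2. The degree is [n.+2], the form in which [bern_var]
   computes the variance. *)
pose n := Num.truncn (4 * M / (d ^+ 2 * e)).
pose N := n.+2.
have N0 : 0 < N%:R :> R by [].
have Ne : 2 * M / d ^+ 2 / N%:R <= e / 2.
  have d20 : 0 < d ^+ 2 by rewrite exprn_gt0.
  have : 4 * M / (d ^+ 2 * e) <= N%:R.
    apply/ltW/(lt_trans (truncnS_gt _)); by rewrite ltr_nat.
  rewrite ler_pdivrMr ?mulr_gt0// => H.
  rewrite ler_pdivrMr// ler_pdivrMr//.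
  have -> : e / 2 * N%:R * d ^+ 2 = N%:R * (d ^+ 2 * e) / 2 by field.
  by rewrite ler_pdivlMr//; apply: le_trans H; rewrite le_eqVlt; apply/orP; left; apply/eqP; ring.
exists (\sum_(k < N.+1) (f (k%:R / N%:R) *+ 'C(N, k)) *: ('X^k * (1%:P - 'X) ^+ (N - k))).
move=> x x01.
have -> : (\sum_(k < N.+1) (f (k%:R / N%:R) *+ 'C(N, k)) *: ('X^k * (1%:P - 'X) ^+ (N - k))).[x] =
   \sum_(k < N.+1) f (k%:R / N%:R) * bern N k x.
  rewrite horner_sum; apply: eq_bigr => k _; rewrite hornerZ hornerM hornerXn horner_exp.
  rewrite !(hornerD, hornerN, hornerC, hornerX) /bern.
  by rewrite -[f _ *+ _]mulr_natr -[_ * _ *+ _]mulr_natr; ring.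
have -> : f x = \sum_(k < N.+1) f x * bern N k x by rewrite -big_distrr/= bern_sum mulr1.
rewrite -sumrB; apply: le_trans (ler_norm_sum _ _ _) _.
apply: (@le_trans _ _ (\sum_(k < N.+1) (e / 2 + 2 * M / d ^+ 2 / N%:R ^+ 2 * (k%:R - N%:R * x) ^+ 2) * bern N k x)).
  apply: ler_sum => k _; rewrite -mulrBl normrM (ger0_norm (bern_ge0 _ _ x01)).
  apply: ler_wpM2r; first exact: bern_ge0.
  have kN : 0 <= (k%:R / N%:R : R) <= 1.
    by rewrite divr_ge0//= ler_pdivrMr// mul1r ler_nat -ltnS.
  have P : 0 <= 2 * M / d ^+ 2 / N%:R ^+ 2 * (k%:R - N%:R * x) ^+ 2.
    rewrite mulr_ge0 ?sqr_ge0//; rewrite !mulr_ge0 ?invr_ge0 ?sqr_ge0//.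
  have [kd|kd] := ltP `|k%:R / N%:R - x| d.
    by apply: le_trans (Hd _ _ x01 kd) _; rewrite lerDl.
  apply: (@le_trans _ _ (2 * M)).
    apply: le_trans (ler_normB _ _) _.
    have -> : 2 * M = M + M by ring.
    by apply: lerD; exact: fM.
  have -> : 2 * M / d ^+ 2 / N%:R ^+ 2 * (k%:R - N%:R * x) ^+ 2 =
     2 * M * ((k%:R / N%:R - x) ^+ 2 / d ^+ 2) by field; rewrite !gt_eqF.
  apply: (@le_trans _ _ (2 * M * ((k%:R / N%:R - x) ^+ 2 / d ^+ 2))); last by rewrite lerDr ltW.
  rewrite -[leLHS]mulr1; apply: ler_wpM2l; first exact: mulr_ge0.
  rewrite ler_pdivlMr ?exprn_gt0// mul1r -[leRHS]real_normK ?num_real//.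
  by apply: lerXn2r => //; rewrite nnegrE ltW.
have -> : \sum_(k < N.+1) (e / 2 + 2 * M / d ^+ 2 / N%:R ^+ 2 * (k%:R - N%:R * x) ^+ 2) * bern N k x =
   e / 2 * \sum_(k < N.+1) bern N k x + 2 * M / d ^+ 2 / N%:R ^+ 2 *
     \sum_(k < N.+1) (k%:R - N%:R * x) ^+ 2 * bern N k x.
  rewrite !big_distrr -big_split/=; apply: eq_bigr => k _; move: (2 * M / _ / _) => q; ring.
rewrite bern_sum mulr1 bern_var.
rewrite [leRHS](splitr e) lerD2l; apply: le_trans Ne.
have /andP[x0 x1] := x01.
have -> : 2 * M / d ^+ 2 / N%:R ^+ 2 * (N%:R * x * (1 - x)) =
  2 * M / d ^+ 2 / N%:R * (x * (1 - x)) by field; rewrite !gt_eqF.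
rewrite -[leRHS]mulr1; apply: ler_wpM2l.
  by rewrite !mulr_ge0 ?invr_ge0 ?sqr_ge0 ?ler0n.
by rewrite -[leRHS]mulr1; apply: ler_pM; rewrite ?subr_ge0// lerBlDr lerDl.
Qed.

Lemma weierstrass (f : R -> R) (a b e : R) : continuous f -> a < b -> 0 < e ->
  exists p : {poly R}, forall x, a <= x <= b -> `|p.[x] - f x| <= e.
Proof.
move=> cf ab e0.
have ba0 : 0 < b - a by rewrite subr_gt0.
have cg : continuous (fun s : R => f (a + s * (b - a))).
  move=> s.
  have cl : a + s * (b - a) @[s --> s] --> a + s * (b - a).
    by apply: cvgD; [exact: cvg_cst|apply: cvgM; [exact: cvg_id|exact: cvg_cst]].
  exact: (continuous_cvg _ (cf _) cl).
have [p Hp] := weierstrass01 cg e0.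
exists (p \Po ((b - a)^-1 *: ('X - a%:P))) => x /andP[ax xb].
rewrite horner_comp !hornerE.
have := Hp ((b - a)^-1 * (x - a)).
have -> : a + (b - a)^-1 * (x - a) * (b - a) = x by field; rewrite gt_eqF.
apply.
rewrite mulrC; apply/andP; split.
  by rewrite divr_ge0// ?subr_ge0// ltW.
by rewrite ler_pdivrMr// mul1r lerD2r.
Qed.

(** The constant coefficient is a division by 0, hence 0. *)
Definition antideriv (p : {poly R}) : {poly R} := \poly_(i < (size p).+1) (p`_i.-1 / i%:R).

Lemma deriv_antideriv p : (antideriv p)^`() = p.
Proof.
apply/polyP => i; rewrite coef_deriv coef_poly ltnS.
have [ip|ip] := ltnP i (size p); last by rewrite mul0rn nth_default.
by rewrite /= -[LHS]mulr_natr mulfVK// pnatr_eq0.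
Qed.

(** The derivative is approximated and then integrated from [a], with the right value there; the
    mean value theorem carries the error over. The tolerance e / (1 + (b - a)) is at most e, and so
    is its product with b - a. *)
Lemma C1_weierstrass (V V1 : R -> R) (a b e : R) : (forall t : R, is_derive t 1 V (V1 t)) ->
  continuous V1 -> a < b -> 0 < e ->
  exists p : {poly R}, forall x, a <= x <= b ->
    `|p.[x] - V x| <= e /\ `|p^`().[x] - V1 x| <= e.
Proof.
move=> dV cV1 ab e0.
have ba0 : 0 < b - a by rewrite subr_gt0.
pose e' := e / (1 + (b - a)).
have s0 : 0 < 1 + (b - a) by rewrite ltr_wpDl.
have e'0 : 0 < e' by rewrite divr_gt0.
have e'e : e' <= e by rewrite ler_pdivrMr// ler_peMr//; [exact: ltW|rewrite lerDl ltW].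
have [p Hp] := weierstrass cV1 ab e'0.
pose q := antideriv p + (V a - (antideriv p).[a])%:P.
have qa : q.[a] = V a by rewrite /q hornerD hornerC addrC subrK.
have dq : q^`() = p by rewrite derivD derivC addr0 deriv_antideriv.
exists q => x /andP[ax xb]; split; last by rewrite dq (le_trans (Hp x _))// ax.
have dF (t : R) : is_derive t 1 (fun t => q.[t] - V t) (p.[t] - V1 t).
  by have := is_deriveB (is_derive_poly q t) (dV t); rewrite dq.
move: ax; rewrite le_eqVlt => /predU1P[<-|ax].
  by rewrite qa subrr normr0 ltW.
have [c] := MVT ax (fun t _ => dF t) (continuous_subspaceT (is_derive_continuous dF)).
rewrite in_itv/= => /andP[ac cx]; rewrite qa subrr subr0 => ->.
rewrite normrM; apply: (@le_trans _ _ (e' * (b - a))).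
  apply: ler_pM => //; first by apply: Hp; rewrite !ltW// (lt_le_trans cx).
  by rewrite gtr0_norm ?subr_gt0// lerD2r.
by rewrite /e' mulrAC ler_pdivrMr// ler_pM2l// lerDr.
Qed.

End Weierstrass.

(** * Smooth functions: polynomials in |x|^2 and compactly supported bumps *)

Section SmoothFunctions.
Context {R : realType}.
Local Notation R3 := (R * R * R)%type.

Lemma coordD (x y : R3) i : coord (x + y) i = coord x i + coord y i.
Proof.
rewrite !coordE -[(x + y).1.1]/(x.1.1 + y.1.1) -[(x + y).1.2]/(x.1.2 + y.1.2).
by rewrite -[(x + y).2]/(x.2 + y.2); ring.
Qed.

(** A directional derivative is a derivative in one real variable, so the one-variable chain rule
    becomes available for functions on space. *)
Lemma is_derive_line (V : normedModType R) (f : V -> R) (x v : V) (d : R) :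
  is_derive x v f d <-> is_derive (0 : R) 1 (fun t : R => f (t *: v + x)) d.
Proof.
have E : (fun h : R => h^-1 *: (f ((h *: (1 : R) + 0) *: v + x) - f (0 *: v + x))) =
   (fun h => h^-1 *: (f (h *: v + x) - f x)).
  apply/funext => h; have -> : h *: (1 : R) = h by exact: mulr1.
  by rewrite addr0 scale0r add0r.
split=> -[H1 H2]; split.
- by rewrite /derivable [X in X @ _]E.
- by rewrite /derive [X in X @ _]E.
- by move: H1; rewrite /derivable [X in X @ _]E.
- by move: H2; rewrite /derive [X in X @ _]E.
Qed.

Lemma is_derive_comp_line (V : normedModType R) (f : R -> R) (g : V -> R) (x v : V) (a b : R) :
  is_derive (g x) 1 f a -> is_derive x v g b -> is_derive x v (f \o g) (a * b).
Proof.
move=> df /is_derive_line dg; apply/is_derive_line.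
apply: (@is_derive1_comp R f (fun t => g (t *: v + x)) 0 a b) => //.
by rewrite scale0r add0r.
Qed.

Lemma is_derive_coord (x v : R3) i : is_derive x v (fun y => coord y i) (coord v i).
Proof.
apply/is_derive_line.
apply: (is_derive_ext (is_deriveD (is_deriveZ (coord v i) (is_derive_id (0:R) (1:R)))
   (is_derive_cst (coord x i) (0:R) 1))).
  by move=> t; rewrite coordD coordZ mulrC.
by rewrite addr0 scaleRE mulr1.
Qed.

Lemma continuous_coord i : continuous (fun x : R3 => coord x i).
Proof.
move=> x; rewrite (_ : (fun x : R3 => coord x i) = (fun x : R3 => (i == i0)%:R * x.1.1 +
   (i == i1)%:R * x.1.2 + (i == i2)%:R * x.2)); last by apply/funext => y; rewrite coordE.
apply: cvgD; [apply: cvgD|]; apply: cvgM; first [exact: cvg_cst|idtac].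
- exact: (cvg_comp _ _ (@cvg_fst _ _ _ _ _) (@cvg_fst _ _ _ _ _)).
- exact: (cvg_comp _ _ (@cvg_fst _ _ _ _ _) (@cvg_snd _ _ _ _ _)).
- exact: cvg_snd.
Qed.

Definition sqnorm (x : R3) : R := x.1.1 ^+ 2 + x.1.2 ^+ 2 + x.2 ^+ 2.

Lemma sqnormE (x : R3) : sqnorm x = enorm x ^+ 2.
Proof. by rewrite /enorm sqr_sqrtr// !addr_ge0 ?sqr_ge0. Qed.

Lemma sqnorm_coord (x : R3) : sqnorm x = \sum_(i < 3) coord x i * coord x i.
Proof. by rewrite big_I3 coord_i0 coord_i1 coord_i2 /sqnorm !expr2. Qed.

Lemma is_derive_sqnorm (x v : R3) :
  is_derive x v sqnorm (\sum_(i < 3) 2 * coord x i * coord v i).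
Proof.
have d i := is_deriveM (is_derive_coord x v i) (is_derive_coord x v i).
apply: (is_derive_ext (is_deriveD (is_deriveD (d i0) (d i1)) (d i2))).
  by move=> y; rewrite sqnorm_coord big_I3.
by rewrite big_I3 !scaleRE; ring.
Qed.

Lemma coord_basis (i j : 'I_3) : coord (basis i : R3) j = (i == j)%:R.
Proof.
by case: i => -[|[|[|//]]] p; case: j => -[|[|[|//]]] q;
  rewrite /coord /basis -val_eqE.
Qed.

Lemma is_derive_sqnorm_basis (x : R3) i : is_derive x (basis i) sqnorm (2 * coord x i).
Proof.
apply: (is_derive_ext (is_derive_sqnorm x (basis i))) => //.
rewrite (bigD1 i)//= coord_basis eqxx mulr1 big1 ?addr0// => j ji.
by rewrite coord_basis eq_sym (negbTE ji) mulr0.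
Qed.

Lemma continuous_sqnorm : continuous sqnorm.
Proof.
move=> x; rewrite (_ : sqnorm = (fun y => coord y i0 * coord y i0 +
   coord y i1 * coord y i1 + coord y i2 * coord y i2)).
  by apply: cvgD; [apply: cvgD|]; apply: cvgM; exact: continuous_coord.
by apply/funext => y; rewrite sqnorm_coord big_I3.
Qed.

(* The parameter p makes this class of functions closed under differentiation. *)
Definition bump (p : {poly R}) (t : R) : R :=
  if 0 < t then p.[t^-1] * expR (- t^-1) else 0.

(** With y = 1/t, the inequality y^(i+1) / (i+1)! <= exp y gives t^-i exp(-1/t) <= (i+1)! t. Applied
    to ['X * p] this bounds the difference quotient of [bump p] at 0, which therefore tends to 0. *)
Lemma bump_bound (p : {poly R}) : exists2 C, 0 <= C & forall t, `|bump p t| <= C * `|t|.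
Proof.
exists (\sum_(i < size p) `|p`_i| * (i.+1)`!%:R).
  by apply: sumr_ge0 => i _; rewrite mulr_ge0.
move=> t; rewrite /bump; case: ltP => t0; last first.
  by rewrite normr0 mulr_ge0//; apply: sumr_ge0 => i _; rewrite mulr_ge0.
rewrite normrM (gtr0_norm t0) (gtr0_norm (expR_gt0 _)) horner_coef mulr_suml.
apply: le_trans (ler_wpM2r (expR_ge0 _) (ler_norm_sum _ _ _)) _.
rewrite mulr_suml; apply: ler_sum => i _.
set y := t^-1; have y0 : 0 < y by rewrite invr_gt0.
rewrite normrM -!mulrA; apply: ler_wpM2l => //.
rewrite normrX (gtr0_norm y0) expRN ler_pdivrMr ?expR_gt0//.
have H : y ^+ i.+1 / (i.+1)`!%:R <= expR y.
  by apply: le_trans (expR_ge1Dxn i (ltW y0)); rewrite lerDr.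
have f0 : 0 < (i.+1)`!%:R :> R by rewrite ltr0n fact_gt0.
have -> : y ^+ i = t * (y ^+ i.+1 / (i.+1)`!%:R) * (i.+1)`!%:R.
  by rewrite exprS -mulrA divfK ?gt_eqF// mulrA /y mulfV ?mul1r// gt_eqF.
have -> : t * (y ^+ i.+1 / (i.+1)`!%:R) * (i.+1)`!%:R =
  (i.+1)`!%:R * t * (y ^+ i.+1 / (i.+1)`!%:R) by ring.
by apply: ler_wpM2l => //; rewrite mulr_ge0// ltW.
Qed.

(** For t > 0 the derivative of p(1/t) exp(-1/t) is t^-2 (p - p')(1/t) exp(-1/t), whence the new
    polynomial. *)
Lemma is_derive_bump (p : {poly R}) (t : R) :
  is_derive t 1 (bump p) (bump ('X^2 * (p - p^`())) t).
Proof.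
rewrite {2}/bump; have [t0|t0|<-] := ltgtP 0 t.
- have tn0 : t != 0 by rewrite gt_eqF.
  have E : \near t, p.[t^-1] * expR (- t^-1) = bump p t.
    by near=> s; rewrite /bump ifT//; near: s; exact: lt_nbhsr.
  apply: (near_eq_is_derive E).
  have dV := is_deriveV tn0 (is_derive_id t (1:R)).
  have dp := @is_derive1_comp R (horner p) (fun t => t^-1) t _ _ (is_derive_poly p _) dV.
  have de := @is_derive1_comp R expR (fun t => - t^-1) t _ _ (is_derive_expR _) (is_deriveN dV).
  apply: (is_derive_ext (is_deriveM dp de)) => //.
  rewrite !scaleRE hornerM hornerXn hornerD hornerN /=; field.
  exact: tn0.
- have E : \near t, cst 0 t = bump p t.
    near=> s; rewrite /bump ifF//; apply/negbTE; rewrite -leNgt ltW//.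
    by near: s; exact: lt_nbhsl.
  apply: (near_eq_is_derive E); exact: is_derive_cst.
suff H : h^-1 *: (bump p (h *: (1 : R) + 0) - bump p 0) @[h --> 0^'] --> (0 : R).
  by split; [apply/cvg_ex; exists 0|apply/cvg_lim].
have [C C0 HC] := bump_bound ('X * p).
apply/cvgr0Pnorm_le => e e0.
have C1 : 0 < C + 1 by rewrite ltr_wpDl.
near=> h.
have h0 : h != 0 by near: h; exact: nbhs_dnbhs_neq.
have -> : h^-1 *: (bump p (h *: (1 : R) + 0) - bump p 0) = bump ('X * p) h.
  have -> : h *: (1 : R) = h by exact: mulr1.
  rewrite addr0 {2}/bump ltxx subr0 scaleRE /bump; case: ifP => _; last by rewrite mulr0.
  by rewrite hornerM hornerX mulrA.
apply: le_trans (HC h) _.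
apply: (@le_trans _ _ ((C + 1) * `|h|)); first by rewrite ler_wpM2r// lerDl.
rewrite mulrC -ler_pdivlMr//; near: h; apply: dnbhs0_le; exact: divr_gt0.
Unshelve. all: by end_near. Qed.

Lemma continuous_bump p : continuous (bump p).
Proof. exact: is_derive_continuous (is_derive_bump p). Qed.

(** The derivative of a product is a sum of products, so induction on the order of differentiability
    has to range over a class that contains the partial derivatives of its members. Smooth functions
    are generators in order that closure under sums and products can be read off. *)
Inductive smooth_gen : (R3 -> R) -> Prop :=
| gen_smooth f : smooth f -> smooth_gen f
| gen_cst (c : R) : smooth_gen (fun=> c)
| gen_coord i : smooth_gen (fun x => coord x i)
| gen_bump p (a : R) : smooth_gen (fun x => bump p (a - sqnorm x))
| gen_add f g : smooth_gen f -> smooth_gen g -> smooth_gen (fun x => f x + g x)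
| gen_mul f g : smooth_gen f -> smooth_gen g -> smooth_gen (fun x => f x * g x).

Lemma smooth_derivable (f : R3 -> R) i x : smooth f -> derivable f x (basis i).
Proof. by move=> /(_ 1%N)[_ /(_ i)[]]. Qed.

Lemma smooth_derive (f : R3 -> R) i : smooth f -> smooth (fun x => 'D_(basis i) f x).
Proof. by move=> sf k; have [_ /(_ i)[]] := sf k.+1. Qed.

Lemma smooth_continuous (f : R3 -> R) : smooth f -> continuous f.
Proof. by move=> /(_ 0%N)[]. Qed.

Lemma smooth_C1 (f : R3 -> R) : smooth f -> C1 f.
Proof.
move=> sf; split; first exact: smooth_continuous.
move=> i; split; first by move=> x; exact: smooth_derivable.
exact/smooth_continuous/smooth_derive.
Qed.

Lemma smooth_gen_continuous f : smooth_gen f -> continuous f.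
Proof.
elim=> {f} [f|c|i|p a|f g _ cf _ cg|f g _ cf _ cg].
- exact: smooth_continuous.
- by move=> x; exact: cvg_cst.
- exact: continuous_coord.
- move=> x; have cl : a - sqnorm y @[y --> x] --> a - sqnorm x.
    by apply: cvgB; [exact: cvg_cst|exact: continuous_sqnorm].
  exact: (continuous_cvg _ (@continuous_bump p (a - sqnorm x)) cl).
- by move=> x; apply: cvgD; [exact: cf|exact: cg].
- by move=> x; apply: cvgM; [exact: cf|exact: cg].
Qed.

Lemma smooth_gen_derive f i : smooth_gen f ->
  exists2 g, smooth_gen g & forall x, is_derive x (basis i) f (g x).
Proof.
elim=> {f} [f sf|c|j|p a|f g gf [f' gf' df] gg [g' gg' dg]|f g gf [f' gf' df] gg [g' gg' dg]].
- exists (fun x => 'D_(basis i) f x); first exact/gen_smooth/smooth_derive.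
  by move=> x; apply: DeriveDef => //; exact: smooth_derivable.
- by exists (fun=> 0); [exact: gen_cst|move=> x; exact: is_derive_cst].
- exists (fun=> (i == j)%:R); first exact: gen_cst.
  by move=> x; rewrite -coord_basis; exact: is_derive_coord.
- exists (fun x => bump ('X^2 * (p - p^`())) (a - sqnorm x) * (-2 * coord x i)).
    by apply: gen_mul; [exact: gen_bump|apply: gen_mul; [exact: gen_cst|exact: gen_coord]].
  move=> x; have d := is_deriveB (is_derive_cst a x (basis i)) (is_derive_sqnorm_basis x i).
  apply: (is_derive_ext (is_derive_comp_line (is_derive_bump p _) d)) => //.
  by congr (_ * _); ring.
- exists (fun x => f' x + g' x); first exact: gen_add.
  by move=> x; exact: is_deriveD.
exists (fun x => f x * g' x + g x * f' x).
  by apply: gen_add; exact: gen_mul.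
by move=> x; exact: is_deriveM.
Qed.

Lemma smooth_gen_smooth f : smooth_gen f -> smooth f.
Proof.
move=> + k; elim: k f => [|k IH] f gf; split => //; try exact: smooth_gen_continuous.
move=> i; have [g gg dg] := smooth_gen_derive i gf; split; first by move=> x; have [] := dg x.
rewrite (_ : (fun x => _) = g); first exact: IH.
by apply/funext => x; have [_ ->] := dg x.
Qed.

Lemma smooth_poly_sqnorm (p : {poly R}) : smooth (fun x => p.[sqnorm x]).
Proof.
apply: smooth_gen_smooth; elim/poly_ind: p => [|p c gp].
  rewrite (_ : (fun x => _) = fun=> 0); first exact: gen_cst.
  by apply/funext => x; rewrite horner0.
rewrite (_ : (fun x => _) = fun x => p.[sqnorm x] * (coord x i0 * coord x i0 +
  coord x i1 * coord x i1 + coord x i2 * coord x i2) + c); last first.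
  by apply/funext => x; rewrite hornerD hornerM hornerX hornerC sqnorm_coord big_I3.
apply: gen_add; last exact: gen_cst.
apply: gen_mul => //.
by apply: gen_add; [apply: gen_add|]; apply: gen_mul; exact: gen_coord.
Qed.

Lemma smooth_mul (f g : R3 -> R) : smooth f -> smooth g -> smooth (fun x => f x * g x).
Proof. by move=> sf sg; apply/smooth_gen_smooth/gen_mul; exact: gen_smooth. Qed.

Lemma smooth_add (f g : R3 -> R) : smooth f -> smooth g -> smooth (fun x => f x + g x).
Proof. by move=> sf sg; apply/smooth_gen_smooth/gen_add; exact: gen_smooth. Qed.

Lemma smooth_cst (c : R) : smooth (fun _ : R3 => c).
Proof. by apply/smooth_gen_smooth; exact: gen_cst. Qed.

Lemma smooth_bump p (a : R) : smooth (fun x => bump p (a - sqnorm x)).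
Proof. by apply/smooth_gen_smooth; exact: gen_bump. Qed.

Lemma smooth_opp (f : R3 -> R) : smooth f -> smooth (fun x => - f x).
Proof.
move=> sf; rewrite (_ : (fun x => _) = fun x => -1 * f x).
  by apply: smooth_mul => //; exact: smooth_cst.
by apply/funext => x; rewrite mulN1r.
Qed.

End SmoothFunctions.

(** * Integration by parts against compactly supported functions *)

Section IntegralPartial.
Context {R : realType}.
Local Notation R3 := (R * R * R)%type.
Local Notation leb1 := (@leb1 R).
Local Notation leb2 := (@leb2 R).
Local Notation leb3 := (@leb3 R).

Lemma integral_compact_derivative (F f : R -> R) (M : R) : 0 < M ->
  continuous f -> (forall r : R, is_derive r 1 F (f r)) ->
  (forall r, M < `|r| -> F r = 0) -> (forall r, M < `|r| -> f r = 0) ->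
  (\int[leb1]_r (f r)%:E = 0)%E.
Proof.
move=> M0 cf dF F0 f0.
pose N := M + 1.
have MN : - N < N by rewrite /N; lra.
have NM : M < N by rewrite ltrDl.
pose J : set R := `](- N), N[%classic.
have E : (\int[leb1]_r (f r)%:E = \int[leb1]_(r in J) (f r)%:E)%E.
  rewrite [RHS]integral_mkcond; apply: eq_integral => r _.
  rewrite patchE /J in_oo_set -ltr_norml; case: ltP => // Nr.
  by rewrite f0// (lt_le_trans NM).
have cF := is_derive_continuous dF.
rewrite E /J (@integral_derivative _ F f f (- N) N MN)//.
- by rewrite !F0 ?subrr// ?normrN gtr0_norm// (lt_trans M0).
- exact: continuous_measurable_fun.
- by move=> r _; exact: cF.
- by move=> r _; exact: cf.
Qed.

(** A cube rather than a ball: on every line parallel to an axis, vanishing outside it means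
    vanishing outside one fixed interval. *)
Definition box (M : R) : set R3 := [set x | [/\ `|x.1.1| <= M, `|x.1.2| <= M & `|x.2| <= M]].

Lemma integrable_box (f : R3 -> R) (M : R) : 0 < M -> continuous f ->
  (forall x, ~ box M x -> f x = 0) -> leb3.-integrable setT (EFin \o f).
Proof.
move=> M0 cf f0.
have mf := continuous_measurable_R3 cf.
have bE x : box M x -> enorm x < 2 * M.
  move=> [h1 h2 h3].
  have M2 : 0 <= 2 * M by rewrite mulr_ge0// ltW.
  rewrite -(ger0_norm M2) -sqrtr_sqr /enorm ltr_sqrt ?exprn_gt0 ?mulr_gt0//.
  have S (u : R) : `|u| <= M -> u ^+ 2 <= M ^+ 2.
    by move=> uM; rewrite -[leLHS]real_normK ?num_real// lerXn2r// nnegrE ltW.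
  have := S _ h1; have := S _ h2; have := S _ h3.
  have : 0 < M ^+ 2 by rewrite exprn_gt0.
  rewrite exprMn; lra.
have [N N0 fN] := continuous_bounded_ball (2 * M) cf.
have mB := @measurable_eball R (2 * M).
have : leb3.-integrable (eball (2 * M)) (EFin \o f).
  apply: measurable_bounded_integrable => //.
  - exact: leb3_ball_lty.
  - exact: (measurable_funS measurableT).
  exists N; split; first by rewrite num_real.
  by move=> z Nz x /ltW/fN h; exact: le_trans (ltW Nz).
move/(integrable_mkcond (EFin \o f) mB); apply: eq_integrable => // x _.
rewrite patchE; case: ifPn => // /negP xB; rewrite /= f0// => /bE h.
by apply: xB; apply/mem_set.
Qed.

Lemma integrable_slice (f : R3 -> R) (M c : R) : 0 < M -> continuous f ->
  (forall x, ~ box M x -> f x = 0) -> leb2.-integrable setT (fun ab => (f (ab, c))%:E).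
Proof.
move=> M0 cf f0.
have mf := continuous_measurable_R3 cf.
(* Half-open to match [leb1_itv]; the additional 1 keeps the end point -M inside. *)
pose J : set R := `](-M - 1), M]%classic.
pose B : set (R * R) := J `*` J.
have mJ : measurable J by exact: measurable_itv.
have mB : measurable B by exact: measurableX.
have mfc : measurable_fun setT (fun ab : R * R => f (ab, c)) by exact: measurable_fun_pair1.
have fB : (leb2 B < +oo)%E.
  have fJ : (leb1 J < +oo)%E by rewrite /J leb1_itv ?ltry//; lra.
  rewrite [X in (X < _)%E](_ : _ = leb1 J * leb1 J)%E; last exact: product_measure1E.
  by apply: lte_mul_pinfty => //; rewrite ge0_fin_numE.
have [N N0 fN] := continuous_bounded_ball (3 * M + `|c| + 3) cf.
have : leb2.-integrable B (fun ab => (f (ab, c))%:E).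
  apply: (@measurable_bounded_integrable _ _ _ leb2 (fun ab => f (ab, c)) B) => //.
    exact: (measurable_funS measurableT).
  exists N; split; first by rewrite num_real.
  move=> z Nz [a b] [/= aJ bJ]; apply: le_trans (ltW Nz); apply: fN.
  have S (u : R) : J u -> `|u| <= M + 1.
    by rewrite /J/= in_itv/= ler_norml => /andP[h1 h2]; apply/andP; split; lra.
  have ha := S _ aJ; have hb := S _ bJ.
  have p : 0 <= 3 * M + `|c| + 3 by rewrite !addr_ge0// mulr_ge0// ltW.
  rewrite -[leRHS](ger0_norm p) -sqrtr_sqr /enorm ler_sqrt ?sqr_ge0//=.
  rewrite -(real_normK (num_real a)) -(real_normK (num_real b)) -(real_normK (num_real c)).
  have := normr_ge0 a; have := normr_ge0 b; have := normr_ge0 c.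
  move: `|a| `|b| `|c| ha hb {p} => x y w hx hy w0 y0 x0; nra.
move/(integrable_mkcond _ mB); apply: eq_integrable => // -[a b] _.
rewrite patchE; case: ifPn => // /negP xB; rewrite /= f0// => -[/= h1 h2 h3].
apply: xB; apply/mem_set; split; rewrite /J /= in_itv/=.
  by move: h1; rewrite ler_norml => /andP[u1 u2]; apply/andP; split; lra.
by move: h2; rewrite ler_norml => /andP[u1 u2]; apply/andP; split; lra.
Qed.

Lemma continuous_slice1 (b c : R) : continuous (fun a : R => (a, b, c)).
Proof.
move=> t; apply: (@cvg_pair _ _ _ _ (nbhs (t, b)) (nbhs c)); last exact: cvg_cst.
by apply: (@cvg_pair _ _ _ _ (nbhs t) (nbhs b)); [exact: cvg_id|exact: cvg_cst].
Qed.

Lemma continuous_slice2 (a c : R) : continuous (fun b : R => (a, b, c)).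
Proof.
move=> t; apply: (@cvg_pair _ _ _ _ (nbhs (a, t)) (nbhs c)); last exact: cvg_cst.
by apply: (@cvg_pair _ _ _ _ (nbhs a) (nbhs t)); [exact: cvg_cst|exact: cvg_id].
Qed.

Lemma continuous_slice3 (ab : R * R) : continuous (fun c : R => (ab, c)).
Proof.
move=> t; apply: (@cvg_pair _ _ _ _ (nbhs ab) (nbhs t)); first exact: cvg_cst.
exact: cvg_id.
Qed.

(** Fubini's theorem lets the integral in the direction of differentiation come first, and it
    vanishes on every line by compact support. *)
Lemma integral_partial (psi : R3 -> R) (M : R) (i : 'I_3) : 0 < M -> C1 psi ->
  (forall x, ~ box M x -> psi x = 0) ->
  (forall x, ~ box M x -> 'D_(basis i) psi x = 0) ->
  (\int[leb3]_x ('D_(basis i) psi x)%:E = 0)%E.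
Proof.
move=> M0 [_ C] p0 d0.
have [dp cd] := C i.
have int3 := integrable_box M0 cd d0.
have int2 c := integrable_slice c M0 cd d0.
have cslice (f : R -> R3) : continuous f -> continuous (fun t => 'D_(basis i) psi (f t)).
  by move=> cf t; exact: (continuous_cvg _ (cd (f t)) (cf t)).
have [i_eq|i_eq|i_eq] : [\/ i = i0, i = i1 | i = i2].
  by case: i {dp cd d0 int3 int2 cslice} => -[|[|[|//]]] p; [constructor 1|constructor 2|constructor 3];
     apply/val_inj; rewrite /= inordK.
- have := @integral21_prod_meas1 _ _ _ _ R leb2 leb1 _ int3.
  rewrite [X in _ = X](_ : _ = \int[leb3]_x ('D_(basis i) psi x)%:E)%E// => <-.
  rewrite integral0_eq// => c _.
  have := @integral21_prod_meas1 _ _ _ _ R leb1 leb1 _ (int2 c).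
  rewrite [X in _ = X](_ : _ = \int[leb2]_ab ('D_(basis i) psi (ab, c))%:E)%E// => H.
  rewrite /fubini_G -[LHS]H integral0_eq// => b _; rewrite /fubini_G.
  apply: (@integral_compact_derivative (fun a => psi (a, b, c)) _ M) => //.
  + apply: cslice; exact: continuous_slice1.
  + by move=> a; rewrite i_eq; apply: is_derive_slice1; rewrite -i_eq.
  + by move=> a Ma; rewrite p0// => -[/=]; rewrite leNgt Ma.
  + by move=> a Ma; rewrite d0// => -[/=]; rewrite leNgt Ma.
- have := @integral21_prod_meas1 _ _ _ _ R leb2 leb1 _ int3.
  rewrite [X in _ = X](_ : _ = \int[leb3]_x ('D_(basis i) psi x)%:E)%E// => <-.
  rewrite integral0_eq// => c _.
  have := @integral12_prod_meas1 _ _ _ _ R leb1 leb1 _ (int2 c).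
  rewrite [X in _ = X](_ : _ = \int[leb2]_ab ('D_(basis i) psi (ab, c))%:E)%E// => H.
  rewrite /fubini_G -[LHS]H integral0_eq// => a _; rewrite /fubini_F.
  apply: (@integral_compact_derivative (fun b => psi (a, b, c)) _ M) => //.
  + apply: cslice; exact: continuous_slice2.
  + by move=> b; rewrite i_eq; apply: is_derive_slice2; rewrite -i_eq.
  + by move=> b Mb; rewrite p0// => -[/= _]; rewrite leNgt Mb.
  + by move=> b Mb; rewrite d0// => -[/= _]; rewrite leNgt Mb.
have := @integral12_prod_meas1 _ _ _ _ R leb2 leb1 _ int3.
rewrite [X in _ = X](_ : _ = \int[leb3]_x ('D_(basis i) psi x)%:E)%E// => <-.
rewrite integral0_eq// => -[a b] _; rewrite /fubini_F.
apply: (@integral_compact_derivative (fun c => psi (a, b, c)) _ M) => //.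
+ apply: cslice; exact: continuous_slice3.
+ by move=> c; rewrite i_eq; apply: is_derive_slice3; rewrite -i_eq.
+ by move=> c Mc; rewrite p0// => -[/= _ _]; rewrite leNgt Mc.
+ by move=> c Mc; rewrite d0// => -[/= _ _]; rewrite leNgt Mc.
Qed.

Lemma C1_mul (f g : R3 -> R) : C1 f -> C1 g ->
  C1 (fun x => f x * g x) /\ forall i x, 'D_(basis i) (fun x => f x * g x) x =
    f x * 'D_(basis i) g x + g x * 'D_(basis i) f x.
Proof.
move=> [cf Cf] [cg Cg].
have d i x : is_derive x (basis i) (fun x => f x * g x) (f x * 'D_(basis i) g x + g x * 'D_(basis i) f x).
  have df := DeriveDef ((Cf i).1 x) erefl; have dg := DeriveDef ((Cg i).1 x) erefl.
  exact: is_deriveM.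
have E i x : 'D_(basis i) (fun x => f x * g x) x = f x * 'D_(basis i) g x + g x * 'D_(basis i) f x.
  by have [_ ->] := d i x.
split => //; split; first by move=> x; apply: cvgM; [exact: cf|exact: cg].
move=> i; split; first by move=> x; have [] := d i x.
rewrite [X in continuous X](_ : _ = (fun x => f x * 'D_(basis i) g x + g x * 'D_(basis i) f x)).
  move=> x; apply: cvgD; apply: cvgM; [exact: cf|exact: (Cg i).2|exact: cg|exact: (Cf i).2].
by apply/funext => x; rewrite E.
Qed.

Lemma derive_vanish (f : R3 -> R) (K : set R3) (v : R3) : closed K ->
  (forall x, ~ K x -> f x = 0) -> forall x, ~ K x -> 'D_v f x = 0.
Proof.
move=> cK f0 x Kx; rewrite (near_eq_derive (g := cst 0)) ?derive_cst//.
have oK : open (~` K) by rewrite openC.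
by near=> y; rewrite /= f0//; near: y; exact: open_nbhs_nbhs.
Unshelve. all: by end_near. Qed.

Lemma compact_box (K : set R3) : compact K -> exists2 M, 0 < M & K `<=` box M.
Proof.
move=> /compact_bounded[M [_ HM]]; exists (`|M| + 1); first by rewrite ltr_wpDl.
move=> x Kx; have := HM (`|M| + 1) _ x Kx; rewrite ltr_pwDr ?ler_norm// => /(_ isT).
by rewrite /= !prod_normE !ge_max => /andP[/andP[h1 h2] h3]; split.
Qed.

(** The product u phi vanishes off [K], so the integrals over [D] are integrals over the whole
    space, where the partial derivative of u phi integrates to 0. *)
Lemma C1_integration_by_parts (D K : set R3) (u phi : R3 -> R) (i : 'I_3) :
  measurable D -> compact K -> K `<=` D -> C1 u -> C1 phi ->
  (forall x, ~ K x -> phi x = 0) ->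
  [/\ leb3.-integrable D (EFin \o (fun x => u x * 'D_(basis i) phi x)),
      leb3.-integrable D (EFin \o (fun x => 'D_(basis i) u x * phi x)) &
  \int[leb3]_(x in D) (u x * 'D_(basis i) phi x) =
  - \int[leb3]_(x in D) ('D_(basis i) u x * phi x)].
Proof.
move=> mD cK KD Cu Cp p0.
have clK : closed K by apply: compact_closed => //; exact: norm_hausdorff.
have d0 := derive_vanish (basis i) clK p0.
have [M M0 KM] := compact_box cK.
have [Cup Eup] := C1_mul Cu Cp.
have bK x : ~ box M x -> ~ K x by move=> h /KM.
have up0 x : ~ box M x -> u x * phi x = 0 by move=> /bK/p0 ->; rewrite mulr0.
have dup0 x : ~ box M x -> 'D_(basis i) (fun x => u x * phi x) x = 0.
  by move=> /bK h; rewrite Eup p0// d0// mul0r mulr0 addr0.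
have H := integral_partial M0 Cup up0 dup0.
have [cu Du] := Cu; have [cp Dp] := Cp.
have int1 : leb3.-integrable setT (EFin \o (fun x => u x * 'D_(basis i) phi x)).
  apply: (@integrable_box _ M) => //.
    by move=> x; apply: cvgM; [exact: cu|exact: (Dp i).2].
  by move=> x /bK h; rewrite d0// mulr0.
have int2 : leb3.-integrable setT (EFin \o (fun x => 'D_(basis i) u x * phi x)).
  apply: (@integrable_box _ M) => //.
    by move=> x; apply: cvgM; [exact: (Du i).2|exact: cp].
  by move=> x /bK h; rewrite p0// mulr0.
have I1 := integrableS measurableT mD (@subsetT _ D) int1.
have I2 := integrableS measurableT mD (@subsetT _ D) int2.
split => //; apply/eqP; rewrite -addr_eq0 -RintegralD//; apply/eqP.
rewrite /Rintegral -[RHS]/(fine 0) -H; congr fine.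
rewrite integral_mkcond; apply: eq_integral => x _; rewrite patchE Eup.
case: ifPn => [_|/negP xD]; first by rewrite /= [in RHS]addrC [phi x * _]mulrC addrC.
have xK : ~ K x by move=> /KD xD'; apply: xD; apply/mem_set.
by rewrite p0// d0// mul0r mulr0 addr0.
Qed.

End IntegralPartial.

Local Open Scope complex_scope.

(** * Traces and density *)

Section RealTrace.
Context {R : realType}.
Local Notation R3 := (R * R * R)%type.
Local Notation leb3 := (@leb3 R).
Local Notation B := (@punctured_ball R).

Definition cvg_L2 (D : set R3) (f : nat -> R3 -> R) (g : R3 -> R) : Prop :=
  (\int[leb3]_(x in D) ((f k x - g x) ^+ 2)%:E)%E @[k --> \oo] --> 0%E.

Lemma cvge0_le (F : nat -> \bar R) (e : R) : 0 < e -> F k @[k --> \oo] --> 0%E ->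
  \forall k \near \oo, (F k <= e%:E)%E.
Proof.
move=> e0 /fine_cvgP[Ff /cvgr0Pnorm_le/(_ e e0) H].
near=> k; have fk : F k \is a fin_num by near: k.
rewrite -(fineK fk) lee_fin; apply: le_trans (ler_norm _) _; by near: k.
Unshelve. all: by end_near. Qed.

(** The pointwise inequality |f| <= d + f^2 / d takes the place of the Cauchy-Schwarz inequality. *)
Lemma integrable_sqr_le (D : set R3) (f : R3 -> R) (d : R) : measurable D ->
  (leb3 D < +oo)%E -> measurable_fun D f -> 0 < d ->
  (\int[leb3]_(x in D) ((f x) ^+ 2)%:E <= (d ^+ 2)%:E)%E ->
  leb3.-integrable D (EFin \o f) /\
  \int[leb3]_(x in D) `|f x| <= d * (fine (leb3 D) + 1).
Proof.
move=> mD fD mf d0 H.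
have fDn : leb3 D \is a fin_num by rewrite ge0_fin_numE.
have mf2 : measurable_fun D (fun x => (f x ^+ 2)%:E).
  by apply/measurable_EFinP; exact: measurable_funX.
have mfn : measurable_fun D (fun x => `|f x|%:E).
  by apply/measurable_EFinP; exact: measurableT_comp.
have L : (\int[leb3]_(x in D) `|f x|%:E <= (d * (fine (leb3 D) + 1))%:E)%E.
  apply: (@le_trans _ _ (\int[leb3]_(x in D) (d%:E + (d^-1)%:E * (f x ^+ 2)%:E)))%E.
    apply: ge0_le_integral => //.
    - by apply: emeasurable_funD => //; exact: measurable_funeM.
    - move=> x Dx; rewrite -EFinM -EFinD lee_fin.
      have [h|h] := leP `|f x| d.
        by apply: (le_trans h); rewrite lerDl mulr_ge0 ?sqr_ge0// invr_ge0 ltW.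
      rewrite -[f x ^+ 2]real_normK ?num_real//.
      apply: (@le_trans _ _ (d^-1 * `|f x| ^+ 2)); last by rewrite lerDr ltW.
      have f0 : 0 < `|f x| by exact: lt_trans h.
      by rewrite mulrC ler_pdivlMr// expr2 ler_pM2l// ltW.
  rewrite ge0_integralD//; last 3 first.
  - by move=> x _; rewrite lee_fin ltW.
  - by move=> x _; rewrite -EFinM lee_fin mulr_ge0 ?sqr_ge0// invr_ge0 ltW.
  - exact: measurable_funeM.
  rewrite integral_cst// ge0_integralZl_EFin//; last 2 first.
  - by move=> x _; rewrite lee_fin sqr_ge0.
  - by rewrite invr_ge0 ltW.
  apply: (@le_trans _ _ (d%:E * leb3 D + (d^-1)%:E * (d ^+ 2)%:E)%E).
    by apply: leeD => //; apply: lee_wpmul2l => //; rewrite lee_fin invr_ge0 ltW.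
  rewrite -(fineK fDn) -!EFinM -EFinD lee_fin /= expr2 mulKf ?gt_eqF//.
  by rewrite mulrDr mulr1.
split.
  apply/integrableP; split; first exact/measurable_EFinP.
  by apply: le_lt_trans L _; rewrite ltry.
rewrite /Rintegral -lee_fin fineK//; apply: fin_real; rewrite (lt_le_trans (ltNyr 0)).
  by apply: le_lt_trans L _; rewrite ltry.
by apply: integral_ge0 => x _; rewrite lee_fin.
Qed.

Lemma cvg_L2_integrable (D : set R3) (f : nat -> R3 -> R) (g : R3 -> R) :
  measurable D -> (leb3 D < +oo)%E -> (forall k, leb3.-integrable D (EFin \o f k)) ->
  measurable_fun D g -> cvg_L2 D f g -> leb3.-integrable D (EFin \o g).
Proof.
move=> mD fD fi mg cv.
have mfi k : measurable_fun D (f k) by have /integrableP[/measurable_EFinP] := fi k.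
have [k Hk] := filter_ex (cvge0_le (exprn_gt0 2 ltr01) cv).
have mfg : measurable_fun D (fun x => f k x - g x) by exact: measurable_funB.
have [ifg _] := integrable_sqr_le mD fD mfg ltr01 Hk.
have := integrableB mD (fi k) ifg.
by apply: eq_integrable => // x _ /=; rewrite -EFinB; congr _%:E; ring.
Qed.

Lemma cvg_L2_Rintegral (D : set R3) (al : R3 -> R) (M : R) (f : nat -> R3 -> R) (g : R3 -> R) :
  measurable D -> (leb3 D < +oo)%E -> measurable_fun D al ->
  (forall x, D x -> `|al x| <= M) -> (forall k, leb3.-integrable D (EFin \o f k)) ->
  measurable_fun D g -> cvg_L2 D f g ->
  [/\ leb3.-integrable D (EFin \o (fun x => al x * g x)),
     forall k, leb3.-integrable D (EFin \o (fun x => al x * f k x)) &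
   (\int[leb3]_(x in D) (al x * f k x)) @[k --> \oo] --> \int[leb3]_(x in D) (al x * g x)].
Proof.
move=> mD fD mal alM fi mg cv.
have gi := cvg_L2_integrable mD fD fi mg cv.
have mfi k : measurable_fun D (f k) by have /integrableP[/measurable_EFinP] := fi k.
have bal : [bounded al x | x in D].
  exists M; split; first by rewrite num_real.
  by move=> z Mz x /alM h; exact: le_trans (ltW Mz).
have bi h : leb3.-integrable D (EFin \o h) -> leb3.-integrable D (EFin \o (fun x => al x * h x)).
  move=> hi; have := integrableMr mD mal bal hi.
  exact.
split; [exact: bi|by move=> k; exact: bi|].
apply/cvgrPdist_le => e e0.
pose V := fine (leb3 D) + 1.
have V0 : 0 < V by rewrite ltr_wpDl// fine_ge0.
(* Chosen so that the bound |M| + 1 on the weight times d V is exactly e. *)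
pose d := e / ((`|M| + 1) * V).
have M1 : 0 < `|M| + 1 by rewrite ltr_wpDl.
have d0 : 0 < d by rewrite divr_gt0// mulr_gt0.
apply: filterS (cvge0_le (exprn_gt0 2 d0) cv) => k Hk.
have mfg : measurable_fun D (fun x => f k x - g x) by exact: measurable_funB.
have [ifg L] := integrable_sqr_le mD fD mfg d0 Hk.
rewrite -RintegralB//; [|exact: bi|exact: bi].
apply: (@le_trans _ _ (\int[leb3]_(x in D) ((`|M| + 1) * `|f k x - g x|))).
  apply: le_trans (le_normr_Rintegral _ _) _ => //.
    by have := integrableB mD (bi _ gi) (bi _ (fi k)); apply: eq_integrable.
  apply: le_Rintegral => //.
  - by have := integrable_norm (integrableB mD (bi _ gi) (bi _ (fi k))); apply: eq_integrable.
  - by have := integrableZl mD (`|M| + 1) (integrable_norm ifg); apply: eq_integrable.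
  - move=> x Dx; rewrite -mulrBr normrM distrC; apply: ler_wpM2r => //.
    by apply: le_trans (alM _ Dx) _; apply: le_trans (ler_norm _) _; rewrite lerDl.
rewrite RintegralZl//; last exact: integrable_norm.
apply: le_trans (ler_wpM2l (ltW M1) L) _.
rewrite mulrCA /d -/V divfK// gt_eqF// mulr_gt0//.
Qed.

(** The real counterpart of [trace], together with the measurability that complex functions get from
    [H1]. The surface norm is written out on the punctured ball, without its factor 3. *)
Record real_trace (D : set R3) (v : R3 -> R) (Dv : 'I_3 -> R3 -> R) (eta : R3 -> R) : Prop := {
  rt_meas : measurable_fun D v;
  rt_measD : forall i, measurable_fun D (Dv i);
  rt_measT : measurable_fun B (eta \o @radial_proj R);
  rt_approx : exists phi : nat -> R3 -> R, [/\ forall k, smooth (phi k),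
    cvg_L2 D phi v, forall i, cvg_L2 D (fun k x => 'D_(basis i) (phi k) x) (Dv i) &
    cvg_L2 B (fun k => phi k \o @radial_proj R) (eta \o @radial_proj R)] }.

Lemma continuous_integrable (D : set R3) (rho : R) (f : R3 -> R) : measurable D ->
  D `<=` eball rho -> continuous f -> leb3.-integrable D (EFin \o f).
Proof.
move=> mD Dr cf; have [M M0 fM] := continuous_bounded_ball rho cf.
apply: measurable_bounded_integrable => //.
- apply: le_lt_trans (leb3_ball_lty rho); apply: le_measure; rewrite ?inE//.
  exact: measurable_eball.
- apply: (measurable_funS measurableT) => //; exact: continuous_measurable_R3.
exists M; split; first by rewrite num_real.
by move=> z Mz x /Dr/ltW/fM h; exact: le_trans (ltW Mz).
Qed.

Lemma punctured_ball_lty : (leb3 B < +oo)%E.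
Proof. exact: (leb3_annulus_lty 0 1). Qed.

Lemma enorm_radial_proj (y : R3) : B y -> enorm (radial_proj y) = 1.
Proof.
move=> /andP[y0 _]; have := enorm_radial ler01 y0; by rewrite scale1r.
Qed.

Lemma integrable_radial_proj (f : R3 -> R) : continuous f ->
  leb3.-integrable B (EFin \o (f \o @radial_proj R)).
Proof.
move=> cf; have [M M0 fM] := continuous_bounded_ball 1 cf.
apply: measurable_bounded_integrable => //.
- exact: measurable_punctured_ball.
- exact: punctured_ball_lty.
- apply: (measurable_funS measurableT) => //.
  exact: measurableT_comp (continuous_measurable_R3 cf) (@measurable_radial_proj R).
exists M; split; first by rewrite num_real.
move=> z Mz y yB; apply: le_trans (ltW Mz); apply: fM.
by rewrite enorm_radial_proj.
Qed.

(** Both sides are continuous for the three convergences in [real_trace]: the coefficients are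
    bounded and the volume is finite, so L^2 convergence implies convergence of the integrals. The
    constant [la] stands for a normal derivative that is constant on the sphere. *)
Lemma real_trace_density (D : set R3) (rho M : R) (al : 'I_3 -> R3 -> R) (be : R3 -> R)
    (la : R) (v : R3 -> R) (Dv : 'I_3 -> R3 -> R) (eta : R3 -> R) :
  measurable D -> D `<=` eball rho ->
  (forall i, measurable_fun D (al i)) -> measurable_fun D be ->
  (forall i x, D x -> `|al i x| <= M) -> (forall x, D x -> `|be x| <= M) ->
  (forall phi, smooth phi -> \int[leb3]_(x in D)
     (\sum_(i < 3) al i x * 'D_(basis i) phi x + be x * phi x) =
     la * \int[leb3]_(y in B) phi (radial_proj y)) ->
  real_trace D v Dv eta ->
  [/\ leb3.-integrable D (EFin \o (fun x => \sum_(i < 3) al i x * Dv i x + be x * v x)),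
     leb3.-integrable B (EFin \o (eta \o @radial_proj R)) &
   \int[leb3]_(x in D) (\sum_(i < 3) al i x * Dv i x + be x * v x) =
     la * \int[leb3]_(y in B) eta (radial_proj y)].
Proof.
move=> mD Dr mal mbe alM beM id [mv mDv meta [phi [sphi cv cDv ceta]]].
have fD : (leb3 D < +oo)%E.
  apply: le_lt_trans (leb3_ball_lty rho); apply: le_measure; rewrite ?inE//.
  exact: measurable_eball.
have mB := @measurable_punctured_ball R.
have ciD i k : leb3.-integrable D (EFin \o (fun x => 'D_(basis i) (phi k) x)).
  exact/(continuous_integrable mD Dr)/smooth_continuous/smooth_derive.
have ci k : leb3.-integrable D (EFin \o phi k).
  exact/(continuous_integrable mD Dr)/smooth_continuous.
have cip k : leb3.-integrable B (EFin \o (phi k \o @radial_proj R)).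
  exact/integrable_radial_proj/smooth_continuous.
have H i := cvg_L2_Rintegral mD fD (mal i) (alM i) (ciD i) (mDv i) (cDv i).
have [K1 K2 K3] := cvg_L2_Rintegral mD fD mbe beM ci mv cv.
have c1 : measurable_fun B (cst 1 : R3 -> R) by [].
have c1M x : B x -> `|cst 1 x : R| <= 1 by rewrite /= normr1.
have [T1 T2 T3] := cvg_L2_Rintegral mB punctured_ball_lty c1 c1M cip meta ceta.
have E (f : 'I_3 -> R3 -> R) (g : R3 -> R) :
   (forall i, leb3.-integrable D (EFin \o (fun x => al i x * f i x))) ->
   leb3.-integrable D (EFin \o (fun x => be x * g x)) ->
   leb3.-integrable D (EFin \o (fun x => \sum_(i < 3) al i x * f i x + be x * g x)) /\
   \int[leb3]_(x in D) (\sum_(i < 3) al i x * f i x + be x * g x) =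
   \int[leb3]_(x in D) (al i0 x * f i0 x) + \int[leb3]_(x in D) (al i1 x * f i1 x) +
   \int[leb3]_(x in D) (al i2 x * f i2 x) + \int[leb3]_(x in D) (be x * g x).
  move=> fi gi.
  have i01 : leb3.-integrable D (EFin \o (fun x => al i0 x * f i0 x + al i1 x * f i1 x)).
    by have := integrableD mD (fi i0) (fi i1); apply: eq_integrable.
  have i012 : leb3.-integrable D (EFin \o (fun x => al i0 x * f i0 x + al i1 x * f i1 x + al i2 x * f i2 x)).
    by have := integrableD mD i01 (fi i2); apply: eq_integrable.
  have FE : (fun x => \sum_(i < 3) al i x * f i x + be x * g x) =
     (fun x => al i0 x * f i0 x + al i1 x * f i1 x + al i2 x * f i2 x + be x * g x).
    by apply/funext => x; rewrite big_I3.
  rewrite FE; split; first by have := integrableD mD i012 gi; apply: eq_integrable.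
  by rewrite RintegralD// RintegralD// RintegralD.
have [I1 I2] := E Dv v (fun i => let: And3 h _ _ := H i in h) K1.
split => //.
  by move: T1; apply: eq_integrable => // x _ /=; rewrite mul1r.
have lim1 : \int[leb3]_(x in D) (\sum_(i < 3) al i x * 'D_(basis i) (phi k) x + be x * phi k x)
   @[k --> \oo] --> \int[leb3]_(x in D) (\sum_(i < 3) al i x * Dv i x + be x * v x).
  rewrite I2.
  rewrite [X in X @ _ --> _](_ : _ = (fun k => \int[leb3]_(x in D) (al i0 x * 'D_(basis i0) (phi k) x) +
    \int[leb3]_(x in D) (al i1 x * 'D_(basis i1) (phi k) x) +
    \int[leb3]_(x in D) (al i2 x * 'D_(basis i2) (phi k) x) + \int[leb3]_(x in D) (be x * phi k x))); last first.
    apply/funext => k; have [//|//|_ ->//] := E (fun i x => 'D_(basis i) (phi k) x) (phi k).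
    by move=> i; have [] := H i.
  by apply: cvgD => //; apply: cvgD; [apply: cvgD|]; [have [] := H i0|have [] := H i1|have [] := H i2].
have lim2 : \int[leb3]_(x in D) (\sum_(i < 3) al i x * 'D_(basis i) (phi k) x + be x * phi k x)
   @[k --> \oo] --> la * \int[leb3]_(y in B) eta (radial_proj y).
  rewrite [X in X @ _ --> _](_ : _ = (fun k => la * \int[leb3]_(y in B) (cst 1 y * phi k (radial_proj y)))); last first.
    apply/funext => k; rewrite id//; congr (_ * _).
    by apply: eq_Rintegral => x _; rewrite /= mul1r.
  rewrite [X in _ --> la * X](_ : _ = \int[leb3]_(y in B) (cst 1 y * eta (radial_proj y))); last first.
    by apply: eq_Rintegral => x _; rewrite /= mul1r.
  by apply: cvgM => //; exact: cvg_cst.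
exact: cvg_unique lim1 lim2.
Qed.

End RealTrace.

Section ComplexParts.
Context {R : realType}.
Local Notation C := R[i].
Local Notation Re := (@complex.Re R).
Local Notation Im := (@complex.Im R).

Lemma complexE (z : C) : z = Re z +i* Im z. Proof. by case: z. Qed.
Lemma cReD (x y : C) : Re (x + y) = Re x + Re y. Proof. by case: x; case: y. Qed.
Lemma cImD (x y : C) : Im (x + y) = Im x + Im y. Proof. by case: x; case: y. Qed.
Lemma cReN (x : C) : Re (- x) = - Re x. Proof. by case: x. Qed.
Lemma cImN (x : C) : Im (- x) = - Im x. Proof. by case: x. Qed.
Lemma cReM (x y : C) : Re (x * y) = Re x * Re y - Im x * Im y.
Proof. by case: x; case: y. Qed.
Lemma cImM (x y : C) : Im (x * y) = Re x * Im y + Im x * Re y.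
Proof. by case: x => a b; case: y => c d. Qed.

Lemma normc_sqr (z : C) : Normc.normc z ^+ 2 = Re z ^+ 2 + Im z ^+ 2.
Proof. by case: z => a b /=; rewrite sqr_sqrtr// addr_ge0// sqr_ge0. Qed.

Lemma normc_ge0 (z : C) : 0 <= Normc.normc z.
Proof. by case: z => a b /=; exact: sqrtr_ge0. Qed.

Lemma normc_real (t : R) : Normc.normc t%:C = `|t|.
Proof. by rewrite /= expr0n/= addr0 sqrtr_sqr. Qed.

End ComplexParts.

Section ComplexTrace.
Context {R : realType}.
Local Notation R3 := (R * R * R)%type.
Local Notation leb3 := (@leb3 R).
Local Notation B := (@punctured_ball R).
Local Notation Re := (@complex.Re R).
Local Notation Im := (@complex.Im R).

Lemma measurable_sphere : measurable (@sphere R).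
Proof.
rewrite -[X in measurable X]setTI.
exact: (measurable_enorm measurableT (measurable_set1 1)).
Qed.

Lemma measurable_radial_trace (f : R3 -> R) : measurable_fun (@sphere R) f ->
  measurable_fun B (f \o @radial_proj R).
Proof.
move=> mf; apply: (measurable_comp (F := @sphere R)) => //.
- exact: measurable_sphere.
- by move=> _ [y yB <-]; exact: enorm_radial_proj.
- by apply: (measurable_funS measurableT) => //; exact: measurable_radial_proj.
Qed.

Lemma sqnorm2E (D : set R3) (f : cfun) :
  sqnorm2 D f = (\int[leb3]_(x in D) ((Re (f x)) ^+ 2 + (Im (f x)) ^+ 2)%:E)%E.
Proof. by apply: eq_integral => x _; rewrite normc_sqr. Qed.

Lemma sqnorm2D (D : set R3) (f : cfun) : measurable D -> cmeasurable D f ->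
  sqnorm2 D f = (\int[leb3]_(x in D) ((Re (f x)) ^+ 2)%:E + \int[leb3]_(x in D) ((Im (f x)) ^+ 2)%:E)%E.
Proof.
move=> mD [m1 m2]; rewrite sqnorm2E.
under eq_integral do rewrite EFinD.
rewrite ge0_integralD//.
- by move=> x _; rewrite lee_fin sqr_ge0.
- by apply/measurable_EFinP; exact: measurable_funX.
- by move=> x _; rewrite lee_fin sqr_ge0.
- by apply/measurable_EFinP; exact: measurable_funX.
Qed.

(** The factor [c] lets one statement serve for volume norms, with c = 1, and for the surface norm,
    whose definition carries a 3. *)
Lemma sqnorm2_cvg_parts (D : set R3) (f : nat -> cfun) (g : cfun) (c : R) : 0 < c ->
  measurable D -> (forall k, cmeasurable D (f k)) -> cmeasurable D g ->
  (c%:E * sqnorm2 D (fun x => (f k x - g x)%R))%E @[k --> \oo] --> 0%E <->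
  cvg_L2 D (fun k x => Re (f k x)) (fun x => Re (g x)) /\
  cvg_L2 D (fun k x => Im (f k x)) (fun x => Im (g x)).
Proof.
move=> c0 mD mf [g1 g2].
have E k : sqnorm2 D (fun x => f k x - g x) =
   (\int[leb3]_(x in D) ((Re (f k x) - Re (g x)) ^+ 2)%:E +
    \int[leb3]_(x in D) ((Im (f k x) - Im (g x)) ^+ 2)%:E)%E.
  rewrite sqnorm2D//.
    by congr (_ + _)%E; apply: eq_integral => x _; rewrite ?cReD ?cImD ?cReN ?cImN.
  split.
    rewrite (_ : (fun x => _) = (fun x => Re (f k x) - Re (g x))).
      by apply: measurable_funB => //; have [] := mf k.
    by apply/funext => x; rewrite cReD cReN.
  rewrite (_ : (fun x => _) = (fun x => Im (f k x) - Im (g x))).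
    by apply: measurable_funB => //; have [] := mf k.
  by apply/funext => x; rewrite cImD cImN.
under eq_fun do rewrite E.
have p1 k : (0 <= \int[leb3]_(x in D) ((Re (f k x) - Re (g x)) ^+ 2)%:E)%E.
  by apply: integral_ge0 => x _; rewrite lee_fin sqr_ge0.
have p2 k : (0 <= \int[leb3]_(x in D) ((Im (f k x) - Im (g x)) ^+ 2)%:E)%E.
  by apply: integral_ge0 => x _; rewrite lee_fin sqr_ge0.
have cl : forall F G : nat -> \bar R, (forall k, 0 <= F k)%E -> (forall k, 0 <= G k)%E ->
   (c%:E * (F k + G k))%E @[k --> \oo] --> 0%E -> F k @[k --> \oo] --> 0%E.
  move=> F G F0 G0 H.
  have H2 : ((c^-1)%:E * (c%:E * (F k + G k)))%E @[k --> \oo] --> 0%E.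
    by rewrite -[X in _ --> X](mule0 (c^-1)%:E); apply: cvgeZl.
  apply: (squeeze_cvge _ (cvg_cst 0%E) H2); apply: nearW => k; rewrite F0/=.
  by rewrite muleA -EFinM mulVf ?gt_eqF// mul1e leeDl.
split=> [H|[H1 H2]].
  split; first exact: (cl _ _ p1 p2).
  by apply: (cl _ _ p2 p1); under eq_fun do rewrite addeC.
rewrite -[X in _ --> X](mule0 c%:E); apply: cvgeZl => //.
by rewrite -[X in _ --> X](adde0 0%E); apply: cvgeD.
Qed.

Lemma csmooth_cmeasurable (D : set R3) (f : cfun) : measurable D -> csmooth f -> cmeasurable D f.
Proof.
move=> mD [/smooth_continuous c1 /smooth_continuous c2].
by split; apply: (measurable_funS measurableT) => //; exact: continuous_measurable_R3.
Qed.

Lemma csmooth_cpartial_cmeasurable (D : set R3) (f : cfun) i : measurable D -> csmooth f ->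
  cmeasurable D (cpartial f i).
Proof.
move=> mD [s1 s2]; split; apply: (measurable_funS measurableT) => //;
 apply: continuous_measurable_R3; apply: smooth_continuous; exact: smooth_derive.
Qed.

Lemma csmooth_proj_cmeasurable (f : cfun) : csmooth f -> cmeasurable B (f \o @radial_proj R).
Proof.
move=> [s1 s2]; split; apply: (measurable_funS measurableT) => //.
  exact: measurableT_comp (continuous_measurable_R3 (smooth_continuous s1)) (@measurable_radial_proj R).
exact: measurableT_comp (continuous_measurable_R3 (smooth_continuous s2)) (@measurable_radial_proj R).
Qed.

Lemma trace_real_parts (D : set R3) (v : cfun) (Dv : cfield) (eta : cfun) :
  measurable D -> cmeasurable D v -> (forall i, cmeasurable D (Dv i)) -> trace D v Dv eta ->
  real_trace D (fun x => Re (v x)) (fun i x => Re (Dv i x)) (fun x => Re (eta x)) /\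
  real_trace D (fun x => Im (v x)) (fun i x => Im (Dv i x)) (fun x => Im (eta x)).
Proof.
move=> mD mv mDv [[me1 me2] [phi [sphi cv cDv ceta]]].
have meta : cmeasurable B (eta \o @radial_proj R).
  by split; [exact: (measurable_radial_trace me1)|exact: (measurable_radial_trace me2)].
have mul1 (F : nat -> \bar R) : F k @[k --> \oo] --> 0%E -> (1%:E * F k)%E @[k --> \oo] --> 0%E.
  by rewrite (_ : (fun k => 1%:E * F k)%E = F)//; apply/funext => k; rewrite mul1e.
have [c1 c2] := (sqnorm2_cvg_parts ltr01 mD (fun k => csmooth_cmeasurable mD (sphi k)) mv).1 (mul1 _ cv).
have cD i := (sqnorm2_cvg_parts ltr01 mD (fun k => csmooth_cpartial_cmeasurable i mD (sphi k)) (mDv i)).1 (mul1 _ (cDv i)).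
have lt03 : 0 < 3 :> R by [].
have [t1 t2] := (@sqnorm2_cvg_parts _ (fun k => phi k \o @radial_proj R) _ _ lt03 (@measurable_punctured_ball R)
   (fun k => csmooth_proj_cmeasurable (sphi k)) meta).1 ceta.
split; split; try by [case: mv|move=> i; case: (mDv i)|case: meta].
  exists (fun k x => Re (phi k x)); split => //.
  - by move=> k; case: (sphi k).
  - by move=> i; case: (cD i).
exists (fun k x => Im (phi k x)); split => //.
- by move=> k; case: (sphi k).
- by move=> i; case: (cD i).
Qed.

Lemma real_parts_trace (D : set R3) (v : cfun) (Dv : cfield) (eta : cfun) :
  measurable D -> cmeasurable (@sphere R) eta ->
  real_trace D (fun x => Re (v x)) (fun i x => Re (Dv i x)) (fun x => Re (eta x)) ->
  real_trace D (fun x => Im (v x)) (fun i x => Im (Dv i x)) (fun x => Im (eta x)) ->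
  trace D v Dv eta.
Proof.
move=> mD meta [mv1 mDv1 me1 [phi [s1 c1 cD1 t1]]] [mv2 mDv2 me2 [psi [s2 c2 cD2 t2]]].
split => //.
pose f k : cfun := fun x => phi k x +i* psi k x.
have sf k : csmooth (f k) by split; [exact: s1|exact: s2].
have mul1 (F : nat -> \bar R) : (1%:E * F k)%E @[k --> \oo] --> 0%E -> F k @[k --> \oo] --> 0%E.
  by rewrite (_ : (fun k => 1%:E * F k)%E = F)//; apply/funext => k; rewrite mul1e.
have lt03 : 0 < 3 :> R by [].
exists f; split => //.
- apply: mul1; apply: (sqnorm2_cvg_parts ltr01 mD (fun k => csmooth_cmeasurable mD (sf k)) _).2 => //.
- move=> i; apply: mul1.
  exact: (@sqnorm2_cvg_parts D (fun k => cpartial (f k) i) (Dv i) 1 ltr01 mD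
    (fun k => csmooth_cpartial_cmeasurable i mD (sf k)) (conj (mDv1 i) (mDv2 i))).2 (conj (cD1 i) (cD2 i)).
by apply: (@sqnorm2_cvg_parts _ (fun k => f k \o @radial_proj R) (eta \o @radial_proj R) _ lt03 (@measurable_punctured_ball R)
   (fun k => csmooth_proj_cmeasurable (sf k)) _).2.
Qed.

Lemma smooth_real_trace (D : set R3) (phi : R3 -> R) : measurable D -> smooth phi ->
  real_trace D phi (fun i x => 'D_(basis i) phi x) phi.
Proof.
move=> mD sphi.
have z (E : set R3) (f : R3 -> R) : cvg_L2 E (fun=> f) f.
  rewrite /cvg_L2; under eq_fun do under eq_integral do rewrite subrr expr0n/=.
  by under eq_fun do rewrite integral0; exact: cvg_cst.
split.
- by apply: (measurable_funS measurableT) => //; apply: continuous_measurable_R3; exact: smooth_continuous.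
- move=> i; apply: (measurable_funS measurableT) => //.
  apply: continuous_measurable_R3; apply: smooth_continuous; exact: smooth_derive.
- apply: (measurable_funS measurableT) => //.
  exact: measurableT_comp (continuous_measurable_R3 (smooth_continuous sphi)) (@measurable_radial_proj R).
by exists (fun=> phi); split => // i.
Qed.

(** Green's identity for a radial solution: [al] plays the role of its gradient, [be] of the
    zeroth-order term and [la] of the flux through the unit sphere. It is stated for smooth real
    functions, as the real and imaginary parts of a complex test function are treated separately. *)
Definition real_form (D : set R3) (al : 'I_3 -> R3 -> R) (be : R3 -> R) (la : R) : Prop :=
  [/\ forall i, measurable_fun D (al i), measurable_fun D be,
      exists M, (forall i x, D x -> `|al i x| <= M) /\ (forall x, D x -> `|be x| <= M) &
      forall phi, smooth phi -> \int[leb3]_(x in D)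
     (\sum_(i < 3) al i x * 'D_(basis i) phi x + be x * phi x) =
     la * \int[leb3]_(y in B) phi (radial_proj y)].

(** The pairing is bilinear, without conjugation, so the four real identities combine by the rule
    for multiplying complex numbers. *)
Lemma complex_trace_density (D : set R3) (rho : R) (al1 al2 : 'I_3 -> R3 -> R) (be1 be2 : R3 -> R)
    (la1 la2 : R) (v : cfun) (Dv : cfield) (eta : cfun) :
  measurable D -> D `<=` eball rho ->
  real_form D al1 be1 la1 -> real_form D al2 be2 la2 ->
  real_trace D (fun x => Re (v x)) (fun i x => Re (Dv i x)) (fun x => Re (eta x)) ->
  real_trace D (fun x => Im (v x)) (fun i x => Im (Dv i x)) (fun x => Im (eta x)) ->
  cint D (fun x => dotc (fun i => al1 i x +i* al2 i x) (Dv ^~ x) + (be1 x +i* be2 x) * v x) =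
  (la1 +i* la2) * cint B (eta \o @radial_proj R).
Proof.
move=> mD Dr [m1 n1 [M1 [b1 c1]] id1] [m2 n2 [M2 [b2 c2]] id2] tr ti.
have [I1r J1r E1r] := real_trace_density mD Dr m1 n1 b1 c1 id1 tr.
have [I1i J1i E1i] := real_trace_density mD Dr m1 n1 b1 c1 id1 ti.
have [I2r _ E2r] := real_trace_density mD Dr m2 n2 b2 c2 id2 tr.
have [I2i _ E2i] := real_trace_density mD Dr m2 n2 b2 c2 id2 ti.
rewrite {1}/cint.
have -> : \int[leb3]_(x in D) Re (dotc (fun i => al1 i x +i* al2 i x) (Dv ^~ x) + (be1 x +i* be2 x) * v x) =
   la1 * \int[leb3]_(y in B) Re (eta (radial_proj y)) - la2 * \int[leb3]_(y in B) Im (eta (radial_proj y)).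
  rewrite -E1r -E2i -RintegralB//; apply: eq_Rintegral => x _.
  by rewrite /dotc !big_I3 !(cReD, cReM)/=; ring.
have -> : \int[leb3]_(x in D) Im (dotc (fun i => al1 i x +i* al2 i x) (Dv ^~ x) + (be1 x +i* be2 x) * v x) =
   la1 * \int[leb3]_(y in B) Im (eta (radial_proj y)) + la2 * \int[leb3]_(y in B) Re (eta (radial_proj y)).
  rewrite -E1i -E2r -RintegralD//; apply: eq_Rintegral => x _.
  by rewrite /dotc !big_I3 !(cImD, cImM)/=; ring.
by [].
Qed.

End ComplexTrace.

(** * Radial functions *)

Section RadialFunctions.
Context {R : realType}.
Local Notation R3 := (R * R * R)%type.
Local Notation leb3 := (@leb3 R).
Local Notation Re := (@complex.Re R).
Local Notation Im := (@complex.Im R).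

Definition radial (V : R -> R) (x : R3) : R := V (sqnorm x).

Definition radial_grad (V1 : R -> R) (i : 'I_3) (x : R3) : R :=
  2 * coord x i * V1 (sqnorm x).

Lemma is_derive_radial (V V1 : R -> R) (i : 'I_3) (x : R3) :
  (forall t : R, is_derive t 1 V (V1 t)) ->
  is_derive x (basis i) (radial V) (radial_grad V1 i x).
Proof.
move=> dV; apply: (is_derive_ext (is_derive_comp_line (dV _) (is_derive_sqnorm_basis x i))) => //.
by rewrite /radial_grad mulrC.
Qed.

Lemma continuous_radial (V : R -> R) : continuous V -> continuous (radial V).
Proof. by move=> cV x; apply: continuous_comp; [exact: continuous_sqnorm|exact: cV]. Qed.

Lemma continuous_radial_grad (V1 : R -> R) i : continuous V1 -> continuous (radial_grad V1 i).
Proof.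
move=> cV x; apply: cvgM; last exact: continuous_radial.
by apply: cvgM; [exact: cvg_cst|exact: continuous_coord].
Qed.

Lemma derive_radial (V V1 : R -> R) (i : 'I_3) :
  (forall t : R, is_derive t 1 V (V1 t)) ->
  (fun x => 'D_(basis i) (radial V) x) = radial_grad V1 i.
Proof. by move=> dV; apply/funext => x; have [_ ->] := is_derive_radial i x dV. Qed.

Lemma C1_radial (V V1 : R -> R) : (forall t : R, is_derive t 1 V (V1 t)) -> continuous V1 ->
  C1 (radial V).
Proof.
move=> dV cV; split; first by apply: continuous_radial; exact: is_derive_continuous dV.
move=> i; split; first by move=> x; have [] := is_derive_radial i x dV.
by rewrite (derive_radial i dV); exact: continuous_radial_grad.
Qed.

Lemma cvg_L2_uniform (D : set R3) (f : nat -> R3 -> R) (g : R3 -> R) (M : R) :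
  measurable D -> (leb3 D < +oo)%E -> (forall k, measurable_fun D (f k)) -> measurable_fun D g ->
  0 <= M -> (forall k x, D x -> `|f k x - g x| <= M * k.+1%:R^-1) -> cvg_L2 D f g.
Proof.
move=> mD fD mf mg M0 H.
have fDn : leb3 D \is a fin_num by rewrite ge0_fin_numE.
apply: (@squeeze_cvge _ _ _ _ (fun=> 0%E) _
  (fun k : nat => ((M ^+ 2 * fine (leb3 D)) * k.+1%:R^-1)%:E)); last 2 first.
- exact: cvg_cst.
- rewrite -[X in _ --> X%:E](mulr0 (M ^+ 2 * fine (leb3 D))).
  by apply: cvg_EFin; [exact: nearW|apply: cvgM; [exact: cvg_cst|exact: cvg_harmonic]].
apply: nearW => k; rewrite integral_ge0/=; last by move=> x _; rewrite lee_fin sqr_ge0.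
apply: (@le_trans _ _ (\int[leb3]_(x in D) (M ^+ 2 * k.+1%:R^-1)%:E)%E).
  apply: ge0_le_integral => //.
  - by move=> x _; rewrite lee_fin sqr_ge0.
  - by apply/measurable_EFinP; apply: measurable_funX; exact: measurable_funB.
  move=> x Dx; rewrite lee_fin -real_normK ?num_real//.
  apply: (@le_trans _ _ ((M * k.+1%:R^-1) ^+ 2)).
    by rewrite ler_pXn2r ?nnegrE ?mulr_ge0//; exact: H.
  rewrite exprMn ler_wpM2l ?sqr_ge0// expr2 ler_piMr//.
  by rewrite invf_le1 ?ltr0n// ler1n.
rewrite integral_cst//= -{1}(fineK fDn) -EFinM lee_fin.
by rewrite -!mulrA [fine _ * _]mulrC.
Qed.

(** If a polynomial p and its derivative are uniformly close to V and V1 on [0, rho^2], then the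
    smooth function p(|x|^2) approximates V(|x|^2), its gradient and its trace all at once. The
    condition 1 < rho puts the unit sphere within range. *)
Lemma radial_real_trace (D : set R3) (rho : R) (V V1 : R -> R) :
  measurable D -> 1 < rho -> D `<=` eball rho ->
  (forall t : R, is_derive t 1 V (V1 t)) -> continuous V1 ->
  real_trace D (radial V) (radial_grad V1) (fun=> V 1).
Proof.
move=> mD r1 Dr dV cV1.
have cV := is_derive_continuous dV.
have fD : (leb3 D < +oo)%E.
  by apply: le_lt_trans (leb3_ball_lty rho); apply: le_measure; rewrite ?inE//; exact: measurable_eball.
have r0 : 0 < rho by apply: lt_trans r1.
have P k := C1_weierstrass dV cV1 (exprn_gt0 2 r0) (_ : 0 < (k.+1%:R : R)^-1).
have [p Hp] : exists p : nat -> {poly R}, forall k x, 0 <= x <= rho ^+ 2 ->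
    `|(p k).[x] - V x| <= k.+1%:R^-1 /\ `|(p k)^`().[x] - V1 x| <= k.+1%:R^-1.
  suff /choice[p H] : forall k, exists q : {poly R}, forall x, 0 <= x <= rho ^+ 2 ->
    `|q.[x] - V x| <= k.+1%:R^-1 /\ `|q^`().[x] - V1 x| <= k.+1%:R^-1 by exists p.
  by move=> k; apply: P => m; rewrite invr_gt0.
have sq (x : R3) : enorm x < rho -> 0 <= sqnorm x <= rho ^+ 2.
  move=> xr; rewrite sqnormE sqr_ge0/= ler_pXn2r ?nnegrE ?enorm_ge0// ltW//.
have mc (E : set R3) (f : R3 -> R) : measurable E -> continuous f -> measurable_fun E f.
  by move=> mE cf; apply: (measurable_funS measurableT) => //; exact: continuous_measurable_R3.
have dp k i : (fun x => 'D_(basis i) (radial (horner (p k))) x) = radial_grad (horner (p k)^`()) i.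
  by apply: derive_radial => t; exact: is_derive_poly.
have cp (q : {poly R}) : continuous (horner q) by move=> t; exact: continuous_horner.
split.
- by apply: mc => //; exact: continuous_radial.
- by move=> i; apply: mc => //; exact: continuous_radial_grad.
- exact: measurable_cst.
exists (fun k => radial (horner (p k))); split.
- by move=> k; exact: smooth_poly_sqnorm.
- apply: (@cvg_L2_uniform _ _ _ 1) => //.
  + by move=> k; apply: mc => //; exact: continuous_radial.
  + by apply: mc => //; exact: continuous_radial.
  + by move=> k x Dx; rewrite mul1r; apply: (Hp k _ _).1; exact/sq/Dr.
- move=> i; apply: (@cvg_L2_uniform _ _ _ (2 * rho)) => //.
  + by move=> k; rewrite dp; apply: mc => //; exact: continuous_radial_grad.
  + by apply: mc => //; exact: continuous_radial_grad.
  + by rewrite mulr_ge0// ltW.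
  move=> k x Dx; rewrite (congr1 (@^~ x) (dp k i)) /radial_grad -mulrBr normrM; apply: ler_pM => //.
    rewrite normrM normr_nat ler_wpM2l//; apply: le_trans (le_coord x i) _.
    exact/ltW/Dr.
  by apply: (Hp k _ _).2; exact/sq/Dr.
apply: (@cvg_L2_uniform _ _ _ 1) => //.
- exact: measurable_punctured_ball.
- exact: punctured_ball_lty.
- by move=> k; have /integrableP[/measurable_EFinP] := integrable_radial_proj (continuous_radial (cp (p k))).
- exact: measurable_cst.
- move=> k y By; rewrite mul1r /= /radial sqnormE enorm_radial_proj// expr1n.
  apply: (Hp k _ _).1; rewrite ler01/=.
  by rewrite -[leLHS](expr1n _ 2) ler_pXn2r ?nnegrE// ltW.
Qed.

Definition cradial (V W : R -> R) : cfun := fun x => radial V x +i* radial W x.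

Definition cradial_grad (V1 W1 : R -> R) : cfield := fun i x =>
  radial_grad V1 i x +i* radial_grad W1 i x.

Lemma cradial_trace (D : set R3) (rho : R) (V V1 W W1 : R -> R) :
  measurable D -> 1 < rho -> D `<=` eball rho ->
  (forall t : R, is_derive t 1 V (V1 t)) -> continuous V1 ->
  (forall t : R, is_derive t 1 W (W1 t)) -> continuous W1 ->
  trace D (cradial V W) (cradial_grad V1 W1) (fun=> V 1 +i* W 1).
Proof.
move=> mD r1 Dr dV cV dW cW; apply: real_parts_trace => //.
- exact: (radial_real_trace mD r1 Dr dV cV).
- exact: (radial_real_trace mD r1 Dr dW cW).
Qed.

Lemma cint_eq_parts (D : set R3) (f g : cfun) :
  \int[leb3]_(x in D) Re (f x) = \int[leb3]_(x in D) Re (g x) ->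
  \int[leb3]_(x in D) Im (f x) = \int[leb3]_(x in D) Im (g x) -> cint D f = cint D g.
Proof. by rewrite /cint => -> ->. Qed.

Lemma continuous_L2 (D : set R3) (rho : R) (f : cfun) : measurable D -> D `<=` eball rho ->
  continuous (fun x => Re (f x)) -> continuous (fun x => Im (f x)) -> L2 D f.
Proof.
move=> mD Dr c1 c2.
have cm : cmeasurable D f.
  by split; apply: (measurable_funS measurableT) => //; exact: continuous_measurable_R3.
split => //; rewrite sqnorm2D//.
have h (g : R3 -> R) : continuous g -> (\int[leb3]_(x in D) ((g x) ^+ 2)%:E < +oo)%E.
  move=> cg; have cg2 : continuous (fun x => g x ^+ 2) by move=> x; apply: cvgM; exact: cg.
  have /integrableP[_] := continuous_integrable mD Dr cg2.
  by under eq_integral do rewrite /= ger0_norm ?sqr_ge0//.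
by rewrite lte_add_pinfty// h.
Qed.

Lemma cradial_H1 (D : set R3) (rho : R) (V V1 W W1 : R -> R) :
  measurable D -> D `<=` eball rho ->
  (forall t : R, is_derive t 1 V (V1 t)) -> continuous V1 ->
  (forall t : R, is_derive t 1 W (W1 t)) -> continuous W1 ->
  H1 D (cradial V W) (cradial_grad V1 W1).
Proof.
move=> mD Dr dV cV dW cW; split.
- apply: (continuous_L2 mD Dr); apply: continuous_radial.
    exact: is_derive_continuous dV.
  exact: is_derive_continuous dW.
- by move=> i; apply: (continuous_L2 mD Dr); exact: continuous_radial_grad.
move=> phi [[s1 s2] [K [cK KD p0]]] i.
have p1 x : ~ K x -> Re (phi x) = 0 by move=> /p0 ->.
have p2 x : ~ K x -> Im (phi x) = 0 by move=> /p0 ->.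
have CV := C1_radial dV cV; have CW := C1_radial dW cW.
have [a1 b1 e1] := C1_integration_by_parts i mD cK KD CV (smooth_C1 s1) p1.
have [a2 b2 e2] := C1_integration_by_parts i mD cK KD CV (smooth_C1 s2) p2.
have [a3 b3 e3] := C1_integration_by_parts i mD cK KD CW (smooth_C1 s1) p1.
have [a4 b4 e4] := C1_integration_by_parts i mD cK KD CW (smooth_C1 s2) p2.
have EV x : 'D_(basis i) (radial V) x = radial_grad V1 i x by have [] := is_derive_radial i x dV.
have EW x : 'D_(basis i) (radial W) x = radial_grad W1 i x by have [] := is_derive_radial i x dW.
rewrite {1}/cint.
under eq_Rintegral do rewrite cReM/=.
under [in X in _ +i* X]eq_Rintegral do rewrite cImM/=.
rewrite RintegralB// RintegralD// e1 e2 e3 e4 /cint.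
under [in RHS]eq_Rintegral do rewrite cReM/= -EV -EW.
under [in X in - (_ +i* X)]eq_Rintegral do rewrite cImM/= -EV -EW.
rewrite RintegralB// RintegralD//; apply/eqP; rewrite eq_complex/=; apply/andP; split; apply/eqP; ring.
Qed.

End RadialFunctions.

(** * Green's formula for radial solutions, inside and outside the ball *)

Section RadialGreen.
Context {R : realType}.
Local Notation R3 := (R * R * R)%type.
Local Notation leb3 := (@leb3 R).
Local Notation B := (@punctured_ball R).
Local Notation Re := (@complex.Re R).
Local Notation Im := (@complex.Im R).

Lemma continuous_flux (v v1 : R -> R) :
  (forall r : R, is_derive r 1 v (v1 r)) -> continuous v1 ->
  continuous (fun r : R => r * v1 r - v r).
Proof.
move=> dv cv1 r; apply: cvgB; last exact: (is_derive_continuous dv).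
by apply: cvgM; [exact: cvg_id|exact: cv1].
Qed.

(** [polar_integration_by_parts] for A = X (r v' - v), whose derivative in layer i is X' (r v' - v)
    - X k_i^2 r v by the differential equation. The multiplier [X] is the constant 1 in the ball and
    a cutoff in the exterior. *)
Lemma radial_green (n : nat) (xs k : nat -> R) (v v1 V V1 X X1 q : R -> R)
    (K L Q : R) (phi : R3 -> R) :
  C1 phi -> 0 <= xs 0%N -> (forall i, (i <= n)%N -> xs i < xs i.+1) ->
  (forall r : R, is_derive r 1 v (v1 r)) -> continuous v1 ->
  (forall i (r : R), (i <= n)%N -> xs i < r < xs i.+1 -> is_derive r 1 v1 (- (k i ^+ 2 * v r))) ->
  (forall r : R, xs 0%N < r < xs n.+1 -> V (r ^+ 2) = v r / r) ->
  (forall r : R, xs 0%N < r < xs n.+1 -> V1 (r ^+ 2) = (r * v1 r - v r) / (2 * r ^+ 3)) ->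
  (forall r : R, is_derive r 1 X (X1 r)) -> continuous X1 ->
  measurable_fun setT q ->
  (forall i (r : R), (i <= n)%N -> xs i < r < xs i.+1 -> q r = k i ^+ 2) ->
  0 <= K -> 0 <= L -> 0 <= Q ->
  (forall r : R, `|q r| <= Q) ->
  (forall r : R, xs 0%N <= r <= xs n.+1 -> `|v r| <= K * r /\ `|r * v1 r - v r| <= K * r ^+ 2) ->
  (forall r : R, xs 0%N <= r <= xs n.+1 -> `|X r| <= L /\ `|X1 r| <= L) ->
  \int[leb3]_(x in annulus (xs 0%N) (xs n.+1))
    (\sum_(i < 3) X (enorm x) * radial_grad V1 i x * 'D_(basis i) phi x +
     (X1 (enorm x) * (2 * enorm x * V1 (sqnorm x)) - X (enorm x) * (q (enorm x) * V (sqnorm x))) * phi x) =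
  \int[leb3]_(y in B)
    (3 * (X (xs n.+1) * (xs n.+1 * v1 (xs n.+1) - v (xs n.+1)) * phi (xs n.+1 *: radial_proj y) -
          X (xs 0%N) * (xs 0%N * v1 (xs 0%N) - v (xs 0%N)) * phi (xs 0%N *: radial_proj y))).
Proof.
move=> Cp a0 xlt dv cv1 dv1 VE V1E dX cX1 mq qE K0 L0 Q0 qQ vK XL.
have cv := is_derive_continuous dv; have cX := is_derive_continuous dX.
pose F r := r * v1 r - v r; have cF : continuous F := continuous_flux dv cv1.
pose A r := X r * F r.
pose A1 r := X1 r * F r - X r * (q r * (r * v r)).
pose h i r := X1 r * F r - X r * (k i ^+ 2 * (r * v r)).
have cA : continuous A by move=> r; apply: cvgM; [exact: cX|exact: cF].
have crv : continuous (fun r : R => r * v r).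
  by move=> r; apply: cvgM; [exact: cvg_id|exact: cv].
have bnd r : xs 0%N <= r <= xs n.+1 -> 0 <= r.
  by move=> /andP[+ _]; exact: le_trans.
have dA i (r : R) : (i <= n)%N -> xs i < r < xs i.+1 -> is_derive r 1 A (h i r).
  move=> ni ri.
  have dF : is_derive r 1 F (- (k i ^+ 2 * (r * v r))).
    have h1 := is_deriveB (is_deriveM (is_derive_id r (1 : R)) (dv1 i r ni ri)) (dv r).
    by apply: (is_derive_ext h1) => //; rewrite !scaleRE; ring.
  apply: (is_derive_ext (is_deriveM (dX r) dF)) => //.
  by rewrite !scaleRE /h; ring.
have K'0 : 0 <= L * K * (1 + Q) by rewrite !mulr_ge0// addr_ge0.
rewrite -[RHS](polar_integration_by_parts (A1 := A1) Cp a0 K'0 xlt _ _ _ dA).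
- apply: eq_Rintegral => x /set_mem/= xab; have e0 : enorm x != 0.
    by rewrite gt_eqF//; move/andP: xab => [+ _]; exact: le_lt_trans.
  rewrite -[RHS]/(A (enorm x) / enorm x ^+ 2 *
       (\sum_(i < 3) coord x i / enorm x * 'D_(basis i) phi x) +
     A1 (enorm x) / enorm x ^+ 2 * phi x).
  by rewrite /A /A1 /F !big_I3 /radial_grad sqnormE VE// V1E//; field; exact: e0.
- exact: continuous_measurable_fun.
- apply: measurable_funB.
    by apply: continuous_measurable_fun => r; apply: cvgM; [exact: cX1|exact: cF].
  apply: measurable_funM; first exact: continuous_measurable_fun.
  by apply: measurable_funM => //; exact: continuous_measurable_fun.
- by move=> r _; exact: cA.
- move=> i r ni ri; apply: cvgB; first by apply: cvgM; [exact: cX1|exact: cF].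
  by apply: cvgM; [exact: cX|apply: cvgM; [exact: cvg_cst|exact: crv]].
- by move=> i r ni ri; rewrite /h -(qE i r).
- move=> r rab; have [_ vr] := vK r rab; have [Xr _] := XL r rab.
  rewrite /A normrM; apply: (@le_trans _ _ (L * (K * r ^+ 2))); first exact: ler_pM.
  by rewrite mulrA ler_wpM2r ?sqr_ge0// ler_peMr ?mulr_ge0// lerDl.
move=> r /andP[ar rb]; have rab : xs 0%N <= r <= xs n.+1 by rewrite !ltW.
have [vr Fr] := vK r rab; have [Xr X1r] := XL r rab.
apply: le_trans (ler_normB _ _) _.
rewrite !normrM (_ : L * K * (1 + Q) * r ^+ 2 = L * (K * r ^+ 2) + L * (Q * (r * (K * r)))); last by ring.
apply: lerD; first exact: ler_pM.
apply: ler_pM => //; apply: ler_pM => //; apply: ler_pM => //.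
by rewrite ger0_norm// bnd.
Qed.

Lemma Rintegral_ball1 (f : R3 -> R) (M : R) : measurable_fun (@ball1 R) f ->
  (forall x, ball1 x -> `|f x| <= M) ->
  \int[leb3]_(x in @ball1 R) f x = \int[leb3]_(x in annulus 0 1) f x.
Proof.
move=> mf fM.
have mB : measurable (@ball1 R) by exact: (measurable_eball 1).
have N0 : leb3 [set x | enorm x = 0] = 0%E by exact: leb3_sphere.
have mN : measurable [set x : R3 | enorm x = 0].
  by rewrite -[X in measurable X]setTI; exact: (measurable_enorm measurableT (measurable_set1 0)).
have fi : leb3.-integrable (@ball1 R) (EFin \o f).
  apply: measurable_bounded_integrable => //; first exact: (leb3_ball_lty 1).
  exists M; split; first by rewrite num_real.
  by move=> z Mz x /fM h; exact: le_trans (ltW Mz).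
rewrite /Rintegral (negligible_integral mN mB fi N0); congr (fine (integral _ _ _)).
apply/seteqP; split=> x; rewrite /ball1 /annulus /setD/=.
  by move=> [x1 x0]; rewrite x1 andbT lt_neqAle enorm_ge0 andbT eq_sym; exact/eqP.
by move=> /andP[x0 x1]; split => //; apply/eqP; rewrite gt_eqF.
Qed.

(** Here the multiplier is 1 and the inner boundary term, at radius 0, vanishes because [v 0 = 0].
    The slope of v / r at 1 is v'(1) - v(1); the factor 3 belongs to the surface measure. *)
Lemma real_form_ball (n : nat) (xs k : nat -> R) (v v1 V V1 q : R -> R) (K Q : R) :
  xs 0%N = 0 -> xs n.+1 = 1 -> (forall i, (i <= n)%N -> xs i < xs i.+1) ->
  (forall r : R, is_derive r 1 v (v1 r)) -> continuous v1 ->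
  (forall i (r : R), (i <= n)%N -> xs i < r < xs i.+1 -> is_derive r 1 v1 (- (k i ^+ 2 * v r))) ->
  continuous V -> continuous V1 ->
  (forall r : R, 0 < r -> V (r ^+ 2) = v r / r) ->
  (forall r : R, 0 < r -> V1 (r ^+ 2) = (r * v1 r - v r) / (2 * r ^+ 3)) ->
  measurable_fun setT q ->
  (forall i (r : R), (i <= n)%N -> xs i < r < xs i.+1 -> q r = k i ^+ 2) ->
  0 <= K -> 0 <= Q -> (forall r : R, `|q r| <= Q) -> v 0 = 0 ->
  (forall r : R, 0 <= r <= 1 -> `|v r| <= K * r /\ `|r * v1 r - v r| <= K * r ^+ 2) ->
  real_form (@ball1 R) (radial_grad V1) (fun x => - (q (enorm x) * V (sqnorm x)))
    (3 * (v1 1 - v 1)).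
Proof.
move=> x0 x1 xlt dv cv1 dv1 cV cV1 VE V1E mq qE K0 Q0 qQ v0 vK.
have mB : measurable (@ball1 R) by exact: (measurable_eball 1).
have mc (f : R3 -> R) : continuous f -> measurable_fun (@ball1 R) f.
  by move=> cf; apply: (measurable_funS measurableT) => //; exact: continuous_measurable_R3.
have mq3 : measurable_fun (@ball1 R) (fun x : R3 => - (q (enorm x) * V (sqnorm x))).
  apply: measurable_funN; apply: measurable_funM; last exact: (mc _ (continuous_radial cV)).
  by apply: (measurable_funS measurableT) => //; exact: measurableT_comp mq measurable_enorm.
have mal i : measurable_fun (@ball1 R) (radial_grad V1 i) by apply: mc; exact: continuous_radial_grad.
have [M1 M10 HM1] := continuous_bounded_ball 1 (continuous_radial cV1).
have [M2 M20 HM2] := continuous_bounded_ball 1 (continuous_radial cV).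
pose M := 2 * M1 + Q * M2.
have M0 : 0 <= M by rewrite /M addr_ge0 ?mulr_ge0.
have alM i x : ball1 x -> `|radial_grad V1 i x| <= M.
  move=> x1'; apply: (@le_trans _ _ (2 * M1)); last by rewrite /M lerDl mulr_ge0.
  rewrite normrM; apply: ler_pM => //; last exact/HM1/ltW.
  rewrite normrM normr_nat ler_piMr//; exact: le_trans (le_coord _ _) (ltW x1').
have beM x : ball1 x -> `|- (q (enorm x) * V (sqnorm x))| <= M.
  move=> x1'; apply: (@le_trans _ _ (Q * M2)); last by rewrite /M lerDr mulr_ge0.
  by rewrite normrN normrM; apply: ler_pM => //; exact/HM2/ltW.
split => //; first by exists M.
move=> phi sphi; have Cp := smooth_C1 sphi.
have [N N0 HN] := C1_bounded 1 Cp.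
rewrite (@Rintegral_ball1 _ (M * N * 4)); last 2 first.
- apply: measurable_funD.
    under eq_fun do rewrite big_I3.
    have mD i : measurable_fun (@ball1 R) (fun x => radial_grad V1 i x * 'D_(basis i) phi x).
      by apply: measurable_funM; [exact: mal|exact: (mc _ (Cp.2 i).2)].
    by apply: measurable_funD; [apply: measurable_funD|]; exact: mD.
  by apply: measurable_funM => //; exact: (mc _ Cp.1).
- move=> x x1'; have [p0 pD] := HN x (ltW x1').
  have t i : `|radial_grad V1 i x * 'D_(basis i) phi x| <= M * N.
    by rewrite normrM; apply: ler_pM => //; exact: alM.
  rewrite (_ : M * N * 4 = (M * N + M * N + M * N) + M * N); last by ring.
  apply: le_trans (ler_normD _ _) _; apply: lerD; last by rewrite normrM ler_pM// beM.
  by rewrite big_I3; apply: le_trans (ler_normD _ _) _; apply: lerD => //;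
    apply: le_trans (ler_normD _ _) _; exact: lerD.
have G := @radial_green n xs k v v1 V V1 (fun=> 1) (fun=> 0) q K 1 Q phi Cp.
rewrite x0 x1 in G.
transitivity (\int[leb3]_(y in B) ((3 * (v1 1 - v 1)) * phi (radial_proj y))); last first.
  by rewrite RintegralZl//; [exact: measurable_punctured_ball|exact: (integrable_radial_proj Cp.1)].
transitivity (\int[leb3]_(x in annulus 0 1)
    (\sum_(i < 3) 1 * radial_grad V1 i x * 'D_(basis i) phi x +
     (0 * (2 * enorm x * V1 (sqnorm x)) - 1 * (q (enorm x) * V (sqnorm x))) * phi x)).
  by apply: eq_Rintegral => x _; rewrite !big_I3; ring.
rewrite G//.
- by apply: eq_Rintegral => y _; rewrite v0 scale1r; ring.
- by move=> r /andP[r0 _]; exact: VE.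
- by move=> r /andP[r0 _]; exact: V1E.
- by move=> r; exact: cvg_cst.
- by move=> r _; rewrite normr1 normr0.
Qed.

Lemma continuous_bounded_itv (f : R -> R) (a b : R) : a <= b -> continuous f ->
  exists2 M, 0 <= M & forall x : R, a <= x <= b -> `|f x| <= M.
Proof.
move=> ab cf.
have cn : {within `[a, b], continuous (fun x => `|f x|)}.
  by apply: continuous_subspaceT => x; apply: cvg_norm; exact: cf.
have [c _ H] := EVT_max ab cn.
by exists `|f c| => // x xab; apply: H; rewrite in_itv.
Qed.

(** It is 1 up to [rho] and reaches 0 at [rho + 1], where the shell ends. A parabola is enough,
    since [radial_green] asks for one continuous derivative. *)
Definition cutoff (rho : R) : R -> R := glue rho (fun=> 1) (fun r => 1 - (r - rho) ^+ 2).

Definition cutoff1 (rho : R) : R -> R := glue rho (fun=> 0) (fun r => - (2 * (r - rho))).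

Lemma is_derive_cutoff (rho : R) (r : R) : is_derive r 1 (cutoff rho) (cutoff1 rho r).
Proof.
have d (t : R) : is_derive t 1 (fun r : R => 1 - (r - rho) ^+ 2) (- (2 * (t - rho))).
  have h1 := is_deriveB (is_derive_id t (1 : R)) (is_derive_cst rho t 1).
  have h2 := is_deriveB (is_derive_cst (1 : R) t (1 : R)) (is_deriveM h1 h1).
  apply: (is_derive_ext h2) => //.
  by rewrite !scaleRE -[(id - cst rho) t]/(t - rho); ring.
have d0 (t : R) : is_derive t 1 (fun=> 1 : R) 0 by exact: is_derive_cst.
by apply: (is_derive_glue (fun t _ => d0 t) (fun t _ => d t)); rewrite subrr; ring.
Qed.

Lemma continuous_cutoff1 (rho : R) : continuous (cutoff1 rho).
Proof.
apply: continuous_glue => [r _|r _|]; last by ring.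
  exact: cvg_cst.
apply: cvgN; apply: cvgM; first exact: cvg_cst.
by apply: cvgB; [exact: cvg_id|exact: cvg_cst].
Qed.

Lemma cutoff_le (rho r : R) : r <= rho + 1 -> `|cutoff rho r| <= 2 /\ `|cutoff1 rho r| <= 2.
Proof.
move=> rr; rewrite /cutoff /cutoff1 /glue; case: ltP => h.
  by rewrite normr0 normr1; split; lra.
have [h0 h1] : 0 <= r - rho /\ r - rho <= 1 by lra.
by split; rewrite ler_norml; apply/andP; split; nra.
Qed.

(** A smooth approximation of a function that vanishes beyond [rho] need not vanish on the outer
    sphere, so the cutoff is built into the coefficients to remove the boundary term there. Up to
    radius [rho] they are the true ones. The sign of the flux is reversed because the unit sphere is
    now the inner boundary. *)
Lemma real_form_shell (kappa rho : R) (v v1 V V1 : R -> R) : 1 < rho ->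
  (forall r : R, is_derive r 1 v (v1 r)) -> continuous v1 ->
  (forall r : R, is_derive r 1 v1 (- (kappa ^+ 2 * v r))) ->
  continuous V -> continuous V1 ->
  (forall r : R, 1 <= r -> V (r ^+ 2) = v r / r) ->
  (forall r : R, 1 <= r -> V1 (r ^+ 2) = (r * v1 r - v r) / (2 * r ^+ 3)) ->
  exists al be, real_form (shell (rho + 1)) al be (- (3 * (v1 1 - v 1))) /\
    forall x, enorm x <= rho ->
      (forall i, al i x = radial_grad V1 i x) /\ be x = - (kappa ^+ 2 * V (sqnorm x)).
Proof.
move=> r1 dv cv1 dv1 cV cV1 VE V1E.
have rr : 1 < rho + 1 by lra.
have cv := is_derive_continuous dv.
set X := cutoff rho; set X1 := cutoff1 rho.
have cX := is_derive_continuous (is_derive_cutoff rho).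
have cX1 := @continuous_cutoff1 rho.
set D := shell (rho + 1).
have mD : measurable D by exact: measurable_annulus.
have mc (f : R3 -> R) : continuous f -> measurable_fun D f.
  by move=> cf; apply: (measurable_funS measurableT) => //; exact: continuous_measurable_R3.
have me (f : R -> R) : continuous f -> measurable_fun D (fun x => f (enorm x)).
  move=> cf; apply: (measurable_funS measurableT) => //.
  by apply: measurableT_comp measurable_enorm; exact: continuous_measurable_fun.
have Dr x : D x -> [/\ 1 <= enorm x, enorm x <= rho + 1 & enorm x <= rho + 1].
  by move=> /andP[/ltW ? /ltW ?].
have [M1 M10 HM1] := continuous_bounded_ball (rho + 1) (continuous_radial cV1).
have [M2 M20 HM2] := continuous_bounded_ball (rho + 1) (continuous_radial cV).
pose P := rho + 1; have P0 : 0 <= P by rewrite /P; lra.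
pose al i x := X (enorm x) * radial_grad V1 i x.
pose be x := X1 (enorm x) * (2 * enorm x * V1 (sqnorm x)) - X (enorm x) * (kappa ^+ 2 * V (sqnorm x)).
pose M := 2 * (2 * P * M1) + 2 * (kappa ^+ 2 * M2).
have k20 : 0 <= kappa ^+ 2 by exact: sqr_ge0.
have t1 : 0 <= 2 * (2 * P * M1) by rewrite !mulr_ge0.
have t2 : 0 <= 2 * (kappa ^+ 2 * M2) by rewrite mulr_ge0// mulr_ge0.
exists al, be; split; last first.
  move=> x; rewrite le_eqVlt => h; rewrite /al /be.
  have [-> ->] : X (enorm x) = 1 /\ X1 (enorm x) = 0.
    rewrite /X /X1 /cutoff /cutoff1 /glue; case: ltP => // h2.
    have -> : enorm x = rho by case/orP: h => [/eqP//|h3]; lra.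
    by split; ring.
  by split; [move=> i|]; ring.
split.
- by move=> i; apply: measurable_funM; [exact: (me _ cX)|apply: mc; exact: continuous_radial_grad].
- apply: measurable_funB; apply: measurable_funM; try exact: me.
    apply: measurable_funM; last by apply: mc; exact: continuous_radial.
    by apply: (me (fun r => 2 * r)) => r; apply: cvgM; [exact: cvg_cst|exact: cvg_id].
  by apply: measurable_funM => //; apply: mc; exact: continuous_radial.
- exists M; split=> [i x|x] /Dr[x1 xP _]; have [Xb X1b] := cutoff_le xP.
    apply: (@le_trans _ _ (2 * (2 * P * M1))); last by rewrite lerDl.
    rewrite /al normrM; apply: ler_pM => //; rewrite /radial_grad normrM.
    apply: ler_pM => //; last exact: HM1.
    rewrite normrM normr_nat ler_wpM2l//; exact: le_trans (le_coord _ _) xP.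
  apply: le_trans (ler_normB _ _) _; apply: lerD; rewrite normrM; apply: ler_pM => //.
    rewrite normrM; apply: ler_pM => //; last exact: HM1.
    by rewrite normrM normr_nat ler_wpM2l// ger0_norm ?enorm_ge0.
  by rewrite normrM ger0_norm// ler_wpM2l//; exact: HM2.
move=> phi sphi; have Cp := smooth_C1 sphi.
have [K1 K10 HK1] := continuous_bounded_itv (ltW rr) cv.
have [K2 K20 HK2] := continuous_bounded_itv (ltW rr) (continuous_flux dv cv1).
(* The shell is a single layer between the radii 1 and rho + 1. *)
pose xs i := if i is 0%N then 1 else rho + 1.
have G := @radial_green 0%N xs (fun=> kappa) v v1 V V1 X X1 (fun=> kappa ^+ 2) (K1 + K2) 2 (kappa ^+ 2) phi Cp.
rewrite /= in G.
transitivity (\int[leb3]_(y in B) ((- (3 * (v1 1 - v 1))) * phi (radial_proj y))); last first.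
  by rewrite RintegralZl//; [exact: measurable_punctured_ball|exact: (integrable_radial_proj Cp.1)].
rewrite -[LHS]/(\int[leb3]_(x in annulus 1 (rho + 1))
    (\sum_(i < 3) X (enorm x) * radial_grad V1 i x * 'D_(basis i) phi x +
     (X1 (enorm x) * (2 * enorm x * V1 (sqnorm x)) - X (enorm x) * (kappa ^+ 2 * V (sqnorm x))) * phi x)).
rewrite (G ler01 _ dv cv1 (fun _ r _ _ => dv1 r) _ _ (is_derive_cutoff rho)) //.
- apply: eq_Rintegral => y _; rewrite scale1r.
  have -> : X 1 = 1 by rewrite /X /cutoff /glue r1.
  have -> : X (rho + 1) = 0.
    rewrite /X /cutoff /glue ifF; last by apply/negbTE; rewrite -leNgt lerDl.
    by rewrite addrAC subrr add0r expr1n subrr.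
  by ring.
- by case.
- by move=> r /andP[r0 _]; apply: VE; exact: ltW.
- by move=> r /andP[r0 _]; apply: V1E; exact: ltW.
- by rewrite addr_ge0.
- by move=> r; rewrite ger0_norm.
- move=> r rb; have := HK1 r rb; have := HK2 r rb; move/andP: rb => [ra rb] h2 h1.
  split.
    apply: le_trans h1 _; apply: (@le_trans _ _ (K1 + K2)); first by rewrite lerDl.
    by rewrite ler_peMr// addr_ge0.
  apply: le_trans h2 _; apply: (@le_trans _ _ (K1 + K2)); first by rewrite lerDr.
  by rewrite ler_peMr// ?addr_ge0// exprn_ege1.
- by move=> r /andP[_ rb]; exact: cutoff_le.
Qed.

Lemma Rintegral_support (D D' : set R3) (f : R3 -> R) : D' `<=` D ->
  (forall x, D x -> ~ D' x -> f x = 0) ->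
  \int[leb3]_(x in D) f x = \int[leb3]_(x in D') f x.
Proof.
move=> sD f0; rewrite /Rintegral; congr fine.
rewrite integral_mkcond [RHS]integral_mkcond; congr integral.
apply/funext => x; rewrite /patch; case: ifPn => [/set_mem Dx|Dx].
  by case: ifPn => // /negP; rewrite inE => D'x; rewrite f0.
by rewrite ifF//; apply/negbTE; apply: contra Dx; rewrite !inE; exact: sD.
Qed.

(** [v] and [w] are the real and imaginary parts of r times the exterior solution. As the test
    function vanishes beyond [rho], the integral reduces to the shell, where the modified
    coefficients may replace the true ones. *)
Lemma exterior_green (kappa rho : R) (v v1 V V1 w w1 W W1 : R -> R) (z : cfun) (Dz : cfield)
    (eta : cfun) : 1 < rho ->
  (forall r : R, is_derive r 1 v (v1 r)) -> continuous v1 ->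
  (forall r : R, is_derive r 1 v1 (- (kappa ^+ 2 * v r))) ->
  continuous V -> continuous V1 ->
  (forall r : R, 1 <= r -> V (r ^+ 2) = v r / r) ->
  (forall r : R, 1 <= r -> V1 (r ^+ 2) = (r * v1 r - v r) / (2 * r ^+ 3)) ->
  (forall r : R, is_derive r 1 w (w1 r)) -> continuous w1 ->
  (forall r : R, is_derive r 1 w1 (- (kappa ^+ 2 * w r))) ->
  continuous W -> continuous W1 ->
  (forall r : R, 1 <= r -> W (r ^+ 2) = w r / r) ->
  (forall r : R, 1 <= r -> W1 (r ^+ 2) = (r * w1 r - w r) / (2 * r ^+ 3)) ->
  real_trace (shell (rho + 1)) (fun x => Re (z x)) (fun i x => Re (Dz i x)) (fun x => Re (eta x)) ->
  real_trace (shell (rho + 1)) (fun x => Im (z x)) (fun i x => Im (Dz i x)) (fun x => Im (eta x)) ->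
  (forall x, rho < enorm x -> z x = 0 /\ forall i, Dz i x = 0) ->
  cint (@exterior R) (fun x => dotc (cradial_grad V1 W1 ^~ x) (Dz ^~ x)
                               - (kappa ^+ 2)%:C * cradial V W x * z x) =
  - (3 * ((v1 1 - v 1) +i* (w1 1 - w 1)) * cint B (eta \o @radial_proj R)).
Proof.
move=> r1 dv cv1 dv1 cV cV1 VE V1E dw cw1 dw1 cW cW1 WE W1E tr ti z0.
have [al1 [be1 [f1 E1]]] := real_form_shell r1 dv cv1 dv1 cV cV1 VE V1E.
have [al2 [be2 [f2 E2]]] := real_form_shell r1 dw cw1 dw1 cW cW1 WE W1E.
have mD : measurable (@shell R (rho + 1)) by exact: measurable_annulus.
have Dr : @shell R (rho + 1) `<=` eball (rho + 1) by move=> x /andP[].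
have H := complex_trace_density mD Dr f1 f2 tr ti.
transitivity (cint (shell (rho + 1)) (fun x => dotc (cradial_grad V1 W1 ^~ x) (Dz ^~ x)
                               - (kappa ^+ 2)%:C * cradial V W x * z x)).
  have sub : @shell R (rho + 1) `<=` @exterior R by move=> x /andP[].
  have out x : exterior x -> ~ shell (rho + 1) x -> rho < enorm x.
    move=> x1 nx; rewrite ltNge; apply/negP => xr; apply: nx.
    by apply/andP; split => //; lra.
  have zz x : exterior x -> ~ shell (rho + 1) x -> dotc (cradial_grad V1 W1 ^~ x) (Dz ^~ x)
                               - (kappa ^+ 2)%:C * cradial V W x * z x = 0.
    move=> xe xs; have [-> D0] := z0 x (out x xe xs).
    by rewrite /dotc !big_I3 !D0 !mulr0 subr0 !addr0.
  by rewrite /cint; congr (_ +i* _); apply: Rintegral_support => // x xe xs; rewrite zz.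
rewrite (_ : - _ = ((- (3 * (v1 1 - v 1))) +i* (- (3 * (w1 1 - w 1)))) * cint B (eta \o @radial_proj R)); last first.
  by rewrite -mulNr; congr (_ * _); apply/eqP; rewrite eq_complex/=; apply/andP; split; apply/eqP; ring.
rewrite -H; apply: cint_eq_parts; apply: eq_Rintegral => x /set_mem xD.
  have [xr|xr] := leP (enorm x) rho; last first.
    by have [-> D0] := z0 x xr; rewrite /dotc !big_I3 !D0 !mulr0 subr0 !addr0.
  have [a1 b1] := E1 x xr; have [a2 b2] := E2 x xr.
  rewrite /dotc !big_I3 !a1 !a2 b1 b2 !(cReD, cReN, cReM, cImM, cImN, cImD)/= /radial; ring.
have [xr|xr] := leP (enorm x) rho; last first.
  by have [-> D0] := z0 x xr; rewrite /dotc !big_I3 !D0 !mulr0 subr0 !addr0.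
have [a1 b1] := E1 x xr; have [a2 b2] := E2 x xr.
rewrite /dotc !big_I3 !a1 !a2 b1 b2 !(cReD, cReN, cReM, cImM, cImN, cImD)/= /radial; ring.
Qed.

End RadialGreen.

(** * The Dirichlet-to-Neumann map *)

Section DirichletToNeumann.
Context {R : realType}.
Local Notation R3 := (R * R * R)%type.
Local Notation leb3 := (@leb3 R).
Local Notation B := (@punctured_ball R).
Local Notation Re := (@complex.Re R).
Local Notation Im := (@complex.Im R).

Definition wave (kappa a b r : R) : R := a * cos (kappa * (r - 1)) + b * sin (kappa * (r - 1)).

Lemma is_derive_wave1 (kappa a b r : R) : kappa != 0 ->
  is_derive r 1 (wave kappa a b) (kappa * wave kappa b (- a) r).
Proof.
move=> k0; apply: (is_derive_ext (is_derive_wave a (kappa * b) 1 k0 r)).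
  by move=> s; rewrite /wave; field; exact: k0.
by rewrite /wave; ring.
Qed.

(** A rotation preserves length; in [outgoing_wave] this says that h exp(i kappa (r - 1)) has
    constant modulus. *)
Lemma wave_sqr (kappa a b r : R) :
  wave kappa a b r ^+ 2 + wave kappa (- b) a r ^+ 2 = a ^+ 2 + b ^+ 2.
Proof.
have := cos2Dsin2 (kappa * (r - 1)); rewrite /wave.
set c := cos _; set s := sin _ => E.
by rewrite -[RHS]mulr1 -E; ring.
Qed.

Lemma normc_le (z : R[i]) (a : R) : 0 <= a -> Re z ^+ 2 + Im z ^+ 2 <= a ^+ 2 -> Normc.normc z <= a.
Proof.
move=> a0 H; rewrite -(@ler_pXn2r _ 2)// ?nnegrE ?normc_ge0// normc_sqr//.
Qed.

Lemma compact_enorm_bounded (K : set R3) : compact K ->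
  exists2 rho, 1 < rho & forall x, K x -> enorm x <= rho.
Proof.
move=> /compact_box[M M0 KM]; exists (2 * M + 1); first by lra.
move=> x /KM [h1 h2 h3].
have s (t : R) : `|t| <= M -> t ^+ 2 <= M ^+ 2.
  by rewrite ler_norml => /andP[? ?]; nra.
apply: (@le_trans _ _ (2 * M)); last by lra.
rewrite -(@ler_pXn2r _ 2)// ?nnegrE ?enorm_ge0//; last by lra.
rewrite -sqnormE /sqnorm exprMn.
by have := s _ h1; have := s _ h2; have := s _ h3; have := sqr_ge0 M; lra.
Qed.

Lemma Rintegral_eq0 (D : set R3) (f : R3 -> R) : (forall x, D x -> f x = 0) ->
  \int[leb3]_(x in D) f x = 0.
Proof.
move=> f0; rewrite /Rintegral (@eq_integral _ _ _ _ _ (cst 0%E)) ?integral0//.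
by move=> x /set_mem/f0 ->.
Qed.

(** v + i w is h exp(i kappa (r - 1)), so v' = - kappa w, w' = kappa v, and the slope of (v + i w) /
    r at 1 is (i kappa - 1) h. The Green identity is kept as a second conclusion because it serves
    twice: test functions supported in the exterior yield the Helmholtz equation, general ones the
    normal derivative. *)
Lemma outgoing_wave (kappa : R) (h : R[i]) : 0 < kappa ->
  exists V V1 W W1 : R -> R,
  [/\ exterior_solution kappa (fun=> h) (cradial V W) (cradial_grad V1 W1) &
      forall (rho : R) (z : cfun) (Dz : cfield) (eta : cfun), 1 < rho ->
      real_trace (shell (rho + 1)) (fun x => Re (z x)) (fun i x => Re (Dz i x)) (fun x => Re (eta x)) ->
      real_trace (shell (rho + 1)) (fun x => Im (z x)) (fun i x => Im (Dz i x)) (fun x => Im (eta x)) ->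
      (forall x, rho < enorm x -> z x = 0 /\ forall i, Dz i x = 0) ->
      cint (@exterior R) (fun x => dotc (cradial_grad V1 W1 ^~ x) (Dz ^~ x)
                               - (kappa ^+ 2)%:C * cradial V W x * z x) =
      - (3 * (((0 +i* kappa) - 1) * h) * cint B (eta \o @radial_proj R))].
Proof.
move=> k0; have kn0 : kappa != 0 by rewrite gt_eqF.
pose v := wave kappa (Re h) (- Im h); pose w := wave kappa (Im h) (Re h).
pose v1 (r : R) := - kappa * w r; pose w1 (r : R) := kappa * v r.
have dv (r : R) : is_derive r 1 v (v1 r).
  by apply: (is_derive_ext (is_derive_wave1 (Re h) (- Im h) r kn0)) => //; rewrite /v1 /w /wave; ring.
have dw (r : R) : is_derive r 1 w (w1 r).
  by apply: (is_derive_ext (is_derive_wave1 (Im h) (Re h) r kn0)) => //; rewrite /w1 /v /wave; ring.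
have cv := is_derive_continuous dv; have cw := is_derive_continuous dw.
have cv1 : continuous v1 by move=> r; apply: cvgM; [exact: cvg_cst|exact: cw].
have cw1 : continuous w1 by move=> r; apply: cvgM; [exact: cvg_cst|exact: cv].
have dv1 (r : R) : is_derive r 1 v1 (- (kappa ^+ 2 * v r)).
  by apply: (is_derive_ext (is_deriveZ (- kappa) (dw r))) => //; rewrite scaleRE /w1; ring.
have dw1 (r : R) : is_derive r 1 w1 (- (kappa ^+ 2 * w r)).
  by apply: (is_derive_ext (is_deriveZ kappa (dv r))) => //; rewrite scaleRE /v1; ring.
have [V [V1 [dV cV1 VE V1E]]] := exterior_profile ltr01 dv cv1.
have [W [W1 [dW cW1 WE W1E]]] := exterior_profile ltr01 dw cw1.
have cV := is_derive_continuous dV; have cW := is_derive_continuous dW.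
have v_1 : v 1 = Re h by rewrite /v /wave subrr mulr0 cos0 sin0; ring.
have w_1 : w 1 = Im h by rewrite /w /wave subrr mulr0 cos0 sin0; ring.
have G (rho : R) (z : cfun) (Dz : cfield) (eta : cfun) : 1 < rho ->
      real_trace (shell (rho + 1)) (fun x => Re (z x)) (fun i x => Re (Dz i x)) (fun x => Re (eta x)) ->
      real_trace (shell (rho + 1)) (fun x => Im (z x)) (fun i x => Im (Dz i x)) (fun x => Im (eta x)) ->
      (forall x, rho < enorm x -> z x = 0 /\ forall i, Dz i x = 0) ->
      cint (@exterior R) (fun x => dotc (cradial_grad V1 W1 ^~ x) (Dz ^~ x)
                               - (kappa ^+ 2)%:C * cradial V W x * z x) =
      - (3 * (((0 +i* kappa) - 1) * h) * cint B (eta \o @radial_proj R)).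
  move=> r1 tr ti z0.
  rewrite (exterior_green r1 dv cv1 dv1 cV cV1 VE V1E dw cw1 dw1 cW cW1 WE W1E tr ti z0).
  rewrite v_1 w_1 /v1 /w1 v_1 w_1; congr (- (_ * _ * _)).
  case: h {v w v1 w1 dv dw cv cw cv1 cw1 dv1 dw1 VE V1E WE W1E v_1 w_1} => a b /=.
  by apply/eqP; rewrite eq_complex/=; apply/andP; split; apply/eqP; ring.
exists V, V1, W, W1; split => //.
have mD (rho : R) : measurable (@shell R rho) by exact: measurable_annulus.
have Dr (rho : R) : @shell R rho `<=` eball rho by move=> x /andP[].
have hE : h = V 1 +i* W 1.
  rewrite -(expr1n _ 2) VE// WE// !divr1 v_1 w_1; exact: complexE.
split.
- by move=> rho _; exact: (cradial_H1 (mD rho) (Dr rho) dV cV1 dW cW1).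
- move=> phi [[s1 s2] [K [cK Ke p0]]].
  have [rho r1 Kr] := compact_enorm_bounded cK.
  have clK : closed K by apply: compact_closed => //; exact: norm_hausdorff.
  have outK x : rho < enorm x -> ~ K x by move=> xr /Kr; rewrite leNgt xr.
  rewrite (G rho phi (cpartial phi) phi r1).
  (* The support lies in the open exterior, so the boundary values on the sphere are 0. *)
  + rewrite (_ : cint B _ = 0) ?mulr0 ?oppr0// /cint.
    have Z y : B y -> phi (radial_proj y) = 0.
      move=> By; apply: p0 => /Ke; rewrite /exterior/= enorm_radial_proj//.
      by rewrite ltxx.
    by rewrite !Rintegral_eq0// => y /Z; rewrite /= => ->.
  + exact: (smooth_real_trace (mD _) s1).
  + exact: (smooth_real_trace (mD _) s2).
  move=> x /outK Kx; split; first exact: p0.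
  move=> i; rewrite /cpartial (derive_vanish _ clK _ Kx) ?(derive_vanish _ clK _ Kx)//.
    by move=> y /p0 ->.
  by move=> y /p0 ->.
- move=> rho r1; have := cradial_trace (mD rho) r1 (Dr rho) dV cV1 dW cW1.
  by rewrite -hE.
(* The radial derivative minus i kappa times the wave equals -(v + i w) / r^2, of modulus |h| / r^2;
   this is at most eps / r once r >= |h| / eps. *)
move=> eps eps0; exists (Normc.normc h / eps); apply: aeW => x x1 xr.
set r := enorm x in x1 xr *.
have r0 : 0 < r by apply: lt_trans x1.
have rn0 : r != 0 by rewrite gt_eqF.
have Er : coord x i0 * coord x i0 + coord x i1 * coord x i1 + coord x i2 * coord x i2 = r ^+ 2.
  by rewrite -sqnormE sqnorm_coord big_I3.
have E : \sum_(i < 3) (coord x i / r)%:C * cradial_grad V1 W1 i x - (0 +i* kappa) * cradial V W x =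
    (- (v r / r ^+ 2)) +i* (- (w r / r ^+ 2)).
  rewrite big_I3 /cradial_grad /cradial /radial /radial_grad sqnormE -/r VE ?WE ?V1E ?W1E ?ltW//.
  rewrite /v1 /w1; apply/eqP; rewrite eq_complex/=; apply/andP; split; apply/eqP.
    transitivity (2 * ((coord x i0 * coord x i0 + coord x i1 * coord x i1 + coord x i2 * coord x i2) / r) *
       ((r * (- kappa * w r) - v r) / (2 * r ^+ 3)) + kappa * w r / r); first by field; exact: rn0.
    by rewrite Er; field; exact: rn0.
  transitivity (2 * ((coord x i0 * coord x i0 + coord x i1 * coord x i1 + coord x i2 * coord x i2) / r) *
       ((r * (kappa * v r) - w r) / (2 * r ^+ 3)) - kappa * v r / r); first by field; exact: rn0.
  by rewrite Er; field; exact: rn0.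
rewrite E; apply: (@le_trans _ _ (Normc.normc h / r ^+ 2)).
  apply: normc_le; first by rewrite divr_ge0 ?normc_ge0// sqr_ge0.
  rewrite /= expr_div_n normc_sqr.
  have := wave_sqr kappa (Im h) (Re h) r; rewrite -/(w r).
  rewrite (_ : wave kappa (- Re h) (Im h) r = - v r); last by rewrite /v /wave; ring.
  move=> Ew; rewrite (_ : Re h ^+ 2 + Im h ^+ 2 = w r ^+ 2 + (- v r) ^+ 2); last by rewrite Ew addrC.
  by rewrite le_eqVlt; apply/orP; left; apply/eqP; field; exact: rn0.
rewrite expr2 invfM mulrA ler_pM2r ?invr_gt0// ler_pdivrMr//.
by rewrite mulrC -ler_pdivrMr// ltW.
Qed.

(** On constants the map is multiplication by i kappa - 1, here paired with [eta] over the sphere.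
    The minus sign in [normal_derivative] cancels the one from the inner boundary. *)
Lemma DtN_constant (kappa : R) (h : R[i]) : 0 < kappa ->
  is_DtN kappa (fun=> h) (fun eta => 3 * (((0 +i* kappa) - 1) * h) * cint B (eta \o @radial_proj R)).
Proof.
move=> k0; have [V [V1 [W [W1 [ext G]]]]] := outgoing_wave h k0.
exists (cradial V W), (cradial_grad V1 W1); split => //.
move=> z Dz eta Hz [rho0 z0] tz.
pose rho := Num.max rho0 1 + 1.
have r1 : 1 < rho by rewrite /rho ltr_pwDr// le_max lexx orbT.
have r0 : rho0 < rho by rewrite /rho ltr_pwDr// le_max lexx.
have mD : measurable (@shell R (rho + 1)) by exact: measurable_annulus.
have r11 : 1 < rho + 1 by lra.
have [[mz _] mDz _] := Hz _ r11.
have [tr ti] := trace_real_parts mD mz (fun i => (mDz i).1) (tz _ r11).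
by rewrite (G rho z Dz eta r1 tr ti) ?opprK// => x xr; apply: z0; exact: lt_trans xr.
Qed.

End DirichletToNeumann.

(** * The radial weak solution in the ball *)

Section BallSolution.
Context {R : realType}.
Local Notation R3 := (R * R * R)%type.
Local Notation leb3 := (@leb3 R).
Local Notation B := (@punctured_ball R).
Local Notation Re := (@complex.Re R).
Local Notation Im := (@complex.Im R).

Lemma cmeasurableD (D : set R3) (f g : cfun) : cmeasurable D f -> cmeasurable D g ->
  cmeasurable D (fun x => f x + g x).
Proof.
move=> [f1 f2] [g1 g2]; split.
  rewrite (_ : (fun x => _) = (fun x => Re (f x) + Re (g x))); first exact: measurable_funD.
  by apply/funext => x; rewrite cReD.
rewrite (_ : (fun x => _) = (fun x => Im (f x) + Im (g x))); first exact: measurable_funD.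
by apply/funext => x; rewrite cImD.
Qed.

Lemma cmeasurableN (D : set R3) (f : cfun) : cmeasurable D f -> cmeasurable D (fun x => - f x).
Proof.
move=> [f1 f2]; split.
  rewrite (_ : (fun x => _) = (fun x => - Re (f x))); first exact: measurable_funN.
  by apply/funext => x; rewrite cReN.
rewrite (_ : (fun x => _) = (fun x => - Im (f x))); first exact: measurable_funN.
by apply/funext => x; rewrite cImN.
Qed.

Lemma cmeasurableM (D : set R3) (f g : cfun) : cmeasurable D f -> cmeasurable D g ->
  cmeasurable D (fun x => f x * g x).
Proof.
move=> [f1 f2] [g1 g2]; split.
  rewrite (_ : (fun x => _) = (fun x => Re (f x) * Re (g x) - Im (f x) * Im (g x))).
    by apply: measurable_funB; exact: measurable_funM.
  by apply/funext => x; rewrite cReM.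
rewrite (_ : (fun x => _) = (fun x => Re (f x) * Im (g x) + Im (f x) * Re (g x))).
  by apply: measurable_funD; exact: measurable_funM.
by apply/funext => x; rewrite cImM.
Qed.

Lemma cmeasurable_real (D : set R3) (f : R3 -> R) : measurable_fun D f ->
  cmeasurable D (fun x => (f x)%:C).
Proof. by move=> mf; split => //; exact: measurable_cst. Qed.

Lemma cmeasurable_dotc (D : set R3) (F G : cfield) : (forall i, cmeasurable D (F i)) ->
  (forall i, cmeasurable D (G i)) -> cmeasurable D (fun x => dotc (F ^~ x) (G ^~ x)).
Proof.
move=> mF mG.
rewrite (_ : (fun x => _) = (fun x => F i0 x * G i0 x + F i1 x * G i1 x + F i2 x * G i2 x)).
  by apply: cmeasurableD; [apply: cmeasurableD|]; exact: cmeasurableM.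
by apply/funext => x; rewrite /dotc big_I3.
Qed.

Lemma ae_eq_Rintegral (D : set R3) (f g : R3 -> R) : measurable D ->
  measurable_fun D f -> measurable_fun D g ->
  {ae leb3, forall x, D x -> f x = g x} ->
  \int[leb3]_(x in D) f x = \int[leb3]_(x in D) g x.
Proof.
move=> mD mf mg fg; rewrite /Rintegral; congr fine.
apply: ae_eq_integral => //; [exact/measurable_EFinP|exact/measurable_EFinP|].
by apply: filterS fg => x /[apply] ->.
Qed.

Lemma ae_eq_cint (D : set R3) (f g : cfun) : measurable D ->
  cmeasurable D f -> cmeasurable D g ->
  {ae leb3, forall x, D x -> f x = g x} -> cint D f = cint D g.
Proof.
move=> mD [f1 f2] [g1 g2] fg; apply: cint_eq_parts; apply: ae_eq_Rintegral => //;
  by apply: filterS fg => x /[apply] ->.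
Qed.

Lemma cintZl (D : set R3) (b : R[i]) (f : cfun) : measurable D ->
  leb3.-integrable D (EFin \o (fun x => Re (f x))) ->
  leb3.-integrable D (EFin \o (fun x => Im (f x))) ->
  cint D (fun x => b * f x) = b * cint D f.
Proof.
move=> mD f1 f2; have Z c (g : R3 -> R) : leb3.-integrable D (EFin \o g) ->
   leb3.-integrable D (EFin \o (fun x => c * g x)).
  by move=> gi; exact: (integrableZl mD c gi).
rewrite /cint; under eq_Rintegral do rewrite cReM.
under [X in _ +i* X]eq_Rintegral do rewrite cImM.
rewrite RintegralB ?RintegralD ?RintegralZl//; try exact: Z.
by rewrite [in RHS](complexE b).
Qed.

Lemma real_trace_integrable (D : set R3) v Dv eta : real_trace D v Dv eta ->
  leb3.-integrable B (EFin \o (eta \o @radial_proj R)).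
Proof.
move=> [_ _ mt [phi [sphi _ _ ct]]].
apply: (cvg_L2_integrable _ _ _ mt ct).
- exact: measurable_punctured_ball.
- exact: punctured_ball_lty.
- by move=> k; apply: integrable_radial_proj; exact: smooth_continuous.
Qed.

Lemma real_formZ (D : set R3) (rho c : R) al be la : measurable D -> D `<=` eball rho ->
  real_form D al be la ->
  real_form D (fun i x => c * al i x) (fun x => c * be x) (c * la).
Proof.
move=> mD Dr [m1 m2 [M [b1 b2]] id]; split.
- by move=> i; apply: measurable_funM.
- by apply: measurable_funM.
- exists (`|c| * M); split=> [i x Dx|x Dx]; rewrite normrM ler_wpM2l//; [exact: b1|exact: b2].
move=> phi sphi.
(* Density is applied to [phi] itself in order to get the integrability of the integrand. *)
have [I _ _] := real_trace_density mD Dr m1 m2 b1 b2 id (smooth_real_trace mD sphi).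
rewrite -mulrA -id// -RintegralZl//; apply: eq_Rintegral => x _.
by rewrite !big_I3; ring.
Qed.

(** Green's formula gives the flux a (v'(1) - v(1)) and the Dirichlet-to-Neumann map gives (i kappa
    - 1) a v(1). In their difference the terms a v(1) cancel, which leaves a (v'(1) - i kappa v(1))
    = b. *)
Lemma ball_weak_solution (n : nat) (xs k : nat -> R) (v v1 V V1 q : R -> R) (K Q : R)
    (om kappa : R) (c : R3 -> R) (a b : R[i]) :
  xs 0%N = 0 -> xs n.+1 = 1 -> (forall i, (i <= n)%N -> xs i < xs i.+1) ->
  (forall r : R, is_derive r 1 v (v1 r)) -> continuous v1 ->
  (forall i (r : R), (i <= n)%N -> xs i < r < xs i.+1 -> is_derive r 1 v1 (- (k i ^+ 2 * v r))) ->
  (forall t : R, is_derive t 1 V (V1 t)) -> continuous V1 ->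
  (forall r : R, 0 < r -> V (r ^+ 2) = v r / r) ->
  (forall r : R, 0 < r -> V1 (r ^+ 2) = (r * v1 r - v r) / (2 * r ^+ 3)) ->
  measurable_fun setT q ->
  (forall i (r : R), (i <= n)%N -> xs i < r < xs i.+1 -> q r = k i ^+ 2) ->
  0 <= K -> 0 <= Q -> (forall r : R, `|q r| <= Q) -> v 0 = 0 ->
  (forall r : R, 0 <= r <= 1 -> `|v r| <= K * r /\ `|r * v1 r - v r| <= K * r ^+ 2) ->
  0 < kappa -> measurable_fun setT c ->
  {ae leb3, forall x, ball1 x -> (om / c x) ^+ 2 = q (enorm x)} ->
  a * ((v1 1)%:C - (0 +i* kappa) * (v 1)%:C) = b ->
  weak_solution om kappa c (fun=> b)
    (cradial (fun t => Re a * V t) (fun t => Im a * V t))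
    (cradial_grad (fun t => Re a * V1 t) (fun t => Im a * V1 t)).
Proof.
move=> x0 x1 xlt dv cv1 dv1 dV cV1 VE V1E mq qE K0 Q0 qQ v0 vK k0 mc cq ab.
have mB : measurable (@ball1 R) by exact: (measurable_eball 1).
have B1 : @ball1 R `<=` eball 1 by [].
have B2 : @ball1 R `<=` eball 2 by move=> x xb; apply: lt_trans xb _; rewrite ltr1n.
have cV := is_derive_continuous dV.
have dZ s (t : R) : is_derive t 1 (fun t => s * V t) (s * V1 t) by exact: is_deriveZ.
have cZ (s : R) (f : R -> R) : continuous f -> continuous (fun t => s * f t).
  by move=> cf t; apply: cvgM; [exact: cvg_cst|exact: cf].
have V_1 : V 1 = v 1 by rewrite -[in LHS](expr1n _ 2) VE// divr1.
have Hu := cradial_H1 mB B1 (dZ (Re a)) (cZ _ _ cV1) (dZ (Im a)) (cZ _ _ cV1).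
split => //.
exists (fun=> (Re a * V 1) +i* (Im a * V 1)), (fun eta => 3 * (((0 +i* kappa) - 1) * ((Re a * V 1) +i* (Im a * V 1))) * cint B (eta \o @radial_proj R)); split.
- exact: (cradial_trace mB (ltr1n R 2) B2 (dZ (Re a)) (cZ _ _ cV1) (dZ (Im a)) (cZ _ _ cV1)).
- exact: DtN_constant.
move=> z Dz eta [[mz _] LDz _] tz.
have mDz i : cmeasurable (@ball1 R) (Dz i) := (LDz i).1.
have [tr ti] := trace_real_parts mB mz mDz tz.
have F := real_form_ball x0 x1 xlt dv cv1 dv1 cV cV1 VE V1E mq qE K0 Q0 qQ v0 vK.
have H := complex_trace_density mB B1 (real_formZ (Re a) mB B1 F) (real_formZ (Im a) mB B1 F) tr ti.
have -> : surf_cint (fun x => b * eta x) = 3 * (b * cint B (eta \o @radial_proj R)).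
  by congr (_ * _); apply: (@cintZl B b (eta \o @radial_proj R));
    [exact: measurable_punctured_ball|exact: real_trace_integrable tr|exact: real_trace_integrable ti].
have mcr (f : R3 -> R) : continuous f -> measurable_fun (@ball1 R) f.
  by move=> cf; apply: (measurable_funS measurableT) => //; exact: continuous_measurable_R3.
have mqe : measurable_fun (@ball1 R) (fun x => q (enorm x)).
  by apply: (measurable_funS measurableT) => //; exact: measurableT_comp mq measurable_enorm.
have mce : measurable_fun (@ball1 R) (fun x => (om / c x) ^+ 2).
  apply: measurable_funX; apply: measurable_funM => //.
  by apply: (measurable_funS measurableT) => //; exact: measurableT_comp measurable_invr mc.
set u := cradial _ _; set Du := cradial_grad _ _.
have mu : cmeasurable (@ball1 R) u by case: Hu => -[].
have mDu i : cmeasurable (@ball1 R) (Du i) by case: Hu => _ /(_ i)[].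
have mf (f : R3 -> R) : measurable_fun (@ball1 R) f ->
   cmeasurable (@ball1 R) (fun x => dotc (Du ^~ x) (Dz ^~ x) - (f x)%:C * u x * z x).
  move=> mf; apply: cmeasurableD; first exact: cmeasurable_dotc.
  by apply: cmeasurableN; apply: cmeasurableM => //; apply: cmeasurableM => //; exact: cmeasurable_real.
rewrite (@ae_eq_cint _ _ (fun x => dotc (Du ^~ x) (Dz ^~ x) - (q (enorm x))%:C * u x * z x)) //; last 3 first.
- exact: mf.
- exact: mf.
- by apply: filterS cq => x /[apply] ->.
rewrite (_ : cint _ _ = ((Re a * (3 * (v1 1 - v 1))) +i* (Im a * (3 * (v1 1 - v 1)))) * cint B (eta \o @radial_proj R)).
  rewrite -ab V_1 -mulrBl [in RHS]mulrA; congr (_ * _).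
  by case: (a) => a1 a2; apply/eqP; rewrite eq_complex/=; apply/andP; split; apply/eqP; ring.
rewrite -H; apply: cint_eq_parts; apply: eq_Rintegral => x _.
  by rewrite /dotc !big_I3 !(cReD, cReN, cReM, cImM, cImN, cImD)/= /radial /radial_grad; ring.
by rewrite /dotc !big_I3 !(cReD, cReN, cReM, cImM, cImN, cImD)/= /radial /radial_grad; ring.
Qed.

Lemma find_layer (n : nat) (xs : nat -> R) (r : R) :
  xs 0%N < r < xs n.+1 -> (forall i, (i <= n.+1)%N -> r != xs i) ->
  exists2 i, (i <= n)%N & xs i < r < xs i.+1.
Proof.
elim: n => [|n IH] /andP[r0 rn] rx; first by exists 0%N => //; rewrite r0.
have [rl|rl|re] := ltgtP r (xs n.+1).
- have [i ni ri] : exists2 i, (i <= n)%N & xs i < r < xs i.+1.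
    by apply: IH; [rewrite r0|move=> i ni; exact/rx/leqW].
  by exists i => //; exact: leqW.
- by exists n.+1 => //; rewrite rl.
- by have := rx n.+1 (leqnSn _); rewrite re eqxx.
Qed.

(** The excluded points lie on countably many spheres, of radii [xs i], including the origin at
    radius [xs 0%N]; each of them is null. *)
Lemma ae_layer (n : nat) (xs : nat -> R) : xs 0%N = 0 -> xs n.+1 = 1 ->
  {ae leb3, forall x, ball1 x -> exists2 i, (i <= n)%N & xs i < enorm x < xs i.+1}.
Proof.
move=> x0 x1.
have N i : {ae leb3, forall x, enorm x != xs i}.
  exists [set x | enorm x = xs i]; split; last 2 first.
  - exact: leb3_sphere.
  - by move=> x /= /negP; rewrite negbK => /eqP.
  rewrite -[X in measurable X]setTI.
  exact: (measurable_enorm measurableT (measurable_set1 (xs i))).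
have := ae_foralln N; apply: filterS => x xx xb.
apply: find_layer => [|i _]; last exact: xx.
by rewrite x0 x1 xb andbT lt_neqAle enorm_ge0 andbT eq_sym -x0.
Qed.

End BallSolution.

(** * Uniqueness of weak gradients *)

Section GradientUniqueness.
Context {R : realType}.
Local Notation R3 := (R * R * R)%type.
Local Notation leb3 := (@leb3 R).
Local Notation Re := (@complex.Re R).
Local Notation Im := (@complex.Im R).

Lemma compact_sqnorm (a : R) : compact [set x : R3 | sqnorm x <= a].
Proof.
pose b := Num.sqrt a.
pose K : set R3 := (`[-b, b] `*` `[-b, b]) `*` `[-b, b].
apply: (@subclosed_compact _ _ K).
- rewrite (_ : [set x | _] = (@sqnorm R) @^-1` [set t | t <= a])//.
  by apply: preimage_closed; [move=> x _; exact: continuous_sqnorm|exact: closed_le].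
- by apply: compact_setX; [apply: compact_setX|]; exact: segment_compact.
move=> x /= xa; have [h1 h2 h3] := le_coord_enorm x.
have xb : enorm x <= b by rewrite /enorm -/(sqnorm x) ler_sqrt// (le_trans _ xa)// sqnormE sqr_ge0.
have H (u : R) : `|u| <= enorm x -> `[-b, b]%classic u.
  by move=> ux; rewrite /= in_itv/= -ler_norml (le_trans ux).
by split; [split|]; exact: H.
Qed.

Lemma bump1_ge0_le1 (t : R) : 0 <= bump 1 t <= 1.
Proof.
rewrite /bump; case: ltP => t0; last by rewrite lexx ler01.
by rewrite hornerC mul1r expR_ge0 -expR0 ler_expR oppr_le0 invr_ge0 ltW.
Qed.

Lemma bump1_gt0 (t : R) : 0 < t -> 0 < bump 1 t.
Proof. by move=> t0; rewrite /bump t0 hornerC mul1r expR_gt0. Qed.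

Lemma integrable_ge0 (D : set R3) (f : R3 -> R) : measurable_fun D f ->
  (forall x, 0 <= f x) -> (\int[leb3]_(x in D) (f x)%:E < +oo)%E ->
  leb3.-integrable D (EFin \o f).
Proof.
move=> mf f0 fi; apply/integrableP; split; first exact/measurable_EFinP.
by under eq_integral do rewrite /= ger0_norm//.
Qed.

(* With chi a cutoff, chi g^2 <= chi (psi - g)^2 + 2 g (chi psi), where chi psi is
   admissible in the hypothesis and psi is as close to g as desired. *)
Lemma L2_test_zero (g : R3 -> R) (psi : nat -> R3 -> R) :
  measurable_fun (@ball1 R) g -> (\int[leb3]_(x in @ball1 R) (g x ^+ 2)%:E < +oo)%E ->
  (forall k, smooth (psi k)) -> cvg_L2 (@ball1 R) psi g ->
  (forall phi K, smooth phi -> compact K -> K `<=` @ball1 R -> (forall x, ~ K x -> phi x = 0) ->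
    \int[leb3]_(x in @ball1 R) (g x * phi x) = 0) ->
  {ae leb3, forall x, ball1 x -> g x = 0}.
Proof.
move=> mg g2 spsi cv gphi.
have mB : measurable (@ball1 R) by exact: (measurable_eball 1).
have fB : (leb3 (@ball1 R) < +oo)%E by exact: (leb3_ball_lty 1).
have B1 : @ball1 R `<=` eball 1 by [].
have g2i : leb3.-integrable (@ball1 R) (EFin \o (fun x => g x ^+ 2)).
  by apply: integrable_ge0 => // [|x]; [exact: measurable_funX|exact: sqr_ge0].
have mc (f : R3 -> R) : continuous f -> measurable_fun (@ball1 R) f.
  by move=> cf; apply: (measurable_funS measurableT) => //; exact: continuous_measurable_R3.
(* For a < 1 the cutoff has compact support in the ball; the values a = 1 - 1/(k+1) exhaust the
   ball, since the cutoff is positive where |x|^2 < a. *)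
suff H a : a < 1 -> {ae leb3, forall x, ball1 x -> bump 1 (a - sqnorm x) * g x ^+ 2 = 0}.
  have Hk (k : nat) : (1 - k.+1%:R^-1 : R) < 1 by rewrite ltrBlDr ltrDl invr_gt0.
  have := ae_foralln (fun k => H _ (Hk k)).
  apply: filterS => x xk xb.
  have sx : sqnorm x < 1 by rewrite sqnormE -[ltRHS](expr1n _ 2) ltr_pXn2r ?nnegrE ?enorm_ge0.
  have [k kx] := ltr_add_invr sx.
  have p0 : 0 < bump 1 (1 - k.+1%:R^-1 - sqnorm x) by apply: bump1_gt0; rewrite -addrA -opprD subr_gt0 addrC.
  by have /eqP := xk k xb; rewrite mulf_eq0 gt_eqF//= expf_eq0/= => /eqP.
move=> a1; pose chi (x : R3) := bump 1 (a - sqnorm x).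
have chi01 x : 0 <= chi x <= 1 by exact: bump1_ge0_le1.
have schi : smooth chi by exact: smooth_bump.
pose K : set R3 := [set x | sqnorm x <= a].
have K1 : K `<=` @ball1 R.
  move=> x /= xa; rewrite /ball1/= -(ltr_pXn2r (n := 2)) ?nnegrE ?enorm_ge0//.
  by rewrite expr1n -sqnormE; exact: le_lt_trans a1.
have chi0 x : ~ K x -> chi x = 0.
  by move=> /negP; rewrite -ltNge /chi /bump => xa; rewrite ifF//; apply/negbTE; rewrite -leNgt; lra.
have chiI (f : R3 -> R) : leb3.-integrable (@ball1 R) (EFin \o f) ->
    leb3.-integrable (@ball1 R) (EFin \o (fun x => chi x * f x)).
  move=> fi; have /integrableP[/measurable_EFinP mf _] := fi.
  apply: le_integrable fi => //.
    apply/measurable_EFinP; apply: measurable_funM; first by apply: mc; exact: smooth_continuous.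
    exact: mf.
  move=> x xB /=; rewrite lee_fin normrM; have /andP[c0 c1] := chi01 x.
  by rewrite ger0_norm// ler_piMl.
have le_e (e : R) : 0 < e -> \int[leb3]_(x in @ball1 R) (chi x * g x ^+ 2) <= e.
  move=> e0; have [k Hk] := filter_ex (cvge0_le e0 cv).
  have cpsi := smooth_continuous (spsi k).
  have mpg : measurable_fun (@ball1 R) (fun x => psi k x - g x).
    by apply: measurable_funB => //; exact: mc.
  have pgi : leb3.-integrable (@ball1 R) (EFin \o (fun x => (psi k x - g x) ^+ 2)).
    apply: integrable_ge0 => // [|x|]; [exact: measurable_funX|exact: sqr_ge0|].
    exact: le_lt_trans Hk (ltry _).
  have spk := smooth_mul schi (spsi k).
  have cpk := smooth_continuous spk.
  have [M M0 HM] := continuous_bounded_ball 1 cpk.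
  have [Igp _ _] := cvg_L2_Rintegral mB fB (mc _ cpk) (fun x xB => HM x (ltW xB))
    (fun k => continuous_integrable mB B1 (smooth_continuous (spsi k))) mg cv.
  have I1 := chiI _ pgi.
  have I2 : leb3.-integrable (@ball1 R) (EFin \o (fun x => 2 * (chi x * psi k x * g x))).
    exact: (integrableZl mB 2 Igp).
  apply: (@le_trans _ _ (\int[leb3]_(x in @ball1 R)
     (chi x * (psi k x - g x) ^+ 2 + 2 * (chi x * psi k x * g x)))).
    apply: le_Rintegral => //; first exact: chiI.
      have := integrableD mB I1 I2; apply: eq_integrable => // x _ /=; by rewrite EFinD.
    move=> x _; have /andP[c0 _] := chi01 x.
    by have := mulr_ge0 c0 (sqr_ge0 (psi k x)); lra.
  rewrite RintegralD// RintegralZl//.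
  have -> : \int[leb3]_(x in @ball1 R) (chi x * psi k x * g x) = 0.
    under eq_Rintegral do rewrite mulrC.
    apply: (gphi _ K) => //; first exact: compact_sqnorm.
    by move=> x /chi0 ->; rewrite mul0r.
  rewrite mulr0 addr0; apply: (@le_trans _ _ (\int[leb3]_(x in @ball1 R) ((psi k x - g x) ^+ 2))).
    apply: le_Rintegral => // x _; have /andP[c0 c1] := chi01 x.
    by rewrite ler_piMl// sqr_ge0.
  rewrite -lee_fin /Rintegral fineK//.
  rewrite ge0_fin_numE; first exact: le_lt_trans Hk (ltry _).
  by apply: integral_ge0 => x _; rewrite lee_fin sqr_ge0.
have I := chiI _ g2i.
have cg0 x : 0 <= chi x * g x ^+ 2 by have /andP[c0 _] := chi01 x; rewrite mulr_ge0// sqr_ge0.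
have z : (\int[leb3]_(x in @ball1 R) `|(chi x * g x ^+ 2)%:E|)%E = 0%E.
  under eq_integral do rewrite /= ger0_norm//.
  apply/eqP; rewrite eq_le integral_ge0 ?andbT; last by move=> x _; rewrite lee_fin.
  have fn : (\int[leb3]_(x in @ball1 R) (chi x * g x ^+ 2)%:E)%E \is a fin_num.
    by have := integrable_fin_num mB I.
  by rewrite -(fineK fn) lee_fin; apply/ler_addgt0Pr => e e0; rewrite add0r; exact: le_e.
have mI : measurable_fun (@ball1 R) (EFin \o (fun x => chi x * g x ^+ 2)) by have /integrableP[] := I.
have [+ _] := ae_eq_integral_abs leb3 mB mI => /(_ z).
by apply: filterS => x /[apply] -[].
Qed.

Lemma integral_sqrB_le (D : set R3) (f g : R3 -> R) : measurable D ->
  measurable_fun D f -> measurable_fun D g ->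
  (\int[leb3]_(x in D) ((f x - g x) ^+ 2)%:E <=
   2%:E * (\int[leb3]_(x in D) (f x ^+ 2)%:E + \int[leb3]_(x in D) (g x ^+ 2)%:E))%E.
Proof.
move=> mD mf mg.
have m2 (h : R3 -> R) : measurable_fun D h -> measurable_fun D (fun x => (h x ^+ 2)%:E).
  by move=> mh; apply/measurable_EFinP; exact: measurable_funX.
have p2 (h : R3 -> R) x : D x -> (0 <= (h x ^+ 2)%:E)%E by rewrite lee_fin sqr_ge0.
rewrite -ge0_integralD//; try exact: m2; try exact: p2.
rewrite -ge0_integralZl//; last 2 first.
- by apply: emeasurable_funD; exact: m2.
- by move=> x Dx; apply: adde_ge0; exact: p2.
apply: ge0_le_integral => //.
- by move=> x Dx; exact: (p2 (fun x => f x - g x)).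
- by apply: (m2 (fun x => f x - g x)); exact: measurable_funB.
- by apply: measurable_funeM; apply: emeasurable_funD; exact: m2.
by move=> x _; rewrite -EFinD -EFinM lee_fin; have := sqr_ge0 (f x + g x); nra.
Qed.

Lemma L2_parts (D : set R3) (f : cfun) : measurable D -> L2 D f ->
  (\int[leb3]_(x in D) (Re (f x) ^+ 2)%:E < +oo)%E /\
  (\int[leb3]_(x in D) (Im (f x) ^+ 2)%:E < +oo)%E.
Proof.
move=> mD [mf]; rewrite sqnorm2D// => H.
have p (h : R3 -> R) : (0 <= \int[leb3]_(x in D) (h x ^+ 2)%:E)%E.
  by apply: integral_ge0 => x _; rewrite lee_fin sqr_ge0.
by split; apply: le_lt_trans H; [exact: leeDl|exact: leeDr].
Qed.

Lemma cvg_L2B (D : set R3) (f f' : nat -> R3 -> R) (g g' : R3 -> R) : measurable D ->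
  (forall k, measurable_fun D (f k)) -> (forall k, measurable_fun D (f' k)) ->
  measurable_fun D g -> measurable_fun D g' -> cvg_L2 D f g -> cvg_L2 D f' g' ->
  cvg_L2 D (fun k x => f k x - f' k x) (fun x => g x - g' x).
Proof.
move=> mD mf mf' mg mg' c c'.
have H : (2%:E * (\int[leb3]_(x in D) ((f k x - g x) ^+ 2)%:E +
                  \int[leb3]_(x in D) ((f' k x - g' x) ^+ 2)%:E))%E @[k --> \oo] --> 0%E.
  by rewrite -[X in _ --> X](mule0 2%:E); apply: cvgeZl => //;
    rewrite -[X in _ --> X](adde0 0%E); apply: cvgeD.
apply: (squeeze_cvge _ (cvg_cst 0%E) H); apply: nearW => k.
rewrite integral_ge0/=; last by move=> x _; rewrite lee_fin sqr_ge0.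
apply: le_trans (integral_sqrB_le mD _ _); try exact: measurable_funB.
rewrite le_eqVlt; apply/orP; left; apply/eqP; apply: eq_integral => x _.
by congr (_ ^+ 2)%:E; ring.
Qed.

Lemma L2_test_unique (f g : R3 -> R) (p q : nat -> R3 -> R) :
  measurable_fun (@ball1 R) f -> measurable_fun (@ball1 R) g ->
  (\int[leb3]_(x in @ball1 R) (f x ^+ 2)%:E < +oo)%E ->
  (\int[leb3]_(x in @ball1 R) (g x ^+ 2)%:E < +oo)%E ->
  (forall k, smooth (p k)) -> (forall k, smooth (q k)) ->
  cvg_L2 (@ball1 R) p f -> cvg_L2 (@ball1 R) q g ->
  (forall phi K, smooth phi -> compact K -> K `<=` @ball1 R -> (forall x, ~ K x -> phi x = 0) ->
    \int[leb3]_(x in @ball1 R) (f x * phi x) = \int[leb3]_(x in @ball1 R) (g x * phi x)) ->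
  {ae leb3, forall x, ball1 x -> f x = g x}.
Proof.
move=> mf mg f2 g2 sp sq cp cq H.
have mB : measurable (@ball1 R) by exact: (measurable_eball 1).
have fB : (leb3 (@ball1 R) < +oo)%E by exact: (leb3_ball_lty 1).
have B1 : @ball1 R `<=` eball 1 by [].
have mc (h : R3 -> R) : continuous h -> measurable_fun (@ball1 R) h.
  by move=> ch; apply: (measurable_funS measurableT) => //; exact: continuous_measurable_R3.
suff : {ae leb3, forall x, ball1 x -> f x - g x = 0}.
  by apply: filterS => x /[apply] /subr0_eq.
apply: (@L2_test_zero _ (fun k x => p k x - q k x)).
- exact: measurable_funB.
- apply: le_lt_trans (integral_sqrB_le mB mf mg) _.
  by apply: lte_mul_pinfty => //; rewrite lte_add_pinfty.
- by move=> k; apply: smooth_add => //; exact: smooth_opp.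
- by apply: cvg_L2B => // k; apply: mc; exact: smooth_continuous.
move=> phi K sphi cK K1 p0; have cphi := smooth_continuous sphi.
have [M M0 HM] := continuous_bounded_ball 1 cphi.
have I (h : R3 -> R) (r : nat -> R3 -> R) : measurable_fun (@ball1 R) h ->
    (forall k, smooth (r k)) -> cvg_L2 (@ball1 R) r h ->
    leb3.-integrable (@ball1 R) (EFin \o (fun x => h x * phi x)).
  move=> mh sr cr.
  have [Ih _ _] := cvg_L2_Rintegral mB fB (mc _ cphi) (fun x xB => HM x (ltW xB))
    (fun k => continuous_integrable mB B1 (smooth_continuous (sr k))) mh cr.
  by apply: eq_integrable Ih => // x _ /=; rewrite mulrC.
under eq_Rintegral do rewrite mulrBl.
by rewrite RintegralB//; [rewrite (H _ _ sphi cK K1 p0) subrr|exact: I sp cp|exact: I sq cq].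
Qed.

Lemma weak_gradient_unique (u w : cfun) (Du Dw : cfield) (h h' : cfun) :
  H1 (@ball1 R) u Du -> trace (@ball1 R) u Du h ->
  H1 (@ball1 R) w Dw -> trace (@ball1 R) w Dw h' ->
  {ae leb3, forall x, ball1 x -> w x = u x} ->
  forall i, {ae leb3, forall x, ball1 x -> Dw i x = Du i x}.
Proof.
move=> [[mu u2] LDu wu] tu [[mw w2] LDw ww] tw wE i.
have mB : measurable (@ball1 R) by exact: (measurable_eball 1).
have mDu j : cmeasurable (@ball1 R) (Du j) := (LDu j).1.
have mDw j : cmeasurable (@ball1 R) (Dw j) := (LDw j).1.
have [[_ _ _ [p1 [sp1 _ cp1 _]]] [_ _ _ [p2 [sp2 _ cp2 _]]]] := trace_real_parts mB mu mDu tu.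
have [[_ _ _ [q1 [sq1 _ cq1 _]]] [_ _ _ [q2 [sq2 _ cq2 _]]]] := trace_real_parts mB mw mDw tw.
have [du1 du2] := L2_parts mB (LDu i); have [dw1 dw2] := L2_parts mB (LDw i).
have T (phi : R3 -> R) K : smooth phi -> compact K -> K `<=` @ball1 R -> (forall x, ~ K x -> phi x = 0) ->
    cint (@ball1 R) (fun x => Dw i x * (phi x)%:C) = cint (@ball1 R) (fun x => Du i x * (phi x)%:C).
  move=> sphi cK K1 p0.
  have cphi : csmooth (fun x => (phi x)%:C) by split => //; exact: smooth_cst.
  have tphi : test_function (@ball1 R) (fun x => (phi x)%:C).
    by split => //; exists K; split => // x /p0 /= ->.
  apply: oppr_inj; rewrite -(wu _ tphi) -(ww _ tphi); apply: ae_eq_cint => //.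
  - by apply: cmeasurableM => //; exact: csmooth_cpartial_cmeasurable.
  - by apply: cmeasurableM => //; exact: csmooth_cpartial_cmeasurable.
  - by apply: filterS wE => x /[apply] ->.
have E1 : {ae leb3, forall x, ball1 x -> Re (Dw i x) = Re (Du i x)}.
  apply: (@L2_test_unique _ _ (fun k x => 'D_(basis i) (q1 k) x) (fun k x => 'D_(basis i) (p1 k) x)) => //.
  - exact: (mDw i).1.
  - exact: (mDu i).1.
  - by move=> k; exact: smooth_derive.
  - by move=> k; exact: smooth_derive.
  move=> phi K sphi cK K1 p0; have := congr1 Re (T phi K sphi cK K1 p0).
  by rewrite /cint/=; under eq_Rintegral do rewrite cReM /= mulr0 subr0;
     under [in X in _ = X -> _]eq_Rintegral do rewrite cReM /= mulr0 subr0.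
have E2 : {ae leb3, forall x, ball1 x -> Im (Dw i x) = Im (Du i x)}.
  apply: (@L2_test_unique _ _ (fun k x => 'D_(basis i) (q2 k) x) (fun k x => 'D_(basis i) (p2 k) x)) => //.
  - exact: (mDw i).2.
  - exact: (mDu i).2.
  - by move=> k; exact: smooth_derive.
  - by move=> k; exact: smooth_derive.
  move=> phi K sphi cK K1 p0; have := congr1 Im (T phi K sphi cK K1 p0).
  by rewrite /cint/=; under eq_Rintegral do rewrite cImM /= mulr0 add0r;
     under [in X in _ = X -> _]eq_Rintegral do rewrite cImM /= mulr0 add0r.
apply: filterS2 E1 E2 => x e1 e2 xB.
by rewrite [LHS]complexE [RHS]complexE e1// e2.
Qed.

End GradientUniqueness.

(** * Stability *)

Section Stability.
Context {R : realType}.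
Local Notation R3 := (R * R * R)%type.
Local Notation leb3 := (@leb3 R).
Local Notation Re := (@complex.Re R).
Local Notation Im := (@complex.Im R).

(** The normalization v(0) = 0, v'(0) = 1 is imposed at the center and the amplitude [a] then solves
    the boundary condition. Only the product of |a| and [M] is bounded, because each factor alone
    depends on the layers. *)
Lemma layered_solution (n : nat) (xs k : nat -> R) (cmin cmax om : R) (b : R[i]) :
  0 < cmin -> cmin <= cmax -> 0 < om ->
  xs 0%N = 0 -> xs n.+1 = 1 -> (forall i, (i <= n)%N -> xs i < xs i.+1) ->
  (forall i, (i <= n)%N -> om / cmax <= k i <= om / cmin) ->
  exists (v v1 V V1 : R -> R) (a : R[i]) (M : R),
  [/\ forall r : R, is_derive r 1 v (v1 r), continuous v1 &
      forall i (r : R), (i <= n)%N -> xs i < r < xs i.+1 -> is_derive r 1 v1 (- (k i ^+ 2 * v r))] /\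
  [/\ forall t : R, is_derive t 1 V (V1 t), continuous V1,
      forall r : R, 0 < r -> V (r ^+ 2) = v r / r &
      forall r : R, 0 < r -> V1 (r ^+ 2) = (r * v1 r - v r) / (2 * r ^+ 3)] /\
  [/\ v 0 = 0, 0 <= M,
      forall r : R, 0 <= r <= 1 -> `|v r| <= M * r /\
        `|r * v1 r - v r| <= (om / cmin) ^+ 2 * M * r ^+ 3,
      a * ((v1 1)%:C - (0 +i* k n) * (v 1)%:C) = b &
      Normc.normc a * M = Normc.normc b * ((1 + cmax) * expR ((1 + cmin ^- 2) * om))].
Proof.
move=> cmin0 cc om0 x0 x1 xlt kb.
have cmax0 : 0 < cmax by exact: lt_le_trans cc.
have k0 i : (i <= n)%N -> 0 < k i.
  by move=> /kb/andP[+ _]; apply: lt_le_trans; rewrite divr_gt0.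
have kQ i : (i <= n)%N -> k i ^+ 2 <= (om / cmin) ^+ 2.
  move=> ni; have /andP[_ h] := kb i ni.
  by rewrite ler_pXn2r// ?nnegrE ?(ltW (k0 i ni))// divr_ge0// ltW.
have [v [v1 [dv cv1 dv1 vs]]] := layered_ode xlt (fun i ni => lt0r_neq0 (k0 i ni)).
have X1 : 0 < xs 1%N by rewrite -x0; exact: xlt.
have kn0 : k 0%N != 0 by rewrite lt0r_neq0// k0.
have [V [V1 [dV cV1 VE V1E]]] := radial_profile X1 kn0 dv cv1 vs.
have v0 : v 0 = 0 by rewrite vs// mulr0 sin0 mul0r.
have v10 : v1 0 = 1.
  have H : is_derive (0 : R) (1 : R) v (1 : R).
    have Ev : {near (0 : R), (fun r => 0 * cos (k 0%N * (r - 0)) + 1 / k 0%N * sin (k 0%N * (r - 0))) =1 v}.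
      near=> s; rewrite vs; last by near: s; exact: lt_nbhsl.
      by rewrite mul0r add0r subr0 div1r mulrC.
    apply: (near_eq_is_derive Ev).
    have h := is_derive_wave 0 1 0 kn0 0.
    by apply: (is_derive_ext h) => //; rewrite subr0 mulr0 cos0 !mul0r subr0 mulr1.
  by have [_ <-] := H; have [_ <-] := dv 0.
pose K := 1 + cmin ^- 2; pose Q := (om / cmin) ^+ 2.
have cm2 : 0 <= cmin ^- 2 by rewrite invr_ge0 sqr_ge0.
have K0 : 0 <= K by rewrite addr_ge0.
(* The first square is om^2 and the second at most cmin^-2 om^2; K is the sum of the two factors. *)
have kK i : (i <= n)%N -> `|om ^+ 2 - k i ^+ 2| <= K * om ^+ 2.
  move=> /kQ; rewrite expr_div_n [_ / _]mulrC => h.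
  have h2 := sqr_ge0 (k i); have h3 := sqr_ge0 om; have h4 := mulr_ge0 cm2 h3.
  by rewrite /K mulrDl mul1r ler_norml; apply/andP; split; lra.
have EE := energy_estimate om0 K0 xlt kK dv cv1 dv1.
rewrite x0 x1 in EE.
pose E r := v1 r ^+ 2 + om ^+ 2 * v r ^+ 2.
(* The boundary operator applied to v. Its modulus controls the energy at 1, because om <= cmax k_n
   bounds om^2 v(1)^2 by a multiple of k_n^2 v(1)^2. *)
pose d : R[i] := (v1 1)%:C - (0 +i* k n) * (v 1)%:C.
have dE : Normc.normc d ^+ 2 = v1 1 ^+ 2 + k n ^+ 2 * v 1 ^+ 2.
  by rewrite normc_sqr /=; ring.
pose P := expR (K * om).
have P1 : 1 <= P by rewrite -expR0 ler_expR mulr_ge0// ltW.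
(* Proportional to |d|, so that |d| cancels in |a| M with a = b / d. The factor [P] appears without
   a square root: E r <= E 1 * P, and P <= P^2 as P >= 1. *)
pose M := (1 + cmax) * Normc.normc d * P.
have M0 : 0 <= M by rewrite !mulr_ge0// ?normc_ge0 ?addr_ge0 ?expR_ge0// ltW.
have E0 (r : R) : 0 <= E r by apply: addr_ge0; [exact: sqr_ge0|apply: mulr_ge0; exact: sqr_ge0].
have EM (r : R) : 0 <= r -> r <= 1 -> E r <= M ^+ 2.
  move=> r0 r1.
  apply: (@le_trans _ _ (E 1 * P)).
    have := EE r 1 r0 r1 (lexx _); rewrite mulr1; apply: le_trans.
    rewrite ler_peMr// -expR0 ler_expR !mulr_ge0// ltW//.
  have h1 : E 1 <= (1 + cmax) ^+ 2 * Normc.normc d ^+ 2.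
    rewrite dE mulrDr; apply: lerD.
      by rewrite ler_peMl ?sqr_ge0// exprn_ege1// lerDl ltW.
    rewrite mulrA ler_wpM2r ?sqr_ge0// -exprMn ler_pXn2r ?nnegrE ?(ltW om0)//; last first.
      by rewrite ltW// mulr_gt0 ?k0// addr_gt0.
    have /andP[h _] := kb n (leqnn n); move: h; rewrite ler_pdivrMr// => h.
    by apply: le_trans h _; rewrite mulrC ler_wpM2r ?(ltW (k0 n _))// lerDr.
  rewrite /M !exprMn; apply: ler_pM => //; first by rewrite expR_ge0.
  by rewrite expr2 ler_peMl// expR_ge0.
have v1M (r : R) : 0 <= r <= xs n.+1 -> `|v1 r| <= M.
  rewrite x1 => /andP[r0 r1]; rewrite -(ler_pXn2r (n := 2)) ?nnegrE// real_normK ?num_real//.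
  by apply: le_trans (EM r r0 r1); rewrite lerDl mulr_ge0 ?sqr_ge0.
have fl := radial_flux_estimate x0 M0 xlt kQ dv cv1 dv1 v0 v1M; rewrite x1 in fl.
(* If d were 0, then M = 0, and the energy at the center would vanish, although v'(0) = 1. *)
have dn0 : d != 0.
  apply/eqP => d0; have := EM 0 (lexx _) ler01.
  by rewrite /M d0 Normc.normc0 mulr0 mul0r expr0n/= /E v0 v10 expr1n expr0n/= mulr0 addr0 ler10.
exists v, v1, V, V1, (b / d), M; split => //; split => //; split => //.
  by rewrite -/d divfK.
rewrite Normc.normcM Normc.normcV /M -/P; field.
by apply/eqP => /Normc.eq0_normc/eqP; rewrite (negbTE dn0).
Unshelve. all: by end_near. Qed.

Lemma sqnorm2_le (D : set R3) (f : cfun) (S : R) : measurable D -> (leb3 D < +oo)%E ->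
  cmeasurable D f -> 0 <= S -> {ae leb3, forall x, D x -> Normc.normc (f x) <= S} ->
  (sqnorm2 D f <= (S ^+ 2 * fine (leb3 D))%:E)%E.
Proof.
move=> mD fD [m1 m2] S0 fS; rewrite sqnorm2E.
have fDn : leb3 D \is a fin_num by rewrite ge0_fin_numE.
apply: (@le_trans _ _ (\int[leb3]_(x in D) (S ^+ 2)%:E)%E); last first.
  by rewrite integral_cst//= -{1}(fineK fDn) -EFinM.
apply: ae_ge0_le_integral => //.
- by move=> x _; rewrite lee_fin addr_ge0 ?sqr_ge0.
- by apply/measurable_EFinP; apply: measurable_funD; exact: measurable_funX.
- by move=> x _; rewrite lee_fin sqr_ge0.
by apply: filterS fS => x /[apply] h; rewrite lee_fin -normc_sqr ler_pXn2r ?nnegrE ?normc_ge0.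
Qed.

Lemma normc_real_scale (a : R[i]) (t : R) :
  Normc.normc ((Re a * t) +i* (Im a * t)) = Normc.normc a * `|t|.
Proof.
apply/eqP; rewrite -(eqrXn2 (n := 2))// ?mulr_ge0 ?normc_ge0//.
by rewrite [X in _ == X]exprMn !normc_sqr real_normK ?num_real//=; apply/eqP; ring.
Qed.

Lemma layer_value_bounds (cmin cmax c1 c2 : R) (j : nat) :
  cmin <= c1 <= cmax -> cmin <= c2 <= cmax -> cmin <= layer_value c1 c2 j <= cmax.
Proof. by rewrite /layer_value; case: odd. Qed.

Lemma layer_wavenumber_bounds (cmin cmax om c1 c2 : R) (j : nat) : 0 < cmin -> 0 < om ->
  cmin <= c1 <= cmax -> cmin <= c2 <= cmax ->
  om / cmax <= om / layer_value c1 c2 j <= om / cmin.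
Proof.
move=> cmin0 om0 h1 h2; have /andP[l1 l2] := layer_value_bounds j h1 h2.
have l0 : 0 < layer_value c1 c2 j by exact: lt_le_trans l1.
by rewrite !ler_pM2l// !lef_pV2 ?posrE// ?l1 ?l2// (lt_le_trans l0).
Qed.

Lemma enorm_axis (r : R) : 0 <= r -> enorm ((r, 0, 0) : R3) = r.
Proof. by move=> r0; rewrite /enorm/= expr0n/= !addr0 sqrtr_sqr ger0_norm. Qed.

(* The restriction of the squared wave number to a ray, truncated to be bounded
   also off the layers. *)
Definition ray_potential (c : R3 -> R) (om Q r : R) : R :=
  Num.min ((om / c (r, 0, 0)) ^+ 2) Q.

Lemma measurable_ray_potential (c : R3 -> R) (om Q : R) : measurable_fun setT c ->
  measurable_fun setT (ray_potential c om Q).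
Proof.
move=> mc; apply: measurable_minr; last exact: measurable_cst.
apply: measurable_funX; apply: measurable_funM => //.
apply: (measurableT_comp measurable_invr); apply: (measurableT_comp mc).
by apply: measurable_fun_pair; [apply: measurable_fun_pair|].
Qed.

Lemma ray_potential_layer (n : nat) (xs : nat -> R) (c1 c2 om Q : R) (c : R3 -> R) (i : nat) (r : R) :
  layered n xs c1 c2 c -> 0 <= xs i -> (i <= n)%N -> xs i < r < xs i.+1 ->
  (om / layer_value c1 c2 i.+1) ^+ 2 <= Q ->
  ray_potential c om Q r = (om / layer_value c1 c2 i.+1) ^+ 2.
Proof.
move=> [_ lc] x0 ni ri kQ; rewrite /ray_potential (lc i.+1) ?ni//=.
  by apply/min_idPl.
by rewrite enorm_axis// (le_trans x0)//; case/andP: ri => /ltW.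
Qed.

End Stability.

(** * Pointwise bounds for the explicit radial solution *)

Section Bounds.
Context {R : realType}.
Local Notation R3 := (R * R * R)%type.
Local Notation Re := (@complex.Re R).
Local Notation Im := (@complex.Im R).

Context (v v1 V V1 : R -> R) (a : R[i]) (M Q : R)
  (VE : forall r : R, 0 < r -> V (r ^+ 2) = v r / r)
  (V1E : forall r : R, 0 < r -> V1 (r ^+ 2) = (r * v1 r - v r) / (2 * r ^+ 3))
  (vM : forall r : R, 0 <= r <= 1 -> `|v r| <= M * r /\ `|r * v1 r - v r| <= Q * M * r ^+ 3).

Local Notation u := (cradial (fun t => Re a * V t) (fun t => Im a * V t)).
Local Notation Du := (cradial_grad (fun t => Re a * V1 t) (fun t => Im a * V1 t)).

Lemma normc_radial_le (x : R3) : 0 < enorm x < 1 -> Normc.normc (u x) <= Normc.normc a * M.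
Proof.
move=> /andP[x0 x1]; rewrite /cradial /radial normc_real_scale ler_wpM2l ?normc_ge0//.
rewrite sqnormE VE// normrM normfV (gtr0_norm x0) ler_pdivrMr//.
by apply: (vM _).1; rewrite !ltW.
Qed.

Lemma radial_slope_le (r : R) : 0 < r < 1 -> `|V1 (r ^+ 2)| <= Q * M / 2.
Proof.
move=> /andP[r0 r1]; rewrite V1E// normrM normfV.
have r3 : 0 < 2 * r ^+ 3 by rewrite mulr_gt0// exprn_gt0.
rewrite (gtr0_norm r3) ler_pdivrMr// (_ : Q * M / 2 * (2 * r ^+ 3) = Q * M * r ^+ 3); last by field.
by apply: (vM _).2; rewrite !ltW.
Qed.

Lemma normc_radial_grad_le (x : R3) i : 0 < enorm x < 1 ->
  Normc.normc (Du i x) <= Normc.normc a * (Q * M).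
Proof.
move=> x01; have /andP[x0 x1] := x01; rewrite /cradial_grad /radial_grad.
rewrite [2 * _ * _]mulrCA [2 * _ * (Im a * _)]mulrCA normc_real_scale ler_wpM2l ?normc_ge0//.
rewrite sqnormE normrM (_ : Q * M = 2 * (Q * M / 2)); last by field.
apply: ler_pM => //; last exact: radial_slope_le.
by rewrite normrM normr_nat ler_piMr//; exact: le_trans (le_coord _ _) (ltW x1).
Qed.

(** The gradient of a V(|x|^2) is 2 a V1(|x|^2) x, so its length is exactly 2 |a| |V1(|x|^2)|
    |x|. *)
Lemma vnorm_radial_grad_le (x : R3) : 0 < enorm x < 1 ->
  vnorm (Du ^~ x) <= Normc.normc a * (Q * M) * enorm x.
Proof.
move=> x01; have /andP[x0 x1] := x01; have h := radial_slope_le x01.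
have E i : Normc.normc (Du i x) ^+ 2 =
    (coord x i * coord x i) * (2 * Normc.normc a * `|V1 (enorm x ^+ 2)|) ^+ 2.
  rewrite /cradial_grad /radial_grad [2 * _ * _]mulrCA [2 * _ * (Im a * _)]mulrCA normc_real_scale.
  rewrite sqnormE !exprMn !real_normK ?num_real//; ring.
rewrite /vnorm; under eq_bigr do rewrite E.
rewrite -mulr_suml -sqnorm_coord sqnormE -exprMn sqrtr_sqr ger0_norm; last first.
  by rewrite !mulr_ge0// ?normc_ge0// ltW.
rewrite mulrC ler_pM2r// (_ : 2 * _ * _ = Normc.normc a * (2 * `|V1 (enorm x ^+ 2)|)); last by ring.
by rewrite ler_wpM2l ?normc_ge0//; lra.
Qed.

End Bounds.

Theorem theorem3p7 (R : realType) (cmin cmax : R)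
    (hcmin : 0 < cmin) (hcmax : cmin <= cmax) :
  exists C alpha : R, [/\ 0 < C, 1 < alpha &
    forall (omega0 omega : R) (n : nat) (xs : nat -> R) (c1 c2 : R)
      (c : R * R * R -> R) (g0 : R[i]) (u : cfun) (Du : cfield),
    0 < omega0 -> omega0 <= omega ->
    xs 0%N = 0 -> xs n.+1 = 1 ->
    (forall i : nat, (i <= n)%N -> xs i < xs i.+1) ->
    cmin <= c1 <= cmax -> cmin <= c2 <= cmax ->
    layered n xs c1 c2 c ->
    the_weak_solution omega (omega / layer_value c1 c2 n.+1) c
      (fun xi => g0 * Y00 xi) u Du ->
    (energy_norm omega c u Du
       <= (C * Normc.normc g0 * alpha `^ omega)%:E)%E
    /\ exists ut : cfun, C1_representative ball1 u ut /\
         forall (r : R) (xi : R * R * R), 0 < r < 1 -> sphere xi ->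
           Normc.normc (ut (r *: xi)) <= C * alpha `^ omega * Normc.normc g0
           /\ vnorm (cpartial ut ^~ (r *: xi))
                <= C * r * alpha `^ omega * Normc.normc g0].
Proof.
pose K := 1 + cmin ^- 2.
pose Y := (Num.sqrt (@sphere_area R))^-1.
pose L := fine (leb3 (@ball1 R)).
(* The factors come, in this order, from the boundary condition, from [Y00], from absorbing 1 +
   (omega/cmin)^2 into exp(omega), and from the energy norm over a ball of volume [L]. The last 1
   makes [C] positive. *)
pose C := (1 + cmax) * Y * (1 + 2 * cmin ^- 2) * (1 + 2 * Num.sqrt L) + 1.
have cm2 : 0 < cmin ^- 2 by rewrite invr_gt0 exprn_gt0.
have cmax0 : 0 < cmax by exact: lt_le_trans hcmax.
have Y0 : 0 <= Y by rewrite invr_ge0 sqrtr_ge0.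
have L0 : 0 <= L by rewrite fine_ge0.
have sL0 : 0 <= Num.sqrt L by rewrite sqrtr_ge0.
exists C, (expR (K + 1)); split.
- by rewrite ltr_wpDl// !mulr_ge0// ?addr_ge0// ?mulr_ge0// ltW.
- by rewrite -[ltLHS]expR0 ltr_expR /K; lra.
move=> omega0 omega n xs c1 c2 c g0 u Du o0 oo x0 x1 xlt hc1 hc2 lay [[Hu [h [F [tu _ _]]]] uniq].
have om0 : 0 < omega by exact: lt_le_trans oo.
(* The layer between [xs i] and [xs i.+1] bears the number i + 1 in [layered]; in particular [k n]
   is the wave number at the boundary. *)
pose k i := omega / layer_value c1 c2 i.+1.
have kb i : (i <= n)%N -> omega / cmax <= k i <= omega / cmin by move=> _; exact: layer_wavenumber_bounds.
pose b := g0 * Y%:C.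
have [v [v1 [V [V1 [a [M [[dv cv1 dv1] [[dV cV1 VE V1E] [v0 M0 vM ab aM]]]]]]]]] :=
  layered_solution b hcmin hcmax om0 x0 x1 xlt kb.
pose Q := (omega / cmin) ^+ 2.
have Q0 : 0 <= Q by exact: sqr_ge0.
have kQ i : k i ^+ 2 <= Q.
  have /andP[k1 k2] := layer_wavenumber_bounds i.+1 hcmin om0 hc1 hc2.
  have k0 : 0 <= k i by apply: le_trans k1; rewrite divr_ge0// ltW.
  by rewrite ler_pXn2r// nnegrE// (le_trans k0).
have xs0 i : (i <= n)%N -> 0 <= xs i by move=> ni; rewrite -x0; exact: (layer_bounds xlt ni).1.
pose q := ray_potential c omega Q.
have qk i (r : R) : (i <= n)%N -> xs i < r < xs i.+1 -> q r = k i ^+ 2.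
  by move=> ni ri; apply: (ray_potential_layer lay (xs0 i ni) ni ri); exact: kQ.
have qQ (r : R) : `|q r| <= Q.
  by rewrite ger0_norm /q /ray_potential ?ge_min ?lexx ?orbT// le_min sqr_ge0.
have aelay := @ae_layer R n xs x0 x1.
have kc (x : R * R * R) i : (i <= n)%N -> xs i < enorm x < xs i.+1 -> omega / c x = k i.
  by move=> ni ri; rewrite (lay.2 i.+1)// ?ni.
have cq : {ae leb3, forall x, ball1 x -> (omega / c x) ^+ 2 = q (enorm x)}.
  by apply: filterS aelay => x /[apply] -[i ni ri]; rewrite (kc x i)// (qk i).
have kn0 : 0 < k n by apply: lt_le_trans (andP (kb n (leqnn n))).1; rewrite divr_gt0.
have vK (r : R) : 0 <= r <= 1 -> `|v r| <= M * (1 + Q) * r /\ `|r * v1 r - v r| <= M * (1 + Q) * r ^+ 2.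
  move=> r01; have [h1 h2] := vM r r01; have /andP[r0 r1] := r01.
  have Mr := mulr_ge0 M0 r0; have QM := mulr_ge0 Q0 M0.
  split; first by apply: le_trans h1 _; rewrite mulrAC ler_peMr// lerDl.
  apply: le_trans h2 _; apply: (@le_trans _ _ (Q * M * r ^+ 2)).
    by rewrite ler_wpM2l// exprS ler_piMl// sqr_ge0.
  by rewrite ler_wpM2r ?sqr_ge0// mulrDr mulr1 [M * Q]mulrC lerDr.
have MQ0 : 0 <= M * (1 + Q) by rewrite mulr_ge0// addr_ge0.
set w := cradial (fun t => complex.Re a * V t) (fun t => complex.Im a * V t).
set Dw := cradial_grad (fun t => complex.Re a * V1 t) (fun t => complex.Im a * V1 t).
have Ww : weak_solution omega (k n) c (fun=> b) w Dw.
  exact: (ball_weak_solution x0 x1 xlt dv cv1 dv1 dV cV1 VE V1E (measurable_ray_potential _ _ lay.1)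
    qk MQ0 Q0 qQ v0 vK kn0 lay.1 cq ab).
have wu_ae := uniq w Dw Ww.
have [Hw [h' [F' [tw _ _]]]] := Ww.
have Dwu := weak_gradient_unique Hu tu Hw tw wu_ae.
pose A := Normc.normc a * M.
have A0 : 0 <= A by rewrite mulr_ge0// normc_ge0.
pose al := expR (K + 1) `^ omega.
have alE : al = expR (K * omega) * expR omega by rewrite /al -expRM mulrDl mul1r expRD.
(* Uses omega^2 <= 2 exp(omega), from the quadratic term of the exponential series, so the constant
   is independent of omega. *)
have Qe : 1 + Q <= (1 + 2 * cmin ^- 2) * expR omega.
  have e1 := expR_ge1Dxn 1 (ltW om0); have e2 := expR_ge1Dx omega.
  rewrite /Q expr_div_n mulrDl mul1r; apply: lerD; first by lra.
  rewrite [leLHS]mulrC -[2 * _]mulrC -mulrA ler_pM2l//.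
  by move: e1; rewrite (_ : 2`! = 2)%N//; lra.
have AE : A = Normc.normc g0 * (Y * ((1 + cmax) * expR (K * omega))).
  rewrite /A aM /b Normc.normcM -mulrA; congr (_ * (_ * _)).
  by rewrite normc_real ger0_norm.
have g00 : 0 <= Normc.normc g0 by exact: normc_ge0.
have e0 : 0 <= expR (K * omega) by exact: expR_ge0.
have bound : A * (1 + Q) * (1 + 2 * Num.sqrt L) <= C * Normc.normc g0 * al.
  apply: (@le_trans _ _ ((C - 1) * Normc.normc g0 * al)); last first.
    by rewrite ler_wpM2r ?powR_ge0// ler_wpM2r// gerBl.
  have -> : (C - 1) * Normc.normc g0 * al = Normc.normc g0 * (Y * ((1 + cmax) * expR (K * omega))) *
      ((1 + 2 * cmin ^- 2) * expR omega) * (1 + 2 * Num.sqrt L) by rewrite /C alE; ring.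
  rewrite AE ler_wpM2r ?addr_ge0 ?mulr_ge0// ler_wpM2l//.
  by rewrite !mulr_ge0// addr_ge0// ltW.
have c1ball (f f1 : R -> R) : (forall t : R, is_derive t 1 f (f1 t)) -> continuous f1 -> C1_on (@ball1 R) (radial f).
  move=> df cf x _; have [c0 cD] := C1_radial df cf; split; first exact: c0.
  by move=> i; split; [exact: (cD i).1|exact: (cD i).2].
pose T := A * (1 + Q).
have T0 : 0 <= T by rewrite mulr_ge0// addr_ge0.
have AT : A <= T by rewrite /T ler_peMr// lerDl.
have AQT : A * Q <= T by rewrite /T ler_wpM2l// lerDr.
have TC (t : R) : t <= T -> t <= C * al * Normc.normc g0.
  move=> tT; rewrite mulrAC; apply: le_trans bound; apply: le_trans tT _.
  by rewrite -/T ler_peMr// lerDl mulr_ge0.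
have mB : measurable (@ball1 R) by exact: (measurable_eball 1).
have fB : (leb3 (@ball1 R) < +oo)%E by exact: (leb3_ball_lty 1).
have aepos : {ae leb3, forall x : R * R * R, ball1 x -> 0 < enorm x < 1}.
  apply: filterS aelay => x H xB; have [i ni /andP[xi _]] := H xB.
  by rewrite (le_lt_trans (xs0 i ni) xi).
split.
  have [[mu _] LDu _] := Hu.
  have bD i : (sqnorm2 (@ball1 R) (Du i) <= (T ^+ 2 * L)%:E)%E.
    apply: sqnorm2_le => //; first by case: (LDu i).
    apply: filterS2 aepos (Dwu i) => x h1 h2 xB; rewrite -h2//.
    apply: le_trans (normc_radial_grad_le a V1E vM i (h1 xB)) _.
    by apply: le_trans AQT; rewrite /A -mulrA [M * Q]mulrC.
  have bu : (sqnorm2 (@ball1 R) (fun x => ((omega / c x)%:C * u x)%R) <= (T ^+ 2 * L)%:E)%E.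
    apply: sqnorm2_le => //.
      apply: cmeasurableM => //; apply: cmeasurable_real.
      apply: measurable_funM => //; apply: (measurable_funS measurableT) => //.
      exact: (measurableT_comp measurable_invr lay.1).
    apply: filterS3 aepos wu_ae aelay => x h1 h2 h3 xB; have [i ni ri] := h3 xB.
    have ki : 0 <= k i by apply: le_trans (andP (kb i ni)).1; rewrite divr_ge0// ltW.
    rewrite -h2// (kc x i)// Normc.normcM normc_real ger0_norm//.
    apply: (@le_trans _ _ (k i * A)); first by rewrite ler_wpM2l//; exact: normc_radial_le VE vM _ (h1 xB).
    (* From k_i^2 <= Q it follows that k_i <= 1 + Q. *)
    by rewrite /T mulrC ler_wpM2l//; have := kQ i; nra.
  (* Three partial derivatives and the weighted function contribute at most T^2 L each; the root of
     4 T^2 L is 2 T sqrt(L). *)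
  apply: (@le_trans _ _ (sqrte ((2 * T * Num.sqrt L) ^+ 2)%:E)).
    rewrite lee_sqrt ?lee_fin ?sqr_ge0//.
    rewrite !big_ord_recl big_ord0 adde0 exprMn sqr_sqrtr//.
    rewrite (_ : (2 * T) ^+ 2 * L = T ^+ 2 * L + (T ^+ 2 * L + T ^+ 2 * L) + T ^+ 2 * L); last by ring.
    by rewrite !EFinD; apply: leeD => //; apply: leeD => //; apply: leeD.
  have nn : 0 <= 2 * T * Num.sqrt L by apply: mulr_ge0 => //; apply: mulr_ge0.
  rewrite /= sqrtr_sqr ger0_norm// lee_fin; apply: le_trans bound.
  by rewrite -/T [2 * T]mulrC -mulrA ler_wpM2l// lerDr.
have dZ (s t : R) : is_derive t 1 (fun t => s * V t) (s * V1 t) by exact: is_deriveZ.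
have cZ (s : R) : continuous (fun t => s * V1 t).
  by move=> t; apply: cvgM; [exact: cvg_cst|exact: cV1].
exists w; split.
  by split => //; [exact: c1ball (dZ _) (cZ _)|exact: c1ball (dZ _) (cZ _)].
move=> r xi r01 xi1; have /andP[r0 r1] := r01.
have er : enorm (r *: xi) = r by rewrite enormZ_ge0 ?ltW// xi1 mulr1.
have r01' : 0 < enorm (r *: xi) < 1 by rewrite er.
split; first by apply: TC; apply: le_trans AT; exact: normc_radial_le VE vM _ r01'.
have -> : (cpartial w ^~ (r *: xi)) = (Dw ^~ (r *: xi)).
  apply/funext => i; rewrite /cpartial; congr (_ +i* _).
    by have [_ e] := is_derive_radial i (r *: xi) (dZ (complex.Re a)).
  by have [_ e] := is_derive_radial i (r *: xi) (dZ (complex.Im a)).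
apply: le_trans (vnorm_radial_grad_le a V1E vM r01') _.
rewrite er -/al (_ : C * r * al * _ = (C * al * Normc.normc g0) * r); last by ring.
apply: ler_wpM2r; [exact: ltW|apply: TC; apply: le_trans AQT].
by rewrite /A -[leRHS]mulrA [M * Q]mulrC.
Qed.
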